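(* Let $\Delta$ be a locally subelliptic diffusion operator on a smooth manifold $M$ which is essentially self-adjoint on the space $C_0^\infty(M)$ of smooth compactly supported functions with respect to a measure $\mu$ on $M$. Assume that $\Delta$ generates a diffusion process $((X_t)_{t\ge 0},(\mathbb{P}_x)_{x\in M})$ which is not explosive. Let $\Phi$ be a bounded Borel function on $[0,+\infty)$. If there exists a finite complex Borel measure $\alpha$ on $[0,+\infty)$ such that for every $x\in[0,+\infty)$, $$\Phi(x)=\int_0^{+\infty}\left(1-\frac{m}{\sqrt{m^2+x}}\right)d\alpha(m),$$ then, for every $p>1$ and $f\in L^p(M,\mu)$, $$\|\Phi(-\Delta)f\|_p\le 2(p^*-1)\,|\alpha|([0,+\infty))\,\|f\|_p,$$ where $p^*=\max\{p,\frac{p}{p-1}\}$.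
   Context: A diffusion operator $\Delta$ on $M$ is a second order operator which in local charts reads $\Delta=\sum_{i,j}\sigma_{ij}(x)\partial_{x_i}\partial_{x_j}+\sum_i c_i(x)\partial_{x_i}$ with smooth real coefficients and $(\sigma_{ij}(x))$ symmetric and nonnegative. It is locally subelliptic (Fefferman–Phong) if every point has a relatively compact coordinate neighbourhood $\Omega$ for which there are $C,\varepsilon>0$ with $\|u\|_{H^\varepsilon}^2\le C\left(\left|\int u\,\Delta u\right|+\|u\|_{L^2}^2\right)$ for all $u\in C_0^\infty(\Omega)$, where $H^\varepsilon$ is the usual Sobolev space. The measure $\mu$ is smooth (given in every chart by a smooth density) and $\Delta$ is symmetric with respect to it: $\int g\Delta f\,d\mu=\int f\Delta g\,d\mu$ for $f,g\in C_0^\infty(M)$; the self-adjoint extension is still denoted $\Delta$. $\Phi(-\Delta)$ is defined on $L^2(M,\mu)$ by the spectral theorem; the conclusion means that the inequality holds on $L^2\cap L^p$, so that $\Phi(-\Delta)$ extends to a bounded operator on $L^p(M,\mu)$ satisfying it. $|\alpha|$ is the total variation measure of $\alpha$ and $\|\cdot\|_p$ is the norm of $L^p(M,\mu)$. In the integrand, $\frac{m}{\sqrt{m^2+x}}$ is read as $0$ when $m=0$ (including at $x=0$). *)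

(* Defs.v *)
From HB Require Import structures.
From mathcomp Require Import all_boot all_order all_algebra.
From mathcomp Require Import all_classical all_reals all_analysis.
From mathcomp Require Import measurable_realfun complex.

Set Implicit Arguments.
Unset Strict Implicit.
Unset Printing Implicit Defensive.

Import Order.TTheory GRing.Theory Num.Theory.
Import numFieldNormedType.Exports.

Local Open Scope classical_set_scope.
Local Open Scope ring_scope.
Local Open Scope complex_scope.

Notation borel T := (g_sigma_algebraType (@open T)).
Notation Rez := (@complex.Re _).
Notation Imz := (@complex.Im _).
Notation opc := one_point_compactification.

Section lebesgue_tuple.
Context {R : realType}.
Local Notation mR := (measurableTypeR R).

Definition tuple_cons (n : nat) (p : mR * n.-tuple mR) : n.+1.-tuple mR :=
  [the n.+1.-tuple mR of p.1 :: p.2].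

Lemma measurable_tuple_cons (n : nat) :
  measurable_fun [set: mR * n.-tuple mR] (@tuple_cons n).
Proof. by apply: measurable_cons; [exact: measurable_fst|exact: measurable_snd]. Qed.

Section step.
Variables (n : nat) (m : {sigma_finite_measure set (n.-tuple mR) -> \bar R}).

Definition leb_cons : set (n.+1.-tuple mR) -> \bar R :=
  pushforward (@lebesgue_measure R \x m)%E (@tuple_cons n).

Let preim_meas A : measurable A -> measurable (@tuple_cons n @^-1` A).
Proof.
by move=> mA; rewrite -[X in measurable X]setTI; exact: measurable_tuple_cons.
Qed.

Let leb_cons0 : leb_cons set0 = 0%E.
Proof. by rewrite /leb_cons /pushforward preimage_set0 measure0. Qed.

Let leb_cons_ge0 A : (0 <= leb_cons A)%E.
Proof. by rewrite /leb_cons /pushforward measure_ge0. Qed.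

Let leb_cons_sigma_additive : semi_sigma_additive leb_cons.
Proof.
move=> F mF tF mUF; rewrite /leb_cons /pushforward preimage_bigcup.
apply: measure_semi_sigma_additive.
- by move=> k; exact: preim_meas.
- apply/trivIsetP => i j _ _ ij; rewrite -preimage_setI.
  by move/trivIsetP : tF => /(_ _ _ _ _ ij) ->//; rewrite preimage_set0.
- by rewrite -preimage_bigcup; exact: preim_meas.
Qed.

HB.instance Definition _ := isMeasure.Build _ _ _
  leb_cons leb_cons0 leb_cons_ge0 leb_cons_sigma_additive.

Let leb_cons_sigma_finite : sigma_finite setT leb_cons.
Proof.
have /sigma_finiteP[F [TF ndF Foo]] := sigma_finiteT (@lebesgue_measure R).
have /sigma_finiteP[G [TG ndG Goo]] := sigma_finiteT m.
have Kc (p : mR * n.-tuple mR) :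
    (thead (tuple_cons p), [tuple of behead (tuple_cons p)]) = p.
  by case: p => x t; congr pair; apply/val_inj.
pose g (t : n.+1.-tuple mR) := (thead t, [tuple of behead t]).
have mg : measurable_fun setT g.
  apply/measurable_fun_pairP; split; first exact: measurable_tnth.
  exact: measurable_behead.
exists (fun k => g @^-1` (F k `*` G k)).
  rewrite -preimage_bigcup (_ : \bigcup_k _ = setT) ?preimage_setT//.
  apply/seteqP; split => // -[x y] _.
  have [i _ Fx] : (\bigcup_k F k) x by rewrite -TF.
  have [j _ Gy] : (\bigcup_k G k) y by rewrite -TG.
  exists (maxn i j) => //; split => /=.
    by move: x Fx; exact/subsetPset/ndF/leq_maxl.
  by move: y Gy; exact/subsetPset/ndG/leq_maxr.
move=> k; have [? ?] := Foo k; have [? ?] := Goo k.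
have mFG : measurable (F k `*` G k) by exact: measurableX.
split; first by rewrite -[X in measurable X]setTI; exact: mg.
rewrite /leb_cons /pushforward (_ : _ @^-1` _ = F k `*` G k).
  by rewrite product_measure1E// lte_mul_pinfty// ge0_fin_numE.
by rewrite -comp_preimage (_ : g \o _ = id) ?preimage_id//; exact/funext/Kc.
Qed.

HB.instance Definition _ :=
  Measure_isSigmaFinite.Build _ _ _ leb_cons leb_cons_sigma_finite.

End step.

Fixpoint leb (n : nat) : {sigma_finite_measure set (n.-tuple mR) -> \bar R} :=
  match n with
  | 0 => dirac [tuple]
  | n'.+1 => leb_cons (leb n')
  end.

End lebesgue_tuple.

(** Lebesgue measure lives on [n.-tuple R], which carries the product
    sigma-algebra; points of R^n are row vectors, which carry the topology and
    the derivatives. *)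
Definition row_of (R : realType) (n : nat) (t : n.-tuple (measurableTypeR R)) :
  'rV[R]_n := \row_i tnth t i.

Section euclidean.
Context {R : realType} {n : nat}.
Implicit Types (f : 'rV[R]_n -> R) (U : set 'rV[R]_n).

Definition partial (i : 'I_n) f : 'rV[R]_n -> R :=
  fun x => 'D_(delta_mx 0 i : 'rV[R]_n) f x.

Definition iter_partial (s : seq 'I_n) f := foldr partial f s.

Definition smooth_on U f :=
  forall (s : seq 'I_n) (x : 'rV[R]_n), U x ->
    {for x, continuous (iter_partial s f)} /\
    forall i, derivable (iter_partial s f) x (delta_mx 0 i : 'rV[R]_n).

Definition integral_Rn f : R := (\int[leb n]_t f (row_of t))%R.

Definition dotv (x y : 'rV[R]_n) : R := \sum_(i < n) x 0 i * y 0 i.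

(** Real and imaginary parts (up to sign) of the Fourier transform
    [\int v(x) exp(-i x.xi) dx]. *)
Definition fourier_cos f (xi : 'rV[R]_n) : R :=
  integral_Rn (fun x => f x * cos (dotv x xi)).
Definition fourier_sin f (xi : 'rV[R]_n) : R :=
  integral_Rn (fun x => f x * sin (dotv x xi)).

(** Square of the norm of the Sobolev space H^eps(R^n). *)
Definition sobolev_norm_sq (eps : R) f : \bar R :=
  (\int[leb n]_t ((2 * pi) ^- n * (1 + dotv (row_of t) (row_of t)) `^ eps *
     (fourier_cos f (row_of t) ^+ 2 + fourier_sin f (row_of t) ^+ 2))%:E)%E.

End euclidean.

(** The values of [cmap] outside [cdom] and of [cinv] outside the image of the
    chart are irrelevant. *)
Record chart (R : realType) (n : nat) (M : Type) := Chart {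
  cdom : set M;
  cmap : M -> 'rV[R]_n;
  cinv : 'rV[R]_n -> M }.

Section manifold.
Context {R : realType} {n : nat} {M : ptopologicalType}.
Implicit Types (c : chart R n M) (atlas : set (chart R n M)) (f : M -> R).

Definition cimg c : set 'rV[R]_n := cmap c @` cdom c.

Definition is_chart c :=
  [/\ open (cdom c), open (cimg c),
      forall x, cdom c x -> cinv c (cmap c x) = x,
      forall x, cdom c x -> {for x, continuous (cmap c)}
    & forall y, cimg c y -> {for y, continuous (cinv c)}].

Definition smooth_transition c c' :=
  forall j : 'I_n, smooth_on (cmap c @` (cdom c `&` cdom c'))
    (fun y => cmap c' (cinv c y) 0 j).

(** [atlas] is a smooth structure: a maximal smooth atlas. *)
Definition smooth_manifold atlas :=
  [/\ hausdorff_space M, @second_countable M,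
      (forall c, atlas c -> is_chart c),
      (forall x, exists2 c, atlas c & cdom c x)
    & forall c, is_chart c ->
        (atlas c <-> forall c', atlas c' ->
           smooth_transition c c' /\ smooth_transition c' c)].

Definition smooth atlas f :=
  forall c, atlas c -> smooth_on (cimg c) (f \o cinv c).

Definition supp f : set M := closure [set x | f x != 0].

Definition Cc_smooth atlas f := smooth atlas f /\ compact (supp f).

(** Expression of [f] in the chart [c], extended by zero. *)
Definition in_chart c f : 'rV[R]_n -> R :=
  fun y => if y \in cimg c then f (cinv c y) else 0.

Definition diffusion_operator atlas (Delta : (M -> R) -> M -> R) :=
  forall c, atlas c ->
  exists (sigma : 'I_n -> 'I_n -> 'rV[R]_n -> R) (b : 'I_n -> 'rV[R]_n -> R),
  [/\ (forall i j, smooth_on (cimg c) (sigma i j)) /\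
      (forall i, smooth_on (cimg c) (b i)),
      forall y i j, cimg c y -> sigma i j y = sigma j i y,
      forall y (v : 'rV[R]_n), cimg c y ->
        0 <= \sum_(i < n) \sum_(j < n) sigma i j y * v 0 i * v 0 j
    & forall f y, smooth atlas f -> cimg c y ->
        Delta f (cinv c y) =
          \sum_(i < n) \sum_(j < n)
            sigma i j y * partial i (partial j (f \o cinv c)) y +
          \sum_(i < n) b i y * partial i (f \o cinv c) y].

Definition locally_subelliptic atlas (Delta : (M -> R) -> M -> R) :=
  forall x : M, exists c : chart R n M,
  [/\ atlas c, cdom c x, compact (closure (cdom c))
    & exists C eps : R, [/\ 0 < C, 0 < eps
      & forall u, Cc_smooth atlas u -> supp u `<=` cdom c ->
        (sobolev_norm_sq eps (in_chart c u) <=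
         (C * (`|integral_Rn (in_chart c (fun z => u z * Delta u z))| +
               integral_Rn (in_chart c (fun z => u z ^+ 2))))%:E)%E]].

Definition smooth_measure atlas (mu : {measure set (borel M) -> \bar R}) :=
  forall c, atlas c -> exists rho : 'rV[R]_n -> R,
  [/\ smooth_on (cimg c) rho,
      forall y, cimg c y -> 0 <= rho y
    & forall A : set (borel M), measurable A -> A `<=` cdom c ->
        mu A = (\int[leb n]_t
          (if row_of t \in cmap c @` A then rho (row_of t) else 0)%:E)%E].

Definition symmetric_wrt atlas (mu : {measure set (borel M) -> \bar R})
    (Delta : (M -> R) -> M -> R) :=
  forall f g, Cc_smooth atlas f -> Cc_smooth atlas g ->
    (\int[mu]_x (g x * Delta f x) = \int[mu]_x (f x * Delta g x))%R.

End manifold.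

Section complex_functions.
Context {d : measure_display} {T : measurableType d} {R : realType}.
Implicit Types (mu : {measure set T -> \bar R}) (f g u v : T -> R[i]).

Definition cmeasurable f :=
  measurable_fun setT (Rez \o f) /\ measurable_fun setT (Imz \o f).

Definition cnorm (p : R) mu f : \bar R :=
  Lnorm mu p%:E (fun x => (Normc.normc (f x))%:E).

Definition memLp (p : R) mu f := cmeasurable f /\ (cnorm p mu f < +oo)%E.

Definition ae_eqc mu f g := {ae mu, forall x, f x = g x}.

Definition inner mu f g : R[i] :=
  (\int[mu]_x Rez (f x * conjc (g x)))%R +i*
  (\int[mu]_x Imz (f x * conjc (g x)))%R.

(** Operators on L^2 are given by their graphs. *)
Implicit Types G : (T -> R[i]) -> (T -> R[i]) -> Prop.

Definition graph_closure mu G : (T -> R[i]) -> (T -> R[i]) -> Prop := fun u v =>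
  [/\ memLp 2 mu u, memLp 2 mu v
    & forall e : R, 0 < e -> exists f g, [/\ G f g,
        (cnorm 2 mu (u \- f)%R < e%:E)%E & (cnorm 2 mu (v \- g)%R < e%:E)%E]].

Definition graph_adjoint mu G : (T -> R[i]) -> (T -> R[i]) -> Prop := fun u v =>
  [/\ memLp 2 mu u, memLp 2 mu v
    & forall f g, G f g -> inner mu g u = inner mu f v].

Definition self_adjoint mu G := forall u v, graph_adjoint mu G u v <-> G u v.

Implicit Types E : set R -> (T -> R[i]) -> (T -> R[i]).

Definition projection_valued_measure mu E :=
  [/\ forall A f, measurable A -> memLp 2 mu f -> memLp 2 mu (E A f),
      forall A (a : R[i]) f g, measurable A -> memLp 2 mu f -> memLp 2 mu g ->
        ae_eqc mu (E A (fun x => a * f x + g x))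
                  (fun x => a * E A f x + E A g x) /\
        inner mu (E A f) g = inner mu f (E A g),
      forall A B f, measurable A -> measurable B -> memLp 2 mu f ->
        ae_eqc mu (E (A `&` B) f) (E A (E B f)),
      forall f, memLp 2 mu f -> ae_eqc mu (E setT f) f
    & forall (F : (set R)^nat) f, (forall k, measurable (F k)) ->
        trivIset setT F -> memLp 2 mu f ->
        cnorm 2 mu (fun x => E (\bigcup_k F k) f x - \sum_(k < m) E (F k) f x)
          @[m --> \oo] --> 0%E].

(** The scalar spectral measure [B |-> <E(B) f, f> = ||E(B) f||^2]. *)
Definition spectral_dist mu E f : set (measurableTypeR R) -> \bar R :=
  fun B => (cnorm 2 mu (E B f) `^ 2)%E.

(** [h] is the vector [(\int phi dE) f]: the vector integral against E is the
    isometry from L^2 of the scalar spectral measure of [f] which sends the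
    indicator of [A] to [E(A) f]. Taking all coefficients zero shows that [phi]
    has to be square integrable, i.e. [f] is in the domain of [\int phi dE]. *)
Definition spectral_integral mu E (phi : R -> R[i]) f h :=
  memLp 2 mu h /\
  forall (m : nat) (a : 'I_m -> R[i]) (A : 'I_m -> set R),
    (forall i, measurable (A i)) ->
    (cnorm 2 mu (fun x => h x - \sum_(i < m) a i * E (A i) f x)%R `^ 2 =
     \int[spectral_dist mu E f]_l
       (Normc.normc (phi l - \sum_(i < m) a i * (\1_(A i) l)%:C)%R ^+ 2)%:E)%E.

(** [E] is the spectral resolution of the self-adjoint operator of graph [G]:
    [G = \int l dE(l)], domains included. *)
Definition spectral_resolution mu G E :=
  projection_valued_measure mu E /\
  forall u v, G u v <->
    memLp 2 mu u /\ spectral_integral mu E (fun l => l%:C) u v.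

End complex_functions.

Section operator.
Context {R : realType} {n : nat} {M : ptopologicalType}.
Variables (atlas : set (chart R n M)) (mu : {measure set (borel M) -> \bar R}).
Variable Delta : (M -> R) -> M -> R.

(** Graph of [s * Delta] on complex-valued test functions: the real operator
    [Delta] acts on real and imaginary parts. *)
Definition Cc_graph (s : R) (f g : borel M -> R[i]) :=
  [/\ Cc_smooth atlas (Rez \o f), Cc_smooth atlas (Imz \o f)
    & forall x, g x = (s * Delta (Rez \o f) x) +i* (s * Delta (Imz \o f) x)].

Definition essentially_self_adjoint :=
  self_adjoint mu (graph_closure mu (Cc_graph 1)).

(** The self-adjoint extension of [- Delta]. *)
Definition minus_Delta := graph_closure mu (Cc_graph (-1)).

End operator.

Section diffusion.
Context {R : realType} {n : nat} {M : ptopologicalType}.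
Context {d : measure_display} {Om : measurableType d}.
Variables (atlas : set (chart R n M)) (Delta : (M -> R) -> M -> R).
(** The state space is the one-point compactification of [M]; the added point
    [None] is the cemetery, reached at the explosion time. *)
Variables (X : R -> Om -> opc M) (P : opc M -> probability Om R).

Definition borel_set : set (set (opc M)) := <<s @open (opc M) >>.

Definition natural_filtration (t : R) : set (set Om) :=
  <<s [set A | exists (s : R) (B : set (opc M)),
        [/\ 0 <= s <= t, borel_set B & A = X s @^-1` B]] >>.

Definition martingale (Q : probability Om R) (N : R -> Om -> R) :=
  [/\ forall t : R, 0 <= t -> Q.-integrable setT (EFin \o N t),
      forall (t : R) (B : set R), 0 <= t -> measurable B ->
        natural_filtration t (N t @^-1` B)
    & forall (s t : R) A, 0 <= s -> s <= t -> natural_filtration s A ->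
        (\int[Q]_(w in A) N s w = \int[Q]_(w in A) N t w)%R].

Definition stopping_time (tau : Om -> \bar R) :=
  (forall w, (0 <= tau w)%E) /\
  forall t : R, 0 <= t -> natural_filtration t [set w | (tau w <= t%:E)%E].

Definition stopped_event (tau : Om -> \bar R) (A : set Om) :=
  measurable A /\
  forall t : R, 0 <= t ->
    natural_filtration t (A `&` [set w | (tau w <= t%:E)%E]).

Definition strong_markov :=
  forall x tau A (s : R) (B : set (opc M)),
    stopping_time tau -> stopped_event tau A -> 0 <= s -> borel_set B ->
    P x (A `&` [set w | (tau w < +oo)%E] `&`
         [set w | B (X (fine (tau w) + s) w)]) =
    (\int[P x]_(w in A `&` [set w | (tau w < +oo)%E])
       P (X (fine (tau w)) w) (X s @^-1` B))%E.

(** Functions on [M] are extended by 0 at the cemetery. *)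
Definition ext0 (f : M -> R) (x : opc M) : R := oapp f 0 x.

Definition generated_by :=
  forall f x, Cc_smooth atlas f ->
    martingale (P x) (fun t w => ext0 f (X t w) - ext0 f (X 0 w) -
      (\int[@lebesgue_measure R]_(s in `[0%R, t]) ext0 (Delta f) (X s w))%R).

Definition diffusion_process :=
  [/\ [/\ forall (t : R) (B : set (opc M)), 0 <= t -> borel_set B ->
        measurable (X t @^-1` B),
      forall (t : R) (B : set (opc M)), 0 <= t -> borel_set B ->
        measurable_fun setT
          (fun x : borel (opc M) => P x (X t @^-1` B)),
      forall w, {within `[0, +oo[, continuous (X ^~ w)}
    & forall w (s t : R), 0 <= s -> s <= t -> X s w = None -> X t w = None],
      forall x, P x (X 0 @^-1` [set x]) = 1%E,
      strong_markov
    & generated_by].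

Definition non_explosive :=
  forall x : M, P (Some x) [set w | forall t : R, 0 <= t -> X t w <> None] = 1%E.

End diffusion.

Section complex_measure.
Context {d : measure_display} {T : measurableType d} {R : realType}.

Definition charge_integral (nu : {charge set T -> \bar R}) (D : set T)
    (f : T -> R) : R :=
  let hN := svalP (cid (svalP (cid (Hahn_decomposition nu)))) in
  (\int[jordan_pos hN]_(x in D) f x - \int[jordan_neg hN]_(x in D) f x)%R.

End complex_measure.

Record complex_measure d (T : measurableType d) (R : realType) :=
  ComplexMeasure {
    cm_re : {charge set T -> \bar R};
    cm_im : {charge set T -> \bar R} }.

Section complex_measure_theory.
Context {d : measure_display} {T : measurableType d} {R : realType}.
Variable alpha : complex_measure T R.

Definition cm_val (A : set T) : R[i] :=
  fine (cm_re alpha A) +i* fine (cm_im alpha A).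

Definition cm_integral (D : set T) (f : T -> R) : R[i] :=
  charge_integral (cm_re alpha) D f +i* charge_integral (cm_im alpha) D f.

Definition cm_variation (D : set T) : \bar R :=
  ereal_sup [set v : \bar R | exists F : (set T)^nat,
    [/\ forall k, measurable (F k), trivIset setT F, \bigcup_k F k = D
      & v = (\sum_(0 <= k <oo) (Normc.normc (cm_val (F k)))%:E)%E]].

End complex_measure_theory.

Definition half_line (R : realType) : set R := `[0, +oo[.

(** [Phi] is a function on the half-line: its values at negative reals are
    ignored. *)
Definition functional_calculus d (T : measurableType d) (R : realType)
    (mu : {measure set T -> \bar R}) (E : set R -> (T -> R[i]) -> (T -> R[i]))
    (Phi : R -> R[i]) (f h : T -> R[i]) :=
  spectral_integral mu E (fun l => if 0 <= l then Phi l else 0) f h.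

Definition bounded_borel (R : realType) (Phi : R -> R[i]) :=
  [/\ measurable_fun (@half_line R) (Rez \o Phi),
      measurable_fun (@half_line R) (Imz \o Phi)
    & exists C : R, forall x, 0 <= x -> Normc.normc (Phi x) <= C].

Definition pstar (R : realType) (p : R) : R := Num.max p (p / (p - 1)).

(* Main.v *)
Require Import Defs.
From HB Require Import structures.
From mathcomp Require Import all_boot all_order all_algebra.
From mathcomp Require Import all_classical all_reals all_analysis.
From mathcomp Require Import measurable_realfun complex finmap.
From mathcomp Require Import ring lra.

(** Let A be the self-adjoint operator - Delta. The proof rests on the fact that
    for every m >= 0 the operator m (m^2 + A)^(-1/2) is a contraction of L^p for
    1 < p < oo. Then 1 - m (m^2 + A)^(-1/2) has norm at most 2 on L^p, and
    integrating in m against alpha bounds Phi(A) by twice the total variation.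
    This suffices, since pstar p is at least 2.

    The contraction property is derived from the resolvents lam (lam + A)^(-1).
    By the symmetry of Delta and the chain rule, the integral of psi(f) (A f) is
    nonnegative for real test functions f and nondecreasing Lipschitz functions
    psi with psi 0 = 0: symmetry is tested on f and polynomials of f, which are
    again test functions, psi is approximated by polynomials, and the inequality
    passes to the closure ([Green_poly], [minus_Delta_dissipative]). With psi the positive part
    it gives a maximum principle for resolvents, so that the resolvent of f is
    dominated by the resolvent of |f|; with psi a truncation of s^(p - 1) and
    Young's inequality it gives the contraction of L^p
    ([resolvent_contraction]).

    The functions phi for which phi(A) has norm at most r on L^p are stable under
    sums, products and bounded pointwise limits ([multiplier_lin],
    [multiplier_mul], [multiplier_cvg]). The power series of 1 / sqrt (1 - q z)
    has nonnegative coefficients; evaluated at a resolvent (by the iterations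
    [sqrt_iter] and [rsqrt_iter]), it yields the symbols
    m / sqrt (m^2 + lam l / (lam + l)) with norm at most 1, and lam tends to
    infinity ([multiplier_poisson]). Sums over partitions of the half-line then
    converge to Phi ([multiplier_half_line_integral]).

    The functional calculus needed here is built from uniform approximation by
    step functions ([ucalc]), where linearity and multiplicativity are visible,
    and is shown to agree with the isometric definition of spectral integrals
    ([ucalc_spectral_integral]). Finally Phi(A) extends from the intersection of
    L^2 and L^p to L^p by closing its graph ([multiplier_extension]). *)

Set Implicit Arguments.
Unset Strict Implicit.
Unset Printing Implicit Defensive.

Import Order.TTheory GRing.Theory Num.Theory.
Import numFieldNormedType.Exports.

Local Open Scope classical_set_scope.
Local Open Scope ring_scope.
Local Open Scope complex_scope.

Local Notation nc := (@Normc.normc _).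

(** * Complex-valued functions and their norms *)

Section complex_numbers.
Context {R : realType}.
Implicit Types (z w a : R[i]) (r : R).

Lemma RezD z w : Rez (z + w) = Rez z + Rez w. Proof. by case: z w => ? ? []. Qed.
Lemma ImzD z w : Imz (z + w) = Imz z + Imz w. Proof. by case: z w => ? ? []. Qed.
Lemma RezN z : Rez (- z) = - Rez z. Proof. by case: z. Qed.
Lemma ImzN z : Imz (- z) = - Imz z. Proof. by case: z. Qed.
Lemma RezM z w : Rez (z * w) = Rez z * Rez w - Imz z * Imz w.
Proof. by case: z w => ? ? []. Qed.
Lemma ImzM z w : Imz (z * w) = Rez z * Imz w + Imz z * Rez w.
Proof. by case: z w => ? ? []. Qed.
Lemma RezJ z : Rez (conjc z) = Rez z. Proof. by case: z. Qed.
Lemma ImzJ z : Imz (conjc z) = - Imz z. Proof. by case: z. Qed.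

Definition ReImE := (RezD, ImzD, RezN, ImzN, RezM, ImzM, RezJ, ImzJ).

Lemma complex_ext z w : Rez z = Rez w -> Imz z = Imz w -> z = w.
Proof. by case: z w => ? ? [? ?] /= -> ->. Qed.

Lemma normc_ge0 z : 0 <= nc z. Proof. by case: z => a b; exact: sqrtr_ge0. Qed.

Lemma sqr_nc z : nc z ^+ 2 = Rez z ^+ 2 + Imz z ^+ 2.
Proof. by case: z => a b /=; rewrite sqr_sqrtr// addr_ge0// sqr_ge0. Qed.

Lemma normr_Re_le z : `|Rez z| <= nc z.
Proof. by rewrite -ler_sqr ?nnegrE ?normc_ge0// sqr_nc real_normK ?num_real// lerDl sqr_ge0. Qed.

Lemma normr_Im_le z : `|Imz z| <= nc z.
Proof. by rewrite -ler_sqr ?nnegrE ?normc_ge0// sqr_nc real_normK ?num_real// lerDr sqr_ge0. Qed.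

Lemma Re_le_normc z : Rez z <= nc z.
Proof. exact: le_trans (ler_norm _) (normr_Re_le z). Qed.

Lemma normcD z w : nc (z + w) <= nc z + nc w. Proof. exact: le_normcD. Qed.

Lemma normcN' z : nc (- z) = nc z. Proof. exact: normcN. Qed.

Lemma normcB z w : nc (z - w) <= nc z + nc w.
Proof. by rewrite -(normcN' w) normcD. Qed.

Lemma normc_distC z w : nc (z - w) = nc (w - z).
Proof. by rewrite -normcN' opprB. Qed.

Lemma normc_real r : nc (r%:C) = `|r|.
Proof. by rewrite /= expr0n/= addr0 sqrtr_sqr. Qed.

Lemma normc_le_ReIm z : nc z <= `|Rez z| + `|Imz z|.
Proof.
rewrite -ler_sqr ?nnegrE ?addr_ge0 ?normc_ge0// sqr_nc sqrrD !real_normK ?num_real//.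
by rewrite [leRHS]addrAC lerDl mulrn_wge0// mulr_ge0.
Qed.

Lemma normc_eq0 z : nc z = 0 -> z = 0. Proof. exact: Normc.eq0_normc. Qed.

End complex_numbers.

Section cmeasurable.
Context {d : measure_display} {T : measurableType d} {R : realType}.
Implicit Types (f g : T -> R[i]) (a : R[i]).

Lemma measurable_normc f : cmeasurable f -> measurable_fun setT (nc \o f).
Proof.
move=> [mr mi].
rewrite (_ : _ \o _ = Num.sqrt \o
   (fun x => (Rez \o f) x ^+ 2 + (Imz \o f) x ^+ 2)); last first.
  by apply/funext => x /=; case: (f x).
apply: measurableT_comp.
  exact: continuous_measurable_fun (@sqrt_continuous R).
by apply: measurable_funD; exact: measurable_funX.
Qed.

Lemma cmeasurable_lin a f g : cmeasurable f -> cmeasurable g ->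
  cmeasurable (fun x => a * f x + g x).
Proof.
move=> [fr fi] [gr gi]; split.
  rewrite (_ : _ \o _ = (fun x => Rez a * (Rez \o f) x - Imz a * (Imz \o f) x
      + (Rez \o g) x)); last by apply/funext => x /=; rewrite !ReImE.
  apply: measurable_funD => //; apply: measurable_funB;
    exact: measurable_funM.
rewrite (_ : _ \o _ = (fun x => Rez a * (Imz \o f) x + Imz a * (Rez \o f) x
      + (Imz \o g) x)); last by apply/funext => x /=; rewrite !ReImE.
by apply: measurable_funD => //; apply: measurable_funD; exact: measurable_funM.
Qed.

Lemma cmeasurable_cst a : cmeasurable (fun _ : T => a).
Proof. by split; exact: measurable_cst. Qed.

Lemma cmeasurableD f g : cmeasurable f -> cmeasurable g ->
  cmeasurable (fun x => f x + g x).
Proof.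
move=> mf mg; rewrite (_ : (fun x => _) = (fun x => 1 * f x + g x)).
  exact: cmeasurable_lin.
by apply/funext => x; rewrite mul1r.
Qed.

Lemma cmeasurableZ a f : cmeasurable f -> cmeasurable (fun x => a * f x).
Proof.
move=> mf; rewrite (_ : (fun x => _) = (fun x => a * f x + 0)).
  exact/cmeasurable_lin/cmeasurable_cst.
by apply/funext => x; rewrite addr0.
Qed.

Lemma cmeasurableB f g : cmeasurable f -> cmeasurable g ->
  cmeasurable (fun x => f x - g x).
Proof.
move=> mf mg; rewrite (_ : (fun x => _) = (fun x => (-1) * g x + f x)).
  exact: cmeasurable_lin.
by apply/funext => x; rewrite mulN1r addrC.
Qed.

Lemma cmeasurable_real (u : T -> R) : measurable_fun setT u ->
  cmeasurable (fun x => (u x)%:C).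
Proof. by move=> mu; split => //; exact: measurable_cst. Qed.

Lemma cmeasurable_normc f : cmeasurable f -> cmeasurable (fun x => (nc (f x))%:C).
Proof. by move=> mf; apply/cmeasurable_real/measurable_normc. Qed.

End cmeasurable.

Section cnorm.
Context {d : measure_display} {T : measurableType d} {R : realType}.
Variable mu : {measure set T -> \bar R}.
Implicit Types (f g h : T -> R[i]) (a : R[i]) (p : R).

Lemma measurable_normc_powR p f : cmeasurable f ->
  measurable_fun setT (fun x => (nc (f x) `^ p)%:E).
Proof.
move=> mf; apply/measurable_EFinP.
apply: (@measurableT_comp _ _ _ _ _ _ (@powR R ^~ p) _ (nc \o f)) => //.
exact: measurable_normc.
Qed.

Lemma cnormE p f :
  cnorm p mu f = ((\int[mu]_x (nc (f x) `^ p)%:E) `^ p^-1)%E.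
Proof.
rewrite /cnorm unlock; congr (_ `^ _)%E; apply: eq_integral => x _.
by rewrite abse_EFin poweR_EFin ger0_norm ?normc_ge0.
Qed.

Lemma cnorm_ge0 p f : (0 <= cnorm p mu f)%E. Proof. exact: Lnorm_ge0. Qed.

Lemma cnorm_poweR p f : p != 0 ->
  (cnorm p mu f `^ p = \int[mu]_x (nc (f x) `^ p)%:E)%E.
Proof.
move=> p0; rewrite cnormE -poweRrM mulVf// poweRe1//.
by apply: integral_ge0 => x _; rewrite lee_fin powR_ge0.
Qed.

Lemma ae_le_cnorm p f g : 0 < p -> cmeasurable f -> cmeasurable g ->
  {ae mu, forall x, nc (f x) <= nc (g x)} -> (cnorm p mu f <= cnorm p mu g)%E.
Proof.
move=> p0 mf mg fg; rewrite !cnormE; apply: gt0_ler_poweR.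
- by rewrite invr_ge0 ltW.
- by rewrite in_itv/= leey integral_ge0// => x _; rewrite lee_fin powR_ge0.
- by rewrite in_itv/= leey integral_ge0// => x _; rewrite lee_fin powR_ge0.
apply: ae_ge0_le_integral => //.
- by move=> x _; rewrite lee_fin powR_ge0.
- exact: measurable_normc_powR.
- by move=> x _; rewrite lee_fin powR_ge0.
- exact: measurable_normc_powR.
apply: filterS fg => x fgx _.
by rewrite lee_fin ge0_ler_powR ?nnegrE ?normc_ge0// ltW.
Qed.

Lemma le_cnorm p f g : 0 < p -> cmeasurable f -> cmeasurable g ->
  (forall x, nc (f x) <= nc (g x)) -> (cnorm p mu f <= cnorm p mu g)%E.
Proof. by move=> p0 mf mg fg; apply: ae_le_cnorm => //; exact: aeW. Qed.

Lemma ae_eq_cnorm p f g : 0 < p -> cmeasurable f -> cmeasurable g ->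
  ae_eqc mu f g -> cnorm p mu f = cnorm p mu g.
Proof.
move=> p0 mf mg fg; apply/eqP; rewrite eq_le.
by apply/andP; split; apply: ae_le_cnorm => //; apply: filterS fg => x ->.
Qed.

Lemma cnormD p f g : 1 <= p -> cmeasurable f -> cmeasurable g ->
  (cnorm p mu (fun x => f x + g x)%R <= cnorm p mu f + cnorm p mu g)%E.
Proof.
move=> p1 mf mg.
have h := minkowski_EFin mu (measurable_normc mf) (measurable_normc mg) p1.
apply: le_trans h.
pose s x := (nc (f x) + nc (g x))%:C.
have -> : Lnorm mu p%:E (EFin \o ((nc \o f) \+ (nc \o g))%R) = cnorm p mu s.
  apply: eq_Lnorm => x; congr EFin.
  by rewrite /s normc_real ger0_norm// addr_ge0 ?normc_ge0.
apply: le_cnorm => //.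
- exact: lt_le_trans p1.
- exact: cmeasurableD.
- by apply/cmeasurable_real/measurable_funD; exact: measurable_normc.
move=> x; rewrite /s normc_real ger0_norm ?addr_ge0 ?normc_ge0//.
exact: normcD.
Qed.

Lemma cnormZ p a f : 0 < p -> cmeasurable f ->
  cnorm p mu (fun x => a * f x)%R = ((nc a)%:E * cnorm p mu f)%E.
Proof.
move=> p0 mf; rewrite !cnormE.
under eq_integral do rewrite Normc.normcM powRM ?normc_ge0// EFinM.
have i0 : (0 <= \int[mu]_x (nc (f x) `^ p)%:E)%E.
  by apply: integral_ge0 => x _; rewrite lee_fin powR_ge0.
rewrite (ge0_integralZl_EFin mu measurableT _ (measurable_normc_powR p mf)) ?powR_ge0//; last first.
  by move=> x _; rewrite lee_fin powR_ge0.
rewrite poweRM ?lee_fin ?powR_ge0//.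
by rewrite poweR_EFin -powRrM mulfV ?gt_eqF// powRr1 ?normc_ge0.
Qed.

Lemma cnorm0 p : 0 < p -> cnorm p mu (fun _ => 0) = 0%E.
Proof.
move=> p0; rewrite (_ : (fun _ => 0) = (fun x : T => 0 * (0 : R[i]))); last first.
  by apply/funext => x; rewrite mul0r.
by rewrite cnormZ//; [rewrite Normc.normc0 mul0e|exact: cmeasurable_cst].
Qed.

Lemma cnormB_eq0 p f g : 0 < p -> cmeasurable f -> cmeasurable g ->
  cnorm p mu (fun x => f x - g x) = 0%E <-> ae_eqc mu f g.
Proof.
move=> p0 mf mg; split => [h|fg].
  have mfg := cmeasurableB mf mg.
  have := @Lnorm_eq0_eq0 _ _ _ mu _ p%:E _ _ h.
  move=> /(_ _ _)/wrap[].
    by apply/measurable_EFinP/measurable_normc.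
    by rewrite lte_fin.
  apply: filterS => x /(_ I) [] /normc_eq0 /eqP.
  by rewrite subr_eq0 => /eqP.
rewrite -(cnorm0 p0); apply: ae_eq_cnorm => //.
- exact: cmeasurableB.
- exact: cmeasurable_cst.
- by apply: filterS fg => x ->; rewrite subrr.
Qed.

End cnorm.

(** * Completeness of L^p *)

Section memLp_theory.
Context {d : measure_display} {T : measurableType d} {R : realType}.
Variable mu : {measure set T -> \bar R}.
Implicit Types (f g h : T -> R[i]) (a : R[i]) (p : R).

Lemma memLp_lin p a f g : 1 <= p -> memLp p mu f -> memLp p mu g ->
  memLp p mu (fun x => a * f x + g x).
Proof.
move=> p1 [mf foo] [mg goo]; split; first exact: cmeasurable_lin.
have p0 : 0 < p by exact: lt_le_trans p1.
apply: le_lt_trans (cnormD _ p1 (cmeasurableZ a mf) mg) _.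
by rewrite lte_add_pinfty// cnormZ// lte_mul_pinfty// lee_fin normc_ge0.
Qed.

Lemma memLp_cst0 p : 0 < p -> memLp p mu (fun _ => 0).
Proof. by move=> p0; split; [exact: cmeasurable_cst|rewrite cnorm0]. Qed.

Lemma memLpD p f g : 1 <= p -> memLp p mu f -> memLp p mu g ->
  memLp p mu (fun x => f x + g x).
Proof.
move=> p1 mf mg; rewrite (_ : (fun x => _) = (fun x => 1 * f x + g x)).
  exact: memLp_lin.
by apply/funext => x; rewrite mul1r.
Qed.

Lemma memLpZ p a f : 1 <= p -> memLp p mu f -> memLp p mu (fun x => a * f x).
Proof.
move=> p1 mf; rewrite (_ : (fun x => _) = (fun x => a * f x + 0)).
  by apply: memLp_lin => //; apply: memLp_cst0; exact: lt_le_trans p1.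
by apply/funext => x; rewrite addr0.
Qed.

Lemma memLpB p f g : 1 <= p -> memLp p mu f -> memLp p mu g ->
  memLp p mu (fun x => f x - g x).
Proof.
move=> p1 mf mg; rewrite (_ : (fun x => _) = (fun x => (-1) * g x + f x)).
  exact: memLp_lin.
by apply/funext => x; rewrite mulN1r addrC.
Qed.

Lemma memLp_sum p (I : Type) (s : seq I) (F : I -> T -> R[i]) : 1 <= p ->
  (forall i, memLp p mu (F i)) -> memLp p mu (fun x => \sum_(i <- s) F i x).
Proof.
move=> p1 mF; elim: s => [|i s IH].
  rewrite (_ : (fun x => _) = fun _ => 0).
    by apply: memLp_cst0; exact: lt_le_trans p1.
  by apply/funext => x; rewrite big_nil.
rewrite (_ : (fun x => _) = fun x => F i x + \sum_(j <- s) F j x).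
  exact: memLpD.
by apply/funext => x; rewrite big_cons.
Qed.

Lemma ae_memLp p f g : 0 < p -> cmeasurable g -> ae_eqc mu f g -> memLp p mu f ->
  memLp p mu g.
Proof. by move=> p0 mg fg [mf foo]; split => //; rewrite -(ae_eq_cnorm p0 mf). Qed.

Lemma ae_le_memLp p f g : 0 < p -> cmeasurable g ->
  {ae mu, forall x, nc (g x) <= nc (f x)} -> memLp p mu f -> memLp p mu g.
Proof. by move=> p0 mg gf [mf foo]; split => //; exact: le_lt_trans (ae_le_cnorm _ _ _ gf) foo. Qed.

Lemma cnorm_distC p f g :
  cnorm p mu (fun x => f x - g x) = cnorm p mu (fun x => g x - f x).
Proof. by rewrite /cnorm; apply: eq_Lnorm => x; rewrite normc_distC. Qed.

Lemma cnorm_triangle p f g h : 1 <= p ->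
  cmeasurable f -> cmeasurable g -> cmeasurable h ->
  (cnorm p mu (fun x => f x - h x)%R <=
   cnorm p mu (fun x => f x - g x)%R + cnorm p mu (fun x => g x - h x)%R)%E.
Proof.
move=> p1 mf mg mh; rewrite (_ : (fun x => f x - h x) =
    (fun x => (f x - g x) + (g x - h x))).
  by apply: cnormD => //; exact: cmeasurableB.
by apply/funext => x; rewrite addrA subrK.
Qed.

Lemma le_cnorm_dist p f g : 1 <= p -> cmeasurable f -> cmeasurable g ->
  (cnorm p mu f <= cnorm p mu (fun x => f x - g x)%R + cnorm p mu g)%E.
Proof.
move=> p1 mf mg; rewrite {1}(_ : f = (fun x => (f x - g x) + g x)).
  by apply: cnormD => //; exact: cmeasurableB.
by apply/funext => x; rewrite subrK.
Qed.

(** The norm as a real number, meaningful on functions of finite norm. *)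
Definition rnorm p f : R := fine (cnorm p mu f).

Lemma eq_rnorm p f g : f =1 g -> rnorm p f = rnorm p g.
Proof. by move=> /funext ->. Qed.

Lemma rnorm_ge0 p f : 0 <= rnorm p f.
Proof. by rewrite /rnorm fine_ge0// cnorm_ge0. Qed.

Lemma rnormE p f : memLp p mu f -> cnorm p mu f = (rnorm p f)%:E.
Proof. by move=> [_ foo]; rewrite fineK// ge0_fin_numE// cnorm_ge0. Qed.

Lemma rnormD p f g : 1 <= p -> memLp p mu f -> memLp p mu g ->
  rnorm p (fun x => f x + g x) <= rnorm p f + rnorm p g.
Proof.
move=> p1 mf mg; rewrite -lee_fin EFinD -!rnormE//; last exact: memLpD.
by apply: cnormD => //; [exact: mf.1|exact: mg.1].
Qed.

Lemma rnormZ p a f : 1 <= p -> memLp p mu f ->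
  rnorm p (fun x => a * f x) = nc a * rnorm p f.
Proof.
move=> p1 mf; apply: EFin_inj; rewrite EFinM -!rnormE//; last exact: memLpZ.
by apply: cnormZ; [exact: lt_le_trans p1|exact: mf.1].
Qed.

Lemma rnorm_triangle p f g h : 1 <= p ->
  memLp p mu f -> memLp p mu g -> memLp p mu h ->
  rnorm p (fun x => f x - h x) <=
   rnorm p (fun x => f x - g x) + rnorm p (fun x => g x - h x).
Proof.
move=> p1 mf mg mh; rewrite -lee_fin EFinD -!rnormE//; try exact: memLpB.
by apply: cnorm_triangle => //; [exact: mf.1|exact: mg.1|exact: mh.1].
Qed.

Lemma le_rnorm_dist p f g : 1 <= p -> memLp p mu f -> memLp p mu g ->
  rnorm p f <= rnorm p (fun x => f x - g x) + rnorm p g.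
Proof.
move=> p1 mf mg; rewrite -lee_fin EFinD -!rnormE//; last exact: memLpB.
by apply: le_cnorm_dist => //; [exact: mf.1|exact: mg.1].
Qed.

Lemma rnorm_distC p f g : rnorm p (fun x => f x - g x) = rnorm p (fun x => g x - f x).
Proof. by rewrite /rnorm cnorm_distC. Qed.

Lemma rnorm_dist_norm p f g : 1 <= p -> memLp p mu f -> memLp p mu g ->
  `|rnorm p f - rnorm p g| <= rnorm p (fun x => f x - g x).
Proof.
move=> p1 mf mg; rewrite ler_norml lerBlDr le_rnorm_dist// andbT.
have := le_rnorm_dist p1 mg mf; rewrite rnorm_distC; lra.
Qed.

Lemma ae_eq_rnorm p f g : 0 < p -> cmeasurable f -> cmeasurable g ->
  ae_eqc mu f g -> rnorm p f = rnorm p g.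
Proof. by move=> *; rewrite /rnorm (@ae_eq_cnorm _ _ _ _ _ f g). Qed.

Lemma rnormB_eq0 p f g : 1 <= p -> memLp p mu f -> memLp p mu g ->
  rnorm p (fun x => f x - g x) <= 0 -> ae_eqc mu f g.
Proof.
move=> p1 mf mg h; have p0 : 0 < p by exact: lt_le_trans p1.
apply/(cnormB_eq0 _ p0 mf.1 mg.1); rewrite rnormE; last exact: memLpB.
by congr EFin; apply/eqP; rewrite eq_le h rnorm_ge0.
Qed.

Lemma rnorm_powR p f : 0 < p -> memLp p mu f ->
  (\int[mu]_x (nc (f x) `^ p)%:E = (rnorm p f `^ p)%:E)%E.
Proof.
by move=> p0 mf; rewrite -cnorm_poweR ?gt_eqF// rnormE// poweR_EFin.
Qed.

Lemma cnorm_lty_powR p f : 0 < p ->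
  (\int[mu]_x (nc (f x) `^ p)%:E < +oo)%E -> (cnorm p mu f < +oo)%E.
Proof. by move=> p0 h; rewrite cnormE; exact: poweR_lty. Qed.

Lemma cnorm_le_powR p f (C : R) : 0 < p -> 0 <= C ->
  (\int[mu]_x (nc (f x) `^ p)%:E <= (C `^ p)%:E)%E -> (cnorm p mu f <= C%:E)%E.
Proof.
move=> p0 C0 h; rewrite cnormE (_ : C%:E = (C `^ p)%:E `^ p^-1)%E; last first.
  by rewrite poweR_EFin -powRrM mulfV ?gt_eqF// powRr1.
apply: gt0_ler_poweR => //.
- by rewrite invr_ge0 ltW.
- by rewrite in_itv/= leey integral_ge0// => x _; rewrite lee_fin powR_ge0.
- by rewrite in_itv/= leey lee_fin powR_ge0.
Qed.

End memLp_theory.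

Section convergence.
Context {d : measure_display} {T : measurableType d} {R : realType}.
Variable mu : {measure set T -> \bar R}.
Implicit Types (f g h : T -> R[i]) (a : R[i]) (p : R).

Lemma cvg_powR (u : nat -> R) (l p : R) : 0 < p -> (forall n, 0 <= u n) ->
  u n @[n --> \oo] --> l -> u n `^ p @[n --> \oo] --> l `^ p.
Proof.
move=> p0 u0 ul.
have l0 : 0 <= l.
  rewrite -(cvg_lim _ ul)//; apply: limr_ge; first by apply/cvg_ex; exists l.
  exact: nearW.
move: l0; rewrite le_eqVlt => /predU1P[l0|l0].
  rewrite -l0 powR0 ?gt_eqF//; rewrite -{}l0 in ul.
  apply/cvgr0Pnorm_lt => e e0.
  have e'0 : 0 < e `^ p^-1 by exact: powR_gt0.
  move/cvgr0Pnorm_lt : ul => /(_ _ e'0); apply: filterS => n.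
  rewrite !ger0_norm ?powR_ge0// => une.
  have := gt0_ltr_powR p0 (u0 n) (powR_ge0 _ _) une.
  by rewrite -powRrM mulVf ?gt_eqF// powRr1// ltW.
suff cl : {for l, continuous (fun y => y `^ p)} by exact: (cvg_comp u (fun y => y `^ p) ul cl).
apply: differentiable_continuous; apply/derivable1_diffP.
by apply: derivable_powR; rewrite in_itv/= l0.
Qed.

Definition ccvg (u : nat -> R[i]) (l : R[i]) :=
  Rez (u n) @[n --> \oo] --> Rez l /\ Imz (u n) @[n --> \oo] --> Imz l.

Lemma ccvg_normc u l : ccvg u l -> nc (u n) @[n --> \oo] --> nc l.
Proof.
move=> [ur ui].
have h z : nc z = Num.sqrt (Rez z ^+ 2 + Imz z ^+ 2) by case: z.
rewrite h; under eq_cvg do rewrite h.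
apply: continuous_cvg; first exact: sqrt_continuous.
by apply: cvgD; [apply: (@cvgM _ _ _ _ (fun n => Rez (u n)) (fun n => Rez (u n)))
  |apply: (@cvgM _ _ _ _ (fun n => Imz (u n)) (fun n => Imz (u n)))].
Qed.

Lemma ccvg_lin u v l m a : ccvg u l -> ccvg v m ->
  ccvg (fun n => a * u n + v n) (a * l + m).
Proof.
move=> [ur ui] [vr vi]; split.
  under eq_cvg do rewrite !ReImE; rewrite !ReImE.
  by apply: cvgD => //; apply: cvgB; apply: cvgMr.
under eq_cvg do rewrite !ReImE; rewrite !ReImE.
by apply: cvgD => //; apply: cvgD; apply: cvgMr.
Qed.

Lemma ccvg_cst z : ccvg (fun _ => z) z.
Proof. by split; exact: cvg_cst. Qed.

Lemma ccvgB_cst u l z : ccvg u l -> ccvg (fun n => z - u n) (z - l).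
Proof.
move=> ul; have := ccvg_lin (-1) ul (ccvg_cst z).
by rewrite mulN1r addrC (_ : (fun _ => _) = (fun n => z - u n))//;
  apply/funext => n; rewrite mulN1r addrC.
Qed.

(** Fatou's lemma, applied to the p-th powers of the moduli. *)
Lemma cnorm_fatou p (h : nat -> T -> R[i]) f (C : R) : 0 < p -> 0 <= C ->
  (forall k, cmeasurable (h k)) -> cmeasurable f ->
  {ae mu, forall x, ccvg (h ^~ x) (f x)} ->
  (\forall k \near \oo, (cnorm p mu (h k) <= C%:E)%E) -> (cnorm p mu f <= C%:E)%E.
Proof.
move=> p0 C0 mh mf hf [K _ hC].
apply: cnorm_le_powR => //.
pose u k x := (nc (h (k + K)%N x) `^ p)%:E.
have mu_u k : measurable_fun setT (u k) by exact: measurable_normc_powR.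
have u0 k x : (0 <= u k x)%E by rewrite lee_fin powR_ge0.
apply: (@le_trans _ _ (\int[mu]_x limn_einf (u ^~ x))%E).
  apply: ae_ge0_le_integral => //.
  - by move=> x _; rewrite lee_fin powR_ge0.
  - exact: measurable_normc_powR.
  - move=> x _; rewrite limn_einf_lim; apply: lime_ge.
      exact: is_cvg_einfs.
    apply: nearW => n; apply: le_ereal_inf_tmp => _ [m _ <-]; exact: u0.
  - apply: (emeasurable_fun_cvg (fun n x => einfs (u ^~ x) n)).
      exact: measurable_fun_einfs.
    by move=> x _; rewrite limn_einf_lim; exact: is_cvg_einfs.
  apply: filterS hf => x hfx _.
  suff -> : limn_einf (u ^~ x) = (nc (f x) `^ p)%:E by [].
  have : u ^~ x @ \oo --> (nc (f x) `^ p)%:E.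
    apply: cvg_EFin; first exact: nearW.
    rewrite (_ : fine \o _ = (fun k => nc (h (k + K)%N x) `^ p))//.
    apply: cvg_powR => //; first by move=> n; exact: normc_ge0.
    by have := ccvg_normc hfx; rewrite -(cvg_shiftn K).
  by move=> /cvg_limn_einf_sup[].
apply: le_trans (fatou mu measurableT mu_u (fun n x _ => u0 n x)) _.
rewrite limn_einf_lim; apply: lime_le; first exact: is_cvg_einfs.
apply: nearW => n; apply: (@le_trans _ _ (\int[mu]_x u n x)%E).
  by apply: ereal_inf_lbound; exists n => /=.
rewrite -cnorm_poweR ?gt_eqF// -poweR_EFin.
apply: gt0_ler_poweR; first exact: ltW.
- by rewrite in_itv/= leey cnorm_ge0.
- by rewrite in_itv/= leey lee_fin C0.
- by apply: hC => /=; rewrite leq_addl.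
Qed.


(** The p-th powers of [2 ^ k * |v k|] have a summable integral, so their sum
    is almost everywhere finite. *)
Lemma ae_fast p (v : nat -> T -> R[i]) : 0 < p -> (forall k, cmeasurable (v k)) ->
  (forall k, (cnorm p mu (v k) <= ((2^-1 ^+ k * (2^-1 ^+ k.+1) `^ p^-1)%R)%:E)%E) ->
  {ae mu, forall x, exists C : R, forall k, nc (v k x) <= C * 2^-1 ^+ k}.
Proof.
move=> p0 mv hv.
have pow0 k : 0 < (2^-1 : R) ^+ k by rewrite exprn_gt0// invr_gt0.
pose u k x : \bar R := ((2 ^+ k * nc (v k x)) `^ p)%:E.
have u0 k x : (0 <= u k x)%E by rewrite lee_fin powR_ge0.
have uE k x : u k x = (((2 ^+ k) `^ p)%:E * (nc (v k x) `^ p)%:E)%E.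
  by rewrite /u powRM ?exprn_ge0 ?normc_ge0.
have mu_u k : measurable_fun setT (u k).
  rewrite (_ : u k = (fun x => ((2 ^+ k) `^ p)%:E * (nc (v k x) `^ p)%:E)%E).
    by apply: emeasurable_funM => //; exact: measurable_normc_powR.
  by apply/funext => x; rewrite uE.
have iu k : (\int[mu]_x u k x <= (1 / (2 ^ (k + 1))%:R)%:E)%E.
  under eq_integral do rewrite uE.
  rewrite (ge0_integralZl_EFin mu measurableT _ (measurable_normc_powR p (mv k)))
    ?powR_ge0//; last by move=> x _; rewrite lee_fin powR_ge0.
  rewrite -cnorm_poweR ?gt_eqF//.
  have : (cnorm p mu (v k) `^ p <=
      (((2^-1 ^+ k * (2^-1 ^+ k.+1) `^ p^-1)%R)%:E) `^ p)%E.
    apply: gt0_ler_poweR (hv k); first exact: ltW.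
    - by rewrite in_itv/= leey cnorm_ge0.
    - by rewrite in_itv/= leey lee_fin mulr_ge0// ?powR_ge0// ltW.
  have -> : (((2^-1 ^+ k * (2^-1 ^+ k.+1) `^ p^-1)%R)%:E `^ p =
      ((2^-1 ^+ k) `^ p * 2^-1 ^+ k.+1)%R%:E)%E.
    rewrite poweR_EFin powRM ?powR_ge0 ?(ltW (pow0 _))//; congr (_ * _)%:E.
    by rewrite -powRrM mulVf ?gt_eqF// powRr1// ltW.
  move=> h.
  have := lee_wpmul2l (_ : (0 <= ((2 ^+ k) `^ p)%:E)%E) h.
  rewrite lee_fin powR_ge0 => /(_ isT) /le_trans; apply.
  rewrite -EFinM lee_fin mulrA -powRM ?exprn_ge0 ?invr_ge0//.
  by rewrite -exprMn mulfV// expr1n powR1 !mul1r exprVn natrX addn1.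
have su : (\int[mu]_x (\sum_(0 <= k <oo) u k x) < +oo)%E.
  rewrite integral_nneseries//.
  apply: (@le_lt_trans _ _ (\sum_(0 <= k <oo) (1 / (2 ^ (k + 1))%:R)%:E)%E).
    apply: lee_nneseries => [k _ _|k _]; last exact: iu.
    exact: integral_ge0.
  have /cvg_lim := @cvg_geometric_eseries_half R 1 0.
  by rewrite /eseries/= => ->//; rewrite ltry.
have su0 x : (0 <= \sum_(0 <= k <oo) u k x)%E by exact: nneseries_ge0.
have /integrable_ae : mu.-integrable setT (fun x => \sum_(0 <= k <oo) u k x)%E.
  apply/integrableP; split; first exact: ge0_emeasurable_sum.
  by under eq_integral do rewrite gee0_abs//.
move=> /(_ measurableT); apply: filterS => x /(_ I) sx.
exists (fine (\sum_(0 <= k <oo) u k x) `^ p^-1) => k.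
have : (u k x <= \sum_(0 <= k <oo) u k x)%E.
  apply: le_trans (nneseries_lim_ge k.+1 _) => //.
  rewrite big_nat_recr//= leeDr//; exact: sume_ge0.
rewrite -(fineK sx) lee_fin => h.
rewrite exprVn ler_pdivlMr ?exprn_gt0// mulrC.
have y0 : 0 <= 2 ^+ k * nc (v k x) by rewrite mulr_ge0 ?exprn_ge0 ?normc_ge0.
have -> : 2 ^+ k * nc (v k x) = ((2 ^+ k * nc (v k x)) `^ p) `^ p^-1.
  by rewrite -powRrM mulfV ?gt_eqF// powRr1.
apply: ge0_ler_powR; rewrite ?nnegrE ?powR_ge0//.
- by rewrite invr_ge0 ltW.
- exact: fine_ge0 (su0 x).
Qed.

Lemma cvg_geometric_steps (a : nat -> R) (C : R) :
  (forall k, `|a k.+1 - a k| <= C * 2^-1 ^+ k) -> cvgn a.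
Proof.
move=> h.
have C0 : 0 <= C by have := h 0%N; rewrite expr0 mulr1; apply: le_trans.
have : cvgn (series (telescope a)).
  apply: normed_cvg; apply: series_le_cvg.
  - by move=> n; exact: normr_ge0.
  - by move=> n; apply: (_ : 0 <= geometric C 2^-1 n); rewrite /geometric/= mulr_ge0// exprn_ge0.
  - by move=> n; exact: h.
  - by apply: is_cvg_geometric_series; rewrite ger0_norm//; lra.
move=> /cvg_ex[l hl]; apply/cvg_ex; exists (a 0%N + l).
have : a 0%N + series (telescope a) n @[n --> \oo] --> a 0%N + l.
  by apply: cvgD; first exact: cvg_cst.
by rewrite (_ : (fun n => _ + _) = a)//; apply/funext => n; rewrite -eq_sum_telescope.
Qed.

(** By [ae_fast] the increments are almost everywhere geometrically small. *)
Lemma ae_fast_cvg p (h : nat -> T -> R[i]) : 0 < p -> (forall k, cmeasurable (h k)) ->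
  (forall k, (cnorm p mu (fun x => h k.+1 x - h k x)%R <=
    ((2^-1 ^+ k * (2^-1 ^+ k.+1) `^ p^-1)%R)%:E)%E) ->
  exists2 g, cmeasurable g & {ae mu, forall x, ccvg (h ^~ x) (g x)}.
Proof.
move=> p0 mh hh.
have [N [mN N0 NP]] := ae_fast p0 (fun k => cmeasurableB (mh k.+1) (mh k)) hh.
pose h' k x := (\1_(~` N) x)%:C * h k x.
have hE k x : ~ N x -> h' k x = h k x.
  by move=> Nx; rewrite /h' indicE mem_set// mul1r.
have h0 k x : N x -> h' k x = 0.
  by move=> Nx; rewrite /h' indicE memNset ?mul0r//= => /(_ Nx).
have h'cvg x : cvgn (fun k => Rez (h' k x)) /\ cvgn (fun k => Imz (h' k x)).
  have [Nx|Nx] := pselect (N x).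
    by split; under eq_fun do rewrite h0//; exact: is_cvg_cst.
  have [C hC] := (contra_notP (@NP x)) Nx.
  split; apply: (@cvg_geometric_steps _ C) => k; rewrite !hE//.
    by rewrite -RezN -RezD; apply: le_trans (hC k); exact: normr_Re_le.
  by rewrite -ImzN -ImzD; apply: le_trans (hC k); exact: normr_Im_le.
pose g x := limn (fun k => Rez (h' k x)) +i* limn (fun k => Imz (h' k x)).
have mh' k : cmeasurable (h' k).
  have m1 : measurable_fun setT (\1_(~` N) : T -> R).
    by apply: measurable_indic; exact: measurableC.
  have [mr mi] := mh k; split.
    rewrite (_ : _ \o _ = (fun x => \1_(~` N) x * (Rez \o h k) x)).
      exact: measurable_funM.
    by apply/funext => x; rewrite /comp /h' [LHS]RezM/= mul0r subr0.
  rewrite (_ : _ \o _ = (fun x => \1_(~` N) x * (Imz \o h k) x)).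
    exact: measurable_funM.
  by apply/funext => x; rewrite /comp /h' [LHS]ImzM/= mul0r addr0.
exists g.
  split.
    apply: (measurable_fun_cvg (h := fun k => Rez \o h' k)) => [k|x _].
      exact: (mh' k).1.
    exact: (h'cvg x).1.
  apply: (measurable_fun_cvg (h := fun k => Imz \o h' k)) => [k|x _].
    exact: (mh' k).2.
  exact: (h'cvg x).2.
exists N; split => // x /= xg; apply: contrapT => Nx; apply: xg.
have [] := h'cvg x.
split; rewrite /g/=.
  have -> : (fun n => Rez (h n x)) = (fun n => Rez (h' n x)).
    by apply/funext => n; rewrite hE.
  exact: (h'cvg x).1.
have -> : (fun n => Imz (h n x)) = (fun n => Imz (h' n x)).
  by apply/funext => n; rewrite hE.
exact: (h'cvg x).2.
Qed.

Definition cauchy_norm p (h : nat -> T -> R[i]) := forall e : R, 0 < e ->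
  exists K, forall j k, (K <= j)%N -> (K <= k)%N ->
    (cnorm p mu (fun x => h j x - h k x)%R <= e%:E)%E.

Definition cvg_norm p (h : nat -> T -> R[i]) (g : T -> R[i]) := forall e : R, 0 < e ->
  exists K, forall k, (K <= k)%N -> (cnorm p mu (fun x => h k x - g x)%R <= e%:E)%E.

Lemma fast_gt0 p k : 0 < (2^-1 ^+ k * (2^-1 ^+ k.+1) `^ p^-1 : R).
Proof. by rewrite mulr_gt0// ?powR_gt0 ?exprn_gt0// invr_gt0. Qed.

Lemma cauchy_norm_subseq p (h : nat -> T -> R[i]) : cauchy_norm p h ->
  exists2 m : nat -> nat, (forall k, (k <= m k)%N) &
  forall k j, (m k <= j)%N ->
    (cnorm p mu (fun x => h j x - h (m k) x)%R <=
    ((2^-1 ^+ k * (2^-1 ^+ k.+1) `^ p^-1)%R)%:E)%E /\ (m k <= m k.+1)%N.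
Proof.
move=> hc; have := fun k => hc _ (fast_gt0 p k) => /choice[K hK].
pose m k := (\sum_(i < k.+1) (K i).+1)%N.
have mS k : m k.+1 = (m k + (K k.+1).+1)%N by rewrite /m big_ord_recr.
have Km k : (K k < m k)%N by rewrite /m big_ord_recr/= leq_addl.
exists m.
  by elim=> // k IH; rewrite mS addnS ltnS (leq_trans IH)// leq_addr.
move=> k j kj; split; last by rewrite mS leq_addr.
by apply: hK; rewrite ?(leq_trans _ kj)// ltnW.
Qed.

(** The Riesz-Fischer theorem. A fast subsequence converges almost everywhere
    by [ae_fast_cvg], and Fatou's lemma turns this limit into a limit in
    norm. *)
Lemma Lp_complete p (h : nat -> T -> R[i]) : 1 <= p -> (forall k, memLp p mu (h k)) -> cauchy_norm p h ->
  exists2 g, memLp p mu g & cvg_norm p h g.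
Proof.
move=> p1 mh hc; have p0 : 0 < p by exact: lt_le_trans p1.
have [m km hm] := cauchy_norm_subseq hc.
have [|k|g mg hg] := @ae_fast_cvg p (fun k => h (m k)) p0.
- by move=> k; exact: (mh _).1.
- by apply: (hm k _ _).1; exact: (hm k _ (leqnn _)).2.
have cvg : cvg_norm p h g.
  move=> e e0; have [K hK] := hc _ e0; exists K => k Kk.
  apply: (@cnorm_fatou p (fun j x => h k x - h (m j) x)) => //.
  - exact: ltW.
  - by move=> j; apply: cmeasurableB; exact: (mh _).1.
  - by apply: cmeasurableB => //; exact: (mh _).1.
  - by apply: filterS hg => x; exact: ccvgB_cst.
  - by exists K => // j /= Kj; apply: hK => //; exact: leq_trans (km _).
exists g => //; split => //.
have [K /(_ _ (leqnn _)) hK] := cvg 1 ltr01.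
apply: le_lt_trans (le_cnorm_dist mu p1 mg (mh K).1) _.
rewrite cnorm_distC lte_add_pinfty//; first by rewrite (le_lt_trans hK)// ltry.
exact: (mh K).2.
Qed.

(** This carries L^p bounds through limits taken in L^2: a subsequence that
    converges fast in L^q converges almost everywhere, and Fatou's lemma
    applies. *)
Lemma cnorm_le_cvg_norm p q (h : nat -> T -> R[i]) g (C : R) : 0 < p -> 1 <= q -> 0 <= C ->
  (forall k, cmeasurable (h k)) -> cmeasurable g ->
  cvg_norm q h g -> (forall k, (cnorm p mu (h k) <= C%:E)%E) ->
  (cnorm p mu g <= C%:E)%E.
Proof.
move=> p0 q1 C0 mh mg hg hC.
have q0 : 0 < q by exact: lt_le_trans q1.
have := fun k => hg _ (fast_gt0 q k) => /choice[K hK].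
pose v k x := h (K k) x - g x.
have mv k : cmeasurable (v k) by exact: cmeasurableB.
have := ae_fast q0 mv (fun k => hK k _ (leqnn _)) => hv.
apply: (@cnorm_fatou p (fun k => h (K k))) => //; last exact: nearW.
apply: filterS hv => x [D hD].
have D0 : D * 2^-1 ^+ n @[n --> \oo] --> 0.
  rewrite -[X in _ --> X](mulr0 D); apply: cvgMr; apply: cvg_expr.
  by rewrite ger0_norm//; lra.
have sq (u : nat -> R) l : (forall k, `|u k - l| <= D * 2^-1 ^+ k) -> u n @[n --> \oo] --> l.
  move=> hu; apply/subr_cvg0; apply/norm_cvg0P.
  apply: (@squeeze_cvgr _ _ _ _ (fun _ => 0) (fun n => D * 2^-1 ^+ n)) => //.
  - by apply: nearW => n; rewrite normr_ge0/=.
  - exact: cvg_cst.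
split; apply: sq => k; apply: le_trans (hD k).
  by rewrite -RezN -RezD; exact: normr_Re_le.
by rewrite -ImzN -ImzD; exact: normr_Im_le.
Qed.

End convergence.

(** * Density, and the inner product of L^2 *)

Section density.
Context {d : measure_display} {T : measurableType d} {R : realType}.
Variable mu : {measure set T -> \bar R}.
Implicit Types (f g h : T -> R[i]) (a : R[i]) (p q : R).

Lemma cmeasurable_indicM (A : set T) f : measurable A -> cmeasurable f ->
  cmeasurable (fun x => (\1_A x)%:C * f x).
Proof.
move=> mA [mr mi].
have m1 : measurable_fun setT (\1_A : T -> R) by exact: measurable_indic.
split.
  rewrite (_ : _ \o _ = (fun x => \1_A x * (Rez \o f) x)).
    exact: measurable_funM.
  by apply/funext => x; rewrite /comp RezM/= mul0r subr0.
rewrite (_ : _ \o _ = (fun x => \1_A x * (Imz \o f) x)).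
  exact: measurable_funM.
by apply/funext => x; rewrite /comp ImzM/= mul0r addr0.
Qed.

Lemma normc_indicM (A : set T) (x : T) (z : R[i]) :
  nc ((\1_A x)%:C * z) = \1_A x * nc z.
Proof. by rewrite Normc.normcM normc_real ger0_norm// indicE ler0n. Qed.

(** Cutting off the values of [f] near zero and near infinity leaves a
    function of every L^q, and the error tends to zero by dominated
    convergence. *)
Lemma Lp_dense p q f (e : R) : 1 <= p -> 0 < q -> memLp p mu f -> 0 < e ->
  exists g, [/\ memLp q mu g, memLp p mu g &
    (cnorm p mu (fun x => f x - g x)%R <= e%:E)%E].
Proof.
move=> p1 q0 mf e0; have p0 : 0 < p by exact: lt_le_trans p1.
pose A k := [set x | k.+1%:R^-1 <= nc (f x) <= k.+1%:R].
have mA k : measurable (A k).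
  rewrite (_ : A k = setT `&` (nc \o f) @^-1` `[k.+1%:R^-1, k.+1%:R]).
    by apply: measurable_normc => //; exact: mf.1.
  by rewrite setTI; apply/seteqP; split => x /=; rewrite in_itv.
pose g k x := (\1_(A k) x)%:C * f x.
have mg k : cmeasurable (g k) by apply: cmeasurable_indicM => //; exact: mf.1.
have i_f : mu.-integrable setT (fun x => (nc (f x) `^ p)%:E).
  apply/integrableP; split; first by apply: measurable_normc_powR; exact: mf.1.
  under eq_integral do rewrite gee0_abs ?lee_fin ?powR_ge0//.
  by rewrite rnorm_powR// ltry.
have Lp k : memLp p mu (g k).
  apply: (ae_le_memLp p0 (mg k) _ mf); apply: aeW => x.
  by rewrite normc_indicM ler_piMl ?normc_ge0// indicE; case: (_ \in _).
have Lq k : memLp q mu (g k).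
  split => //; apply: cnorm_lty_powR => //.
  (* On the level set, [|f|^q = |f|^(q - p) |f|^p] and the first factor is at
     most [K]. *)
  pose K : R := k.+1%:R `^ `|q - p|.
  apply: (@le_lt_trans _ _ (\int[mu]_x (K%:E * (nc (f x) `^ p)%:E))%E).
    apply: ge0_le_integral => //.
    - by move=> x _; rewrite lee_fin powR_ge0.
    - exact: measurable_normc_powR.
    - by apply: emeasurable_funM => //; apply: measurable_normc_powR; exact: mf.1.
    move=> x _; rewrite -EFinM lee_fin normc_indicM indicE.
    have [/set_mem /=/andP[h1 h2]|_] := boolP (x \in A k); last first.
      by rewrite mul0r powR0 ?gt_eqF// mulr_ge0// powR_ge0.
    have nf0 : 0 < nc (f x) by apply: lt_le_trans h1; rewrite invr_gt0.
    rewrite mul1r -{1}(subrK p q) powRD ?(gt_eqF nf0) ?implybT//.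
    rewrite ler_wpM2r ?powR_ge0// /K.
    have [qp|qp] := leP 0 (q - p).
      rewrite ger0_norm//.
      by apply: ge0_ler_powR; rewrite ?nnegrE ?ler0n ?normc_ge0.
    have -> : nc (f x) `^ (q - p) = (nc (f x))^-1 `^ (p - q).
      by rewrite -powR_inv1 ?normc_ge0// -powRrM mulN1r opprB.
    rewrite ltr0_norm// opprB.
    apply: ge0_ler_powR; rewrite ?nnegrE ?invr_ge0 ?ler0n ?normc_ge0//.
      by rewrite subr_ge0 -subr_le0 ltW.
    by rewrite -(invrK k.+1%:R) lef_pV2// posrE// invr_gt0.
  rewrite ge0_integralZl_EFin ?powR_ge0//.
  - by rewrite rnorm_powR// -EFinM ltry.
  - by move=> x _; rewrite lee_fin powR_ge0.
  - by apply: measurable_normc_powR; exact: mf.1.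
have gE k x : nc (f x - g k x) = \1_(~` A k) x * nc (f x).
  rewrite (_ : f x - g k x = (\1_(~` A k) x)%:C * f x) ?normc_indicM//.
  rewrite /g !indicE in_setC; case: (x \in A k) => /=.
    by rewrite mul1r subrr mul0r.
  by rewrite mul0r subr0 mul1r.
have cvg0 x : (nc (f x - g k x) `^ p)%:E @[k --> \oo] --> 0%E.
  apply: cvg_near_cst.
  have [fx0|fx0] := eqVneq (nc (f x)) 0.
    by apply: nearW => k; rewrite gE fx0 mulr0 powR0// gt_eqF.
  have fx1 : 0 < nc (f x) by rewrite lt_def fx0 normc_ge0.
  near=> k; rewrite gE.
  suff : A k x by move=> Ax; rewrite indicE memNset ?mul0r ?powR0 ?gt_eqF//= => /(_ Ax).
  rewrite /A/=; apply/andP; split.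
    rewrite -(invrK (nc _)) lef_pV2 ?posrE ?invr_gt0//.
    apply: (@le_trans _ _ k%:R); last by rewrite ler_nat.
    by near: k; exact: nbhs_infty_ger.
  apply: (@le_trans _ _ k%:R); last by rewrite ler_nat.
  by near: k; exact: nbhs_infty_ger.
have dom k x : (`|(nc (f x - g k x) `^ p)%:E| <= (nc (f x) `^ p)%:E)%E.
  rewrite gee0_abs ?lee_fin ?powR_ge0//.
  apply: ge0_ler_powR; rewrite ?nnegrE ?normc_ge0//; first exact: ltW.
  by rewrite gE ler_piMl ?normc_ge0// indicE; case: (_ \in _).
have [_ _] := dominated_convergence measurableT
  (fun k => measurable_normc_powR p (cmeasurableB mf.1 (mg k)))
  (measurable_cst 0%E) (aeW _ (fun x _ => cvg0 x)) i_f
  (aeW _ (fun x k _ => dom k x)).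
rewrite integral0 => /fine_cvgP[finI /cvgr0Pnorm_le /(_ (e `^ p))].
rewrite powR_gt0// => /(_ isT) small.
near \oo => k; exists (g k); split => //.
apply: cnorm_le_powR => //; first exact: ltW.
have fk : (\int[mu]_x (nc (f x - g k x) `^ p)%:E)%E \is a fin_num.
  by near: k.
rewrite -(fineK fk) lee_fin.
apply: le_trans (ler_norm _) _.
by near: k.
Unshelve. all: by end_near. Qed.

End density.

Section inner.
Context {d : measure_display} {T : measurableType d} {R : realType}.
Variable mu : {measure set T -> \bar R}.
Implicit Types (f g h : T -> R[i]) (a : R[i]).

Lemma memL2_sqr_integrable f : memLp 2 mu f ->
  mu.-integrable setT (EFin \o (fun x => nc (f x) ^+ 2)).
Proof.
move=> mf; apply/integrableP; split.
  by apply/measurable_EFinP/measurable_funX/measurable_normc; exact: mf.1.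
under eq_integral do
  rewrite /comp gee0_abs ?lee_fin ?sqr_ge0// -powR_mulrn ?normc_ge0//.
by rewrite rnorm_powR// ltry.
Qed.

Lemma rnorm_sqr f : memLp 2 mu f ->
  rnorm mu 2 f ^+ 2 = (\int[mu]_x nc (f x) ^+ 2)%R.
Proof.
move=> mf; rewrite /Rintegral.
under eq_integral do rewrite -powR_mulrn ?normc_ge0//.
by rewrite rnorm_powR//= powR_mulrn// rnorm_ge0.
Qed.

Lemma integrable_le_sqr (u : T -> R) f g : memLp 2 mu f -> memLp 2 mu g ->
  measurable_fun setT u -> (forall x, `|u x| <= nc (f x) * nc (g x)) ->
  mu.-integrable setT (EFin \o u).
Proof.
move=> mf mg mu_u h.
have : mu.-integrable setT (EFin \o (fun x => nc (f x) ^+ 2 + nc (g x) ^+ 2)).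
  exact: (integrableD measurableT (memL2_sqr_integrable mf) (memL2_sqr_integrable mg)).
apply: le_integrable => //; first exact/measurable_EFinP.
move=> x _ /=; rewrite lee_fin [leRHS]ger0_norm ?addr_ge0 ?sqr_ge0//.
apply: le_trans (h x) _.
have := sqr_ge0 (nc (f x) - nc (g x)).
have := sqr_ge0 (nc (f x)); have := sqr_ge0 (nc (g x)); rewrite sqrrB; lra.
Qed.

Lemma measurable_inner f g : cmeasurable f -> cmeasurable g ->
  measurable_fun setT (fun x => Rez (f x * conjc (g x))) /\
  measurable_fun setT (fun x => Imz (f x * conjc (g x))).
Proof.
move=> [fr fi] [gr gi]; split.
  rewrite (_ : (fun x => _) = (fun x => (Rez \o f) x * (Rez \o g) x +
      (Imz \o f) x * (Imz \o g) x)).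
    by apply: measurable_funD; exact: measurable_funM.
  by apply/funext => x; rewrite !ReImE mulrN opprK.
rewrite (_ : (fun x => _) = (fun x => (Imz \o f) x * (Rez \o g) x -
    (Rez \o f) x * (Imz \o g) x)).
  by apply: measurable_funB; exact: measurable_funM.
by apply/funext => x; rewrite !ReImE mulrN addrC.
Qed.

Lemma normc_conjc (z : R[i]) : nc (conjc z) = nc z.
Proof. by case: z => a b /=; rewrite sqrrN. Qed.

Lemma inner_integrable f g : memLp 2 mu f -> memLp 2 mu g ->
  mu.-integrable setT (EFin \o (fun x => Rez (f x * conjc (g x)))) /\
  mu.-integrable setT (EFin \o (fun x => Imz (f x * conjc (g x)))).
Proof.
move=> mf mg; have [m1 m2] := measurable_inner mf.1 mg.1.
split; apply: (integrable_le_sqr mf mg) => // x;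
  rewrite -(normc_conjc (g x)) -Normc.normcM.
- exact: normr_Re_le.
- exact: normr_Im_le.
Qed.

Lemma inner_lin a f g h : memLp 2 mu f -> memLp 2 mu g -> memLp 2 mu h ->
  inner mu (fun x => a * f x + g x) h = a * inner mu f h + inner mu g h.
Proof.
move=> mf mg mh.
have [rf if_] := inner_integrable mf mh; have [rg ig] := inner_integrable mg mh.
have intZ (c : R) (u : T -> R) : mu.-integrable setT (EFin \o u) ->
    mu.-integrable setT (EFin \o (fun x => c * u x)).
  by move=> iu; exact: (integrableZl measurableT c iu).
have intD (u v : T -> R) : mu.-integrable setT (EFin \o u) ->
    mu.-integrable setT (EFin \o v) ->
    mu.-integrable setT (EFin \o (fun x => u x + v x)).
  by move=> iu iv; exact: (integrableD measurableT iu iv).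
have intB (u v : T -> R) : mu.-integrable setT (EFin \o u) ->
    mu.-integrable setT (EFin \o v) ->
    mu.-integrable setT (EFin \o (fun x => u x - v x)).
  by move=> iu iv; exact: (integrableB measurableT iu iv).
apply: complex_ext; rewrite !ReImE /inner/=.
  rewrite -!RintegralZl// -RintegralB//; [|exact: intZ..].
  rewrite -RintegralD//; last by apply: intB; exact: intZ.
  by apply: eq_Rintegral => x _; rewrite !ReImE; ring.
rewrite -!RintegralZl// -RintegralD//; [|exact: intZ..].
rewrite -RintegralD//; last by apply: intD; exact: intZ.
by apply: eq_Rintegral => x _; rewrite !ReImE; ring.
Qed.

Lemma inner_conj f g : memLp 2 mu f -> memLp 2 mu g ->
  inner mu g f = conjc (inner mu f g).
Proof.
move=> mf mg; have [rf if_] := inner_integrable mf mg.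
apply: complex_ext; rewrite !ReImE /inner/=.
  by apply: eq_Rintegral => x _; rewrite !ReImE; ring.
rewrite -mulN1r -RintegralZl//.
by apply: eq_Rintegral => x _; rewrite !ReImE; ring.
Qed.

Lemma inner_self f : memLp 2 mu f -> inner mu f f = (rnorm mu 2 f ^+ 2)%:C.
Proof.
move=> mf; rewrite rnorm_sqr//; apply: complex_ext; rewrite /inner/=.
  by apply: eq_Rintegral => x _; rewrite !ReImE sqr_nc; ring.
rewrite (_ : (fun x => _) = cst 0); first by rewrite Rintegral_cst//= mul0r.
by apply/funext => x; rewrite !ReImE/=; ring.
Qed.

Lemma inner_aer f g g' : ae_eqc mu g g' -> cmeasurable f -> cmeasurable g ->
  cmeasurable g' -> inner mu f g = inner mu f g'.
Proof.
move=> gg' mf mg mg'.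
have [m1 m2] := measurable_inner mf mg; have [m3 m4] := measurable_inner mf mg'.
apply: complex_ext; rewrite /inner/=; congr fine; apply: ae_eq_integral => //;
  try exact/measurable_EFinP; by apply: filterS gg' => x -> _.
Qed.

Lemma inner0l h : memLp 2 mu h -> inner mu (fun=> 0) h = 0.
Proof.
move=> mh; have m0 : memLp 2 mu (fun _ => 0) by apply: memLp_cst0.
have := inner_lin (-1) m0 m0 mh; rewrite [X in _ = X + _]mulN1r addNr => h1.
by apply: etrans h1; congr inner; apply/funext => x; rewrite mulr0 addr0.
Qed.

Lemma inner_suml (I : Type) (s : seq I) (F : I -> T -> R[i]) h :
  (forall i, memLp 2 mu (F i)) -> memLp 2 mu h ->
  inner mu (fun x => \sum_(i <- s) F i x) h = \sum_(i <- s) inner mu (F i) h.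
Proof.
move=> mF mh; have two1 : 1 <= 2 :> R by lra.
elim: s => [|i s IH].
  rewrite big_nil -[RHS](inner0l mh); congr inner.
  by apply/funext => x; rewrite big_nil.
rewrite big_cons -IH -[inner _ (F i) _]mul1r -inner_lin//; last exact: memLp_sum.
by congr inner; apply/funext => x; rewrite big_cons mul1r.
Qed.

Lemma inner_Zl a f h : memLp 2 mu f -> memLp 2 mu h ->
  inner mu (fun x => a * f x) h = a * inner mu f h.
Proof.
move=> mf mh; have m0 : memLp 2 mu (fun _ => 0) by apply: memLp_cst0.
rewrite -[RHS]addr0 -(inner0l mh) -inner_lin//.
by congr inner; apply/funext => x; rewrite addr0.
Qed.

End inner.

(** * Step functions of a real variable *)

(** Step functions are lists of values and sets, because one and the same list is
    read as a function of the spectral variable and as a combination of spectral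
    projections. *)
Section steps.
Context {R : realType}.
Local Notation mR := (measurableTypeR R).

Definition bset := {A : set mR | measurable A}.
Definition step := seq (R[i] * bset).
Implicit Types s t : step.

Definition step_fun s (l : R) : R[i] := \sum_(c <- s) c.1 * (\1_(sval c.2) l)%:C.

Definition stepZ (a : R[i]) s : step := [seq (a * c.1, c.2) | c <- s].

Definition bsetI (A B : bset) : bset :=
  exist _ (sval A `&` sval B) (measurableI _ _ (svalP A) (svalP B)).

Definition stepM s t : step :=
  [seq (c.1 * e.1, bsetI c.2 e.2) | c <- s, e <- t].

Lemma step_funD s t l : step_fun (s ++ t) l = step_fun s l + step_fun t l.
Proof. by rewrite /step_fun big_cat. Qed.

Lemma step_funZ a s l : step_fun (stepZ a s) l = a * step_fun s l.
Proof.
by rewrite /step_fun /stepZ big_map mulr_sumr; apply: eq_bigr => c _; rewrite mulrA.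
Qed.

Lemma step_funM s t l : step_fun (stepM s t) l = step_fun s l * step_fun t l.
Proof.
rewrite /step_fun /stepM big_allpairs_dep mulr_suml; apply: eq_bigr => c _.
rewrite mulr_sumr; apply: eq_bigr => e _ /=.
rewrite indicI rmorphM/=; ring.
Qed.

Lemma step_funB s t l :
  step_fun (s ++ stepZ (-1) t) l = step_fun s l - step_fun t l.
Proof. by rewrite step_funD step_funZ mulN1r. Qed.

Lemma cmeasurable_step s : cmeasurable (step_fun s : mR -> R[i]).
Proof.
elim: s => [|c s IH].
  rewrite (_ : step_fun _ = fun=> 0); first exact: cmeasurable_cst.
  by apply/funext => l; rewrite /step_fun big_nil.
rewrite (_ : step_fun _ = fun l => c.1 * (\1_(sval c.2) l)%:C + step_fun s l).
  apply: cmeasurable_lin => //; apply: cmeasurable_real.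
  exact: measurable_indic (svalP c.2).
by apply/funext => l; rewrite /step_fun big_cons.
Qed.

(** The sum counts the positive multiples of [e] below [y]: this is rounding
    down to a multiple of [e]. *)
Lemma stair (e y : R) m : 0 < e -> 0 <= y -> y < e *+ m.+1 ->
  `|y - e * \sum_(k < m) (e *+ k.+1 <= y)%R%:R| <= e.
Proof.
move=> e0; elim: m y => [|m IH] y y0 ym.
  by rewrite big_ord0 mulr0 subr0 ger0_norm// ltW.
rewrite big_ord_recl/=; have [ye|ye] := leP (e *+ 1) y; last first.
  rewrite big1 => [|k _].
    by rewrite addr0 mulr0 subr0 ger0_norm// ltW.
  have -> : (e *+ (bump 0 k).+1 <= y) = false.
    apply/negbTE; rewrite -ltNge; apply: lt_le_trans ye _.
    by rewrite (ler_pMn2l e0).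
  by [].
have y'0 : 0 <= y - e by rewrite subr_ge0.
have y'm : y - e < e *+ m.+1 by rewrite ltrBlDr -mulrSr.
have := IH _ y'0 y'm; congr (`|_| <= _).
rewrite mulrDr mulr1 opprD addrA; congr (_ - _ * _).
by apply: eq_bigr => k _; rewrite lerBrDr -mulrSr.
Qed.

Lemma real_step_approx (phi : mR -> R) (B e : R) : measurable_fun setT phi ->
  (forall l, `|phi l| <= B) -> 0 < e ->
  exists s, forall l, nc ((phi l)%:C - step_fun s l) <= e.
Proof.
move=> mphi hB e0.
have B0 : 0 <= B by exact: le_trans (hB 0).
pose m := Num.truncn (2 * B / e).
have mA k : measurable [set l : mR | e *+ k.+1 <= phi l + B].
  rewrite (_ : [set l | _] = setT `&` phi @^-1` `[e *+ k.+1 - B, +oo[).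
    exact: mphi.
  by rewrite setTI; apply/seteqP; split => x /=; rewrite in_itv/= andbT lerBlDr.
pose A k : bset := exist _ _ (mA k).
pose T : bset := exist _ setT measurableT.
pose s : step := ((- B)%:C, T) :: [seq (e%:C, A k) | k <- iota 0 m].
exists s => l.
have -> : step_fun s l = (e * (\sum_(k < m) (e *+ k.+1 <= phi l + B)%R%:R) - B)%:C.
  rewrite /step_fun /s big_cons big_map /= indicT mulr1 addrC rmorphB/=.
  rewrite rmorphN/=; congr (_ - _); rewrite mulr_sumr rmorph_sum/=.
  rewrite -(big_mkord xpredT (fun k => (e * (e *+ k.+1 <= phi l + B)%R%:R)%:C)).
  rewrite /index_iota subn0; apply: eq_bigr => k _.
  rewrite indicE rmorphM/=; congr (_ * _%:C); congr (_%:R).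
  have [h|h] := boolP (e *+ k.+1 <= phi l + B); first by rewrite mem_set.
  by rewrite memNset// => /= h'; rewrite h' in h.
rewrite -rmorphB normc_real opprB addrA; apply: stair => //.
  by have := hB l; rewrite ler_norml => /andP[]; lra.
have h1 : phi l + B <= 2 * B by have := hB l; rewrite ler_norml => /andP[]; lra.
apply: le_lt_trans h1 _.
have : 2 * B / e < m.+1%:R by rewrite /m truncnS_gt.
by rewrite ltr_pdivrMr// [X in _ < X -> _]mulr_natl.
Qed.

Lemma step_approx (phi : mR -> R[i]) (B e : R) : cmeasurable phi ->
  (forall l, nc (phi l) <= B) -> 0 < e ->
  exists s, forall l, nc (phi l - step_fun s l) <= e.
Proof.
move=> [mr mi] hB e0; have e20 : 0 < e / 2 by rewrite divr_gt0.
have [s hs] := @real_step_approx _ B _ mr (fun l => le_trans (normr_Re_le _) (hB l)) e20.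
have [t ht] := @real_step_approx _ B _ mi (fun l => le_trans (normr_Im_le _) (hB l)) e20.
exists (s ++ stepZ 'i%C t) => l.
rewrite step_funD step_funZ [X in X - _]complexE opprD addrACA -mulrBr.
apply: le_trans (normcD _ _) _.
have -> : nc ('i%C * ((Imz (phi l))%:C - step_fun t l)) =
    nc ((Imz (phi l))%:C - step_fun t l).
  by rewrite Normc.normcM [X in X * _]/= expr0n expr1n/= add0r sqrtr1 mul1r.
by have := hs l; have := ht l; rewrite /=; lra.
Qed.

End steps.

Section finite_measure_steps.
Context {R : realType}.
Local Notation mR := (measurableTypeR R).
Variable nu : {finite_measure set mR -> \bar R}.

Lemma integral_comb (t : seq (R * @bset R)) :
  nu.-integrable setT (EFin \o (fun l => \sum_(c <- t) c.1 * \1_(sval c.2) l)) /\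
  (\int[nu]_l \sum_(c <- t) c.1 * \1_(sval c.2) l =
   \sum_(c <- t) c.1 * fine (nu (sval c.2)))%R.
Proof.
elim: t => [|c t [IH1 IH2]].
  rewrite big_nil; split.
    rewrite (_ : _ \o _ = cst 0%E); first exact: integrable0.
    by apply/funext => l /=; rewrite big_nil.
  under eq_Rintegral do rewrite big_nil.
  by rewrite Rintegral_cst// mul0r.
have ic : nu.-integrable setT (EFin \o (\1_(sval c.2) : mR -> R)).
  exact: integrable_indic (svalP c.2).
have icz : nu.-integrable setT (EFin \o (fun l => c.1 * \1_(sval c.2) l)).
  exact: (integrableZl measurableT c.1 ic).
split.
  rewrite (_ : _ \o _ = EFin \o (fun l => c.1 * \1_(sval c.2) l +
      \sum_(e <- t) e.1 * \1_(sval e.2) l)).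
    exact: (integrableD measurableT icz IH1).
  by apply/funext => l /=; rewrite big_cons.
under eq_Rintegral do rewrite big_cons.
rewrite RintegralD// IH2 big_cons RintegralZl//; congr (_ * _ + _).
by rewrite /Rintegral integral_indic ?setIT//; exact: svalP.
Qed.

(** The square of the norm is written as a quadratic form in the coefficients,
    to be compared with [step_op_sqr]. *)
Lemma rnorm_step_sqr (s : @step R) :
  memLp 2 nu (step_fun s) /\
  rnorm nu 2 (step_fun s) ^+ 2 =
  \sum_(c <- s) \sum_(e <- s) Rez (c.1 * conjc e.1) * fine (nu (sval c.2 `&` sval e.2)).
Proof.
pose t : seq (R * @bset R) :=
  [seq (Rez (c.1 * conjc e.1), bsetI c.2 e.2) | c <- s, e <- s].
have [h1 h2] := integral_comb t.
have sE l : nc (step_fun s l) ^+ 2 = \sum_(c <- t) c.1 * \1_(sval c.2) l.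
  have -> : nc (step_fun s l) ^+ 2 = Rez (step_fun s l * conjc (step_fun s l)).
    by rewrite sqr_nc !ReImE; ring.
  rewrite /t big_allpairs_dep {1}/step_fun mulr_suml.
  rewrite (big_morph (@complex.Re R) RezD (erefl _)); apply: eq_bigr => c _.
  rewrite /step_fun (rmorph_sum (@conjc R)) mulr_sumr.
  rewrite (big_morph (@complex.Re R) RezD (erefl _)); apply: eq_bigr => e _ /=.
  rewrite indicI/= rmorphM/= !ReImE/=; ring.
have mem : memLp 2 nu (step_fun s).
  split; first exact: cmeasurable_step.
  apply: cnorm_lty_powR => //.
  under eq_integral do rewrite powR_mulrn ?normc_ge0// sE.
  have /integrable_fin_num := h1 => /(_ measurableT).
  by rewrite ge0_fin_numE// integral_ge0// => x _; rewrite lee_fin -sE sqr_ge0.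
split => //; rewrite rnorm_sqr//.
under eq_Rintegral do rewrite sE.
by rewrite h2 /t big_allpairs_dep.
Qed.

Lemma rnorm_sup (g : mR -> R[i]) (B : R) : cmeasurable g -> 0 <= B ->
  (forall l, nc (g l) <= B) ->
  memLp 2 nu g /\ rnorm nu 2 g <= B * Num.sqrt (fine (nu setT)).
Proof.
move=> mg B0 hB.
have bound : (cnorm 2 nu g <= (B * Num.sqrt (fine (nu setT)))%:E)%E.
  apply: cnorm_le_powR => //; first by rewrite mulr_ge0// sqrtr_ge0.
  rewrite powR_mulrn ?mulr_ge0 ?sqrtr_ge0// exprMn sqr_sqrtr ?fine_ge0//.
  apply: (@le_trans _ _ (\int[nu]_x (B ^+ 2)%:E)%E).
    apply: ge0_le_integral => //.
    - by move=> x _; rewrite lee_fin powR_ge0.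
    - exact: measurable_normc_powR.
    - by move=> x _; rewrite lee_fin powR_mulrn ?normc_ge0// ler_sqr ?nnegrE ?normc_ge0.
  by rewrite integral_cst// [leRHS]EFinM fineK// fin_num_measure.
have mem : memLp 2 nu g by split => //; exact: le_lt_trans bound (ltry _).
by split => //; rewrite -lee_fin -rnormE.
Qed.

End finite_measure_steps.

(** * Scalar spectral measures *)

Lemma two_ge1 (R : realType) : 1 <= 2 :> R. Proof. by rewrite ler1n. Qed.
#[local] Hint Extern 0 (is_true (1 <= 2)) => exact: two_ge1 : core.

Section spectral.
Context {d : measure_display} {T : measurableType d} {R : realType}.
Variable mu : {measure set T -> \bar R}.
Variable E : set R -> (T -> R[i]) -> (T -> R[i]).
Hypothesis hE : projection_valued_measure mu E.
Local Notation mR := (measurableTypeR R).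
Local Notation L2 := (memLp 2 mu).
Local Notation N := (rnorm mu 2).
Implicit Types (f g h : T -> R[i]) (a : R[i]) (A B : @bset R) (s t : @step R).

Lemma E_mem A f : L2 f -> L2 (E (sval A) f).
Proof. by case: hE => h *; apply: h => //; exact: svalP. Qed.

Lemma E_lin A a f g : L2 f -> L2 g ->
  ae_eqc mu (E (sval A) (fun x => a * f x + g x))
            (fun x => a * E (sval A) f x + E (sval A) g x).
Proof. by case: hE => _ h _ _ _ mf mg; have [] := h (sval A) a f g (svalP A) mf mg. Qed.

Lemma E_sym A f g : L2 f -> L2 g ->
  inner mu (E (sval A) f) g = inner mu f (E (sval A) g).
Proof. by case: hE => _ h _ _ _ mf mg; have [] := h (sval A) 0 f g (svalP A) mf mg. Qed.

Lemma E_I A B f : L2 f ->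
  ae_eqc mu (E (sval (bsetI A B)) f) (E (sval A) (E (sval B) f)).
Proof. by case: hE => _ _ h _ _ mf; apply: h => //; exact: svalP. Qed.

Lemma ae_eqc_sym f g : ae_eqc mu f g -> ae_eqc mu g f.
Proof. by apply: filterS => x ->. Qed.

(** The scalar spectral measure of [f], with real values. *)
Definition smass f (A : set mR) : R := N (E A f) ^+ 2.

(** [E A] and [E B] are commuting orthogonal projections with product [E (A
    `&` B)]. *)
Lemma inner_EE A B f : L2 f ->
  inner mu (E (sval A) f) (E (sval B) f) = (smass f (sval A `&` sval B))%:C.
Proof.
move=> mf.

have mEA := E_mem A mf; have mEB := E_mem B mf.
have key (C D : bset) : inner mu f (E (sval C) (E (sval D) f)) =
    inner mu f (E (sval C `&` sval D) f).
  apply: inner_aer (mf.1) (E_mem C (E_mem D mf)).1 (E_mem (bsetI C D) mf).1.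
  exact/ae_eqc_sym/E_I.
rewrite E_sym// key -[X in E X f]setIid -[sval A `&` _]/(sval (bsetI A B)).
by rewrite -key -E_sym ?inner_self//; exact: E_mem.
Qed.

Lemma smassT f : L2 f -> smass f setT = N f ^+ 2.
Proof.
case: hE => h _ _ hT _ mf; rewrite /smass; congr (_ ^+ 2).
by apply: ae_eq_rnorm => //; [exact: (h _ _ measurableT mf).1|exact: mf.1|exact: hT].
Qed.

Lemma Lnorm_cvg0 (u : nat -> T -> R[i]) : (forall n, L2 (u n)) ->
  cnorm 2 mu (u n) @[n --> \oo] --> 0%E -> N (u n) @[n --> \oo] --> 0.
Proof. by move=> mu_u; under eq_cvg do rewrite rnormE//; move=> /fine_cvg. Qed.

Lemma E_cvg (F : nat -> @bset R) f : trivIset setT (fun k => sval (F k)) -> L2 f ->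
  N (fun x => E (\bigcup_k sval (F k)) f x - \sum_(k < m) E (sval (F k)) f x)
    @[m --> \oo] --> 0.
Proof.
case: hE => h _ _ _ hs tF mf; apply: Lnorm_cvg0.
  move=> n; apply: memLpB => //; last by apply: memLp_sum => // i; exact: E_mem.
  by apply: h => //; apply: bigcupT_measurable => k; exact: svalP.
by apply: hs => // k; exact: svalP.
Qed.

Lemma smass0 f : L2 f -> smass f set0 = 0.
Proof.
move=> mf; pose Z : @bset R := exist _ set0 measurable0.
have mZ := E_mem Z mf.
have tF : trivIset setT (fun k : nat => sval ((fun=> Z) k)).
  by apply/trivIsetP => i j _ _ _; rewrite set0I.
(* Countable additivity for the constant sequence of empty sets: the vectors
   [(1 - n) E(set0) f] tend to zero. *)
have := E_cvg tF mf; rewrite bigcup0//.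
have h2 n : N (fun x => E set0 f x - \sum_(k < n) E set0 f x) = `|1 - n%:R| * N (E set0 f).
  rewrite -[ `|_| ]normc_real -rnormZ//; apply: eq_rnorm => x.
  by rewrite sumr_const card_ord rmorphB/= rmorph_nat mulrBl mul1r mulr_natl.
under eq_cvg do rewrite h2.
move=> /cvgrPdist_lt h3.
apply/eqP; rewrite /smass sqrf_eq0; apply/negP => /negP n0.
have n0' : 0 < N (E set0 f) by rewrite lt_def n0 rnorm_ge0.
have [K _ /(_ (K + 2)%N)] := h3 _ n0'.
rewrite /= leq_addr => /(_ isT).
rewrite sub0r normrN normrM normr_id [ `|N _| ]ger0_norm ?rnorm_ge0//.
rewrite -[ltRHS]mul1r ltr_pM2r// natrD opprD addrA distrC ltNge.
rewrite (le_trans _ (ler_norm _))//.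
have : 0 <= K%:R :> R by []. lra.
Qed.

Definition step_operator s f (x : T) : R[i] := \sum_(c <- s) c.1 * E (sval c.2) f x.

Lemma step_op_mem s f : L2 f -> L2 (step_operator s f).
Proof. by move=> mf; apply: memLp_sum => // c; apply: memLpZ => //; exact: E_mem. Qed.

(** The vectors [E A f] and [E B f] have inner product [smass f (A `&` B)], by
    [inner_EE]: expanding the square gives the same quadratic form as for the
    step function in L^2 of the scalar spectral measure. *)
Lemma step_op_sqr s f : L2 f ->
  N (step_operator s f) ^+ 2 =
  \sum_(c <- s) \sum_(e <- s) Rez (c.1 * conjc e.1) * smass f (sval c.2 `&` sval e.2).
Proof.
move=> mf; have ms := step_op_mem s mf.
have mE (c : R[i] * @bset R) : L2 (fun x => c.1 * E (sval c.2) f x).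
  by apply: memLpZ => //; exact: E_mem.
apply: complexI; rewrite -inner_self// {1}/step_operator inner_suml//.
suff : \sum_(c <- s) inner mu (fun x => c.1 * E (sval c.2) f x) (step_operator s f) =
   \sum_(c <- s) \sum_(e <- s) c.1 * conjc e.1 * (smass f (sval c.2 `&` sval e.2))%:C.
  move=> h; have := inner_self ms; rewrite {1}/step_operator inner_suml// => h0.
  rewrite h0; congr (_%:C); move: h0; rewrite h => /(congr1 (@complex.Re R))/= <-.
  rewrite (big_morph (@complex.Re R) RezD (erefl _)); apply: eq_bigr => c _.
  rewrite (big_morph (@complex.Re R) RezD (erefl _)); apply: eq_bigr => e _.
  by rewrite [LHS]RezM/= mulr0 subr0.
apply: eq_bigr => c _; rewrite inner_Zl//; last exact: E_mem.
rewrite inner_conj//; last exact: E_mem.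
rewrite inner_suml//; last exact: E_mem.
rewrite (rmorph_sum (@conjc R)) mulr_sumr; apply: eq_bigr => e _.
rewrite inner_Zl//; [|exact: E_mem..].
by rewrite inner_EE// rmorphM [X in _ * (_ * X)]conjc_real mulrA setIC.
Qed.

Lemma spectral_distE f A : L2 f -> spectral_dist mu E f (sval A) = (smass f (sval A))%:E.
Proof.
move=> mf; rewrite /spectral_dist rnormE; last exact: E_mem.
by rewrite poweR_EFin powR_mulrn ?rnorm_ge0.
Qed.

Section spectral_measure.
Variables (f : T -> R[i]) (mf : L2 f).

(** The hypotheses that make this set function a measure are arguments of the
    definition, so that the measure structures declared below can find
    them. *)
Definition smeas of projection_valued_measure mu E & L2 f := spectral_dist mu E f.

Let smeas0 : smeas hE mf set0 = 0%E.
Proof.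
pose Z : @bset R := exist _ set0 measurable0.
by rewrite /smeas (spectral_distE Z mf) smass0.
Qed.

Let smeas_ge0 (A : set mR) : (0 <= smeas hE mf A)%E. Proof. exact: poweR_ge0. Qed.

Let smeas_sigma_additive : semi_sigma_additive (smeas hE mf).
Proof.
move=> F0 mF tF mUF; pose F k : @bset R := exist _ (F0 k) (mF k).
pose U : @bset R := exist _ (\bigcup_k F0 k) mUF.
have tF' : trivIset setT (fun k => sval (F k)) by [].
rewrite /smeas (spectral_distE U mf).
have sE n : (\sum_(0 <= i < n) spectral_dist mu E f (F0 i) =
    (N (fun x => \sum_(k < n) E (sval (F k)) f x)%R ^+ 2)%:E)%E.
  pose s : @step R := [seq (1, F k) | k <- index_iota 0 n].
  have -> : (fun x => \sum_(k < n) E (sval (F k)) f x) = step_operator s f.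
    apply/funext => x; rewrite /step_operator big_map big_mkord.
    by apply: eq_bigr => k _; rewrite mul1r.
  rewrite (eq_bigr (fun i => (smass f (sval (F i)))%:E)); last first.
    by move=> i _; exact: (spectral_distE (F i) mf).
  rewrite sumEFin step_op_sqr// /s big_map/=; congr EFin.
  apply: eq_big_seq => i; rewrite mem_index_iota => ni.
  rewrite big_map/= (bigD1_seq i) ?mem_index_iota ?iota_uniq//=.
  rewrite setIid mul0r subr0 !mul1r big1 ?addr0// => j ji.
  have /trivIsetP/(_ i j I I) := tF; rewrite eq_sym ji => /(_ isT) ->.
  by rewrite smass0// mulr0.
under eq_cvg do rewrite sE.
apply: cvg_EFin; first exact: nearW.
rewrite /comp/=.
have mUf := E_mem U mf.
have mS n : L2 (fun x => \sum_(k < n) E (sval (F k)) f x).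
  by apply: memLp_sum => // i; exact: E_mem.
suff h : N (fun x => \sum_(k < n) E (sval (F k)) f x) @[n --> \oo] --> N (E (sval U) f).
  by rewrite /smass; under eq_cvg do rewrite expr2; rewrite expr2; exact: cvgM.
apply/subr_cvg0/norm_cvg0P.
apply: (squeeze_cvgr _ (cvg_cst 0) (E_cvg tF' mf)).
apply: nearW => n; rewrite normr_ge0/= distrC.
exact: (rnorm_dist_norm _ mUf (mS n)).
Qed.

HB.instance Definition _ := isMeasure.Build _ _ _
  (smeas hE mf) smeas0 smeas_ge0 smeas_sigma_additive.

Let smeas_fin : fin_num_fun (smeas hE mf).
Proof. by move=> A mA; rewrite /smeas (spectral_distE (exist _ A mA) mf). Qed.

HB.instance Definition _ := Measure_isFinite.Build _ _ _ (smeas hE mf) smeas_fin.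

Lemma smeasE A : fine (smeas hE mf (sval A)) = smass f (sval A).
Proof. by rewrite /smeas spectral_distE. Qed.

End spectral_measure.

(** The isometry between L^2 of the scalar spectral measure and the cyclic
    subspace of [f], on step functions. *)
Lemma rnorm_step_op s f (mf : L2 f) : rnorm (smeas hE mf) 2 (step_fun s) = N (step_operator s f).
Proof.
apply/eqP; rewrite -(eqrXn2 (ltn0Sn 1)) ?rnorm_ge0//; apply/eqP.
have [_ ->] := rnorm_step_sqr (smeas hE mf) s.
rewrite step_op_sqr//; apply: eq_bigr => c _; apply: eq_bigr => e _.
by rewrite -(smeasE mf (bsetI c.2 e.2)).
Qed.

End spectral.

(** * Bounded Borel functional calculus *)

Section calculus.
Context {d : measure_display} {T : measurableType d} {R : realType}.
Variable mu : {measure set T -> \bar R}.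
Variable E : set R -> (T -> R[i]) -> (T -> R[i]).
Hypothesis hE : projection_valued_measure mu E.
Local Notation mR := (measurableTypeR R).
Local Notation L2 := (memLp 2 mu).
Local Notation N := (rnorm mu 2).
Local Notation step_op := (step_operator E).
Implicit Types (f g h k : T -> R[i]) (a : R[i]) (A B : @bset R) (s t : @step R).
Implicit Types (phi psi : mR -> R[i]).

Lemma step_op_cons c s f x : step_op (c :: s) f x = c.1 * E (sval c.2) f x + step_op s f x.
Proof. by rewrite /step_operator big_cons. Qed.

Lemma step_op_cat s t f x : step_op (s ++ t) f x = step_op s f x + step_op t f x.
Proof. by rewrite /step_operator big_cat. Qed.

Lemma step_opZ a s f x : step_op (stepZ a s) f x = a * step_op s f x.
Proof.
by rewrite /step_operator big_map mulr_sumr; apply: eq_bigr => c _; rewrite mulrA.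
Qed.

Lemma step_opB s t f x : step_op (s ++ stepZ (-1) t) f x = step_op s f x - step_op t f x.
Proof. by rewrite step_op_cat step_opZ mulN1r. Qed.

Lemma step_op_lin s a f g : L2 f -> L2 g ->
  ae_eqc mu (step_op s (fun x => a * f x + g x))
            (fun x => a * step_op s f x + step_op s g x).
Proof.
move=> mf mg; elim: s => [|c s IH].
  by apply: aeW => x; rewrite /step_operator !big_nil mulr0 addr0.
have h := E_lin hE c.2 a mf mg.
apply: filterS2 h IH => x h IH.
by rewrite !step_op_cons h IH; ring.
Qed.

Lemma E_step_op A t f : L2 f -> ae_eqc mu (E (sval A) (step_op t f))
  (fun x => \sum_(e <- t) e.1 * E (sval (bsetI A e.2)) f x).
Proof.
move=> mf; elim: t => [|e t IH].
  have m0 : L2 (fun=> 0) by exact: memLp_cst0.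
  have -> : step_op [::] f = (fun=> 0).
    by apply/funext => x; rewrite /step_operator big_nil.
  have := E_lin hE A (-1) m0 m0.
  rewrite (_ : (fun x => -1 * 0 + 0) = (fun=> 0)); last first.
    by apply/funext => x; rewrite mulr0 addr0.
  by apply: filterS => x ->; rewrite big_nil mulN1r addNr.
have -> : step_op (e :: t) f = (fun x => e.1 * E (sval e.2) f x + step_op t f x).
  by apply/funext => x; rewrite step_op_cons.
have h1 := E_lin hE A e.1 (E_mem hE e.2 mf) (step_op_mem hE t mf).
have h2 := E_I hE A e.2 mf.
apply: (filterS3 _ _ h1 h2 IH) => x -> h2' IH'.
by rewrite big_cons h2' IH'.
Qed.

Lemma step_op_comp s t f : L2 f ->
  ae_eqc mu (step_op s (step_op t f)) (step_op (stepM s t) f).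
Proof.
move=> mf; elim: s => [|c s IH].
  by apply: aeW => x; rewrite /step_operator /stepM !big_nil.
apply: filterS2 (E_step_op c.2 t mf) IH => x h IH.
have -> : stepM (c :: s) t = [seq (c.1 * e.1, bsetI c.2 e.2) | e <- t] ++ stepM s t by [].
rewrite step_op_cons step_op_cat h IH; congr (_ + _).
by rewrite /step_operator big_map mulr_sumr; apply: eq_bigr => e _; rewrite mulrA.
Qed.

Lemma smeas_mass f (mf : L2 f) : Num.sqrt (fine (smeas hE mf setT)) = N f.
Proof.
rewrite (smeasE hE mf (exist _ setT measurableT)) smassT//.
by rewrite sqrtr_sqr ger0_norm ?rnorm_ge0.
Qed.

(** The isometry bounds the norm by the supremum of the step function times
    the square root of the total mass of the spectral measure, which is the
    norm of [f]. *)
Lemma step_op_bound s f (B : R) : L2 f -> 0 <= B ->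
  (forall l, nc (step_fun s l) <= B) -> N (step_op s f) <= B * N f.
Proof.
move=> mf B0 hB; rewrite -(rnorm_step_op hE s mf).
have [_] := rnorm_sup (smeas hE mf) (cmeasurable_step s) B0 hB.
by rewrite smeas_mass.
Qed.

(** [ucalc phi f h]: the vector [h] is [phi] of the operator applied to [f],
    obtained from uniform approximations of [phi] by step functions. Since the
    same step function serves all vectors, this form, unlike the isometry that
    defines spectral integrals, shows at once that the calculus is linear in
    [f] and multiplicative in [phi]. *)
Definition ucalc phi f h := [/\ L2 f, L2 h &
  forall e : R, 0 < e -> exists s,
    (forall l, nc (phi l - step_fun s l) <= e) /\
    N (fun x => h x - step_op s f x) <= e].

Lemma ucalc_mem phi f h : ucalc phi f h -> L2 f /\ L2 h. Proof. by case. Qed.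

(** Any step function close to [phi] is close to the ones that define [h], and
    [step_op_bound] makes their operators close. *)
Lemma ucalc_near phi f h s (e : R) : ucalc phi f h -> 0 <= e ->
  (forall l, nc (phi l - step_fun s l) <= e) ->
  N (fun x => h x - step_op s f x) <= e * N f.
Proof.
move=> [mf mh hc] e0 hs.
apply/ler_addgt0Pr => r r0; pose r' := r / (1 + N f).
have N1 : 0 < 1 + N f by rewrite ltr_pwDl// rnorm_ge0.
have r'0 : 0 < r' by rewrite divr_gt0.
have [t [ht1 ht2]] := hc _ r'0.
have h1 := rnorm_triangle (p := 2) (two_ge1 R) mh (step_op_mem hE t mf) (step_op_mem hE s mf).
apply: le_trans h1 _.
have h2 : N (fun x => step_op t f x - step_op s f x) <= (r' + e) * N f.
  rewrite (_ : (fun x => _) = step_op (t ++ stepZ (-1) s) f); last first.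
    by apply/funext => x; rewrite step_opB.
  apply: step_op_bound => //; first by rewrite addr_ge0// ltW.
  move=> l; rewrite step_funB.
  rewrite (_ : _ - _ = - (phi l - step_fun t l) + (phi l - step_fun s l)); last by ring.
  by apply: le_trans (normcD _ _) _; rewrite normcN' lerD.
apply: le_trans (lerD ht2 h2) _.
have -> : r = r' * (1 + N f) by rewrite /r' divfK// gt_eqF.
by rewrite le_eqVlt; apply/orP; left; apply/eqP; ring.
Qed.

Lemma ucalc_lin a phi psi f h k : ucalc phi f h -> ucalc psi f k ->
  ucalc (fun l => a * phi l + psi l) f (fun x => a * h x + k x).
Proof.
move=> [mf mh hh] [_ mk hk]; split => //; first exact: memLp_lin.
move=> e e0; pose e' := e / (nc a + 1).
have a1 : 0 < nc a + 1 by rewrite ltr_wpDl// normc_ge0.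
have e'0 : 0 < e' by rewrite divr_gt0.
have [s [s1 s2]] := hh _ e'0; have [t [t1 t2]] := hk _ e'0.
have ee : nc a * e' + e' = e by rewrite -[X in _ + X]mul1r -mulrDl /e' mulrC divfK// gt_eqF.
exists (stepZ a s ++ t); split => [l|].
  rewrite step_funD step_funZ opprD addrACA -mulrBr -ee.
  apply: le_trans (normcD _ _) _; apply: lerD => //.
  by rewrite Normc.normcM ler_wpM2l// normc_ge0.
rewrite (_ : (fun x => _) = (fun x => a * (h x - step_op s f x) + (k x - step_op t f x))).
  have ms := memLpB (two_ge1 R) mh (step_op_mem hE s mf).
  have mt := memLpB (two_ge1 R) mk (step_op_mem hE t mf).
  apply: le_trans (rnormD (two_ge1 R) (memLpZ a (two_ge1 R) ms) mt) _.
  by rewrite rnormZ// -ee lerD// ler_wpM2l// normc_ge0.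
by apply/funext => x; rewrite step_op_cat step_opZ; ring.
Qed.

Lemma ucalc_lin_vec a phi f g h k : ucalc phi f h -> ucalc phi g k ->
  ucalc phi (fun x => a * f x + g x) (fun x => a * h x + k x).
Proof.
move=> ch ck; have [mf mh hh] := ch; have [mg mk hk] := ck.
split; [exact: memLp_lin|exact: memLp_lin|].
move=> e e0; pose e' := e / (nc a * N f + N g + 1).
have a1 : 0 < nc a * N f + N g + 1.
  by rewrite ltr_wpDl// addr_ge0 ?mulr_ge0 ?normc_ge0 ?rnorm_ge0.
pose e'' := Num.min e e'.
have e'0 : 0 < e'' by rewrite /e'' lt_min e0 divr_gt0.
have [s [s1 s2]] := hh _ e'0.
exists s; split => [l|]; first by apply: le_trans (s1 l) _; rewrite /e'' ge_min lexx.
have h1 := ucalc_near ch (ltW e'0) s1; have h2 := ucalc_near ck (ltW e'0) s1.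
have mhs := memLpB (two_ge1 R) mh (step_op_mem hE s mf).
have mks := memLpB (two_ge1 R) mk (step_op_mem hE s mg).
have msl := step_op_mem hE s (memLp_lin a (two_ge1 R) mf mg).
have mfg := memLp_lin a (two_ge1 R) mh mk.
rewrite (@ae_eq_rnorm _ _ _ _ _ _
  (fun x => a * (h x - step_op s f x) + (k x - step_op s g x))) //.
- apply: le_trans (rnormD (two_ge1 R) (memLpZ a (two_ge1 R) mhs) mks) _.
  rewrite rnormZ//; apply: (@le_trans _ _ (e' * (nc a * N f + N g + 1))); last first.
    by rewrite /e' divfK// gt_eqF.
  have e''e' : e'' <= e' by rewrite /e'' ge_min lexx orbT.
  apply: (@le_trans _ _ (e'' * (nc a * N f + N g + 1))); last by rewrite ler_wpM2r// ltW.
  have := ler_wpM2l (normc_ge0 a) h1; move: h2; lra.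
- by apply: cmeasurableB; [exact: mfg.1|exact: msl.1].
- by apply: cmeasurable_lin; [exact: mhs.1|exact: mks.1].
- by apply: filterS (step_op_lin s a mf mg) => x ->; ring.
Qed.

(** The isometry of [rnorm_step_op] passes to uniform limits. *)
Lemma ucalc_norm phi f h (mf : L2 f) : cmeasurable phi -> ucalc phi f h -> forall s,
  memLp 2 (smeas hE mf) (fun l => phi l - step_fun s l) /\
  N (fun x => h x - step_op s f x) = rnorm (smeas hE mf) 2 (fun l => phi l - step_fun s l).
Proof.
move=> mphi hc s; have [_ mh hh] := hc.
have mem : memLp 2 (smeas hE mf) phi.
  have [t [t1 _]] := hh _ ltr01.
  have [h1 _] := rnorm_sup (smeas hE mf) (cmeasurableB mphi (cmeasurable_step t)) ler01 t1.
  have [h2 _] := rnorm_step_sqr (smeas hE mf) t.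
  have := memLpD (two_ge1 R) h1 h2.
  by rewrite (_ : (fun x => _) = phi)//; apply/funext => l; rewrite subrK.
have [ms _] := rnorm_step_sqr (smeas hE mf) s.
split; first exact: memLpB.
apply/eqP; rewrite -subr_eq0 -normr_le0; apply/ler_addgt0Pr => r r0; rewrite add0r.
pose r' := r / (N f + N f + 1).
have N1 : 0 < N f + N f + 1 by rewrite ltr_wpDl// addr_ge0// rnorm_ge0.
have r'0 : 0 < r' by rewrite divr_gt0.
have [t [t1 _]] := hh _ r'0.
have t2 := ucalc_near hc (ltW r'0) t1.
have [mt _] := rnorm_step_sqr (smeas hE mf) t.
have mts := step_op_mem hE t mf; have mss := step_op_mem hE s mf.
have d1 : `|N (fun x => h x - step_op s f x) - N (fun x => step_op t f x - step_op s f x)|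
    <= r' * N f.
  apply: le_trans t2.
  apply: le_trans (rnorm_dist_norm (two_ge1 R) (memLpB (two_ge1 R) mh mss) (memLpB (two_ge1 R) mts mss)) _.
  rewrite (@eq_rnorm _ _ _ _ _ _ (fun x => h x - step_op t f x))// => x; ring.
have d2 : `|rnorm (smeas hE mf) 2 (fun l => phi l - step_fun s l) -
     rnorm (smeas hE mf) 2 (fun l => step_fun t l - step_fun s l)| <= r' * N f.
  apply: le_trans (rnorm_dist_norm (two_ge1 R) (memLpB (two_ge1 R) mem ms) (memLpB (two_ge1 R) mt ms)) _.
  rewrite (@eq_rnorm _ _ _ _ _ _ (fun l => phi l - step_fun t l)) => [|x]; last by ring.
  have [_] := rnorm_sup (smeas hE mf) (cmeasurableB mphi (cmeasurable_step t)) (ltW r'0) t1.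
  by rewrite smeas_mass.
have d3 : N (fun x => step_op t f x - step_op s f x) =
    rnorm (smeas hE mf) 2 (fun l => step_fun t l - step_fun s l).
  rewrite (@eq_rnorm _ _ _ _ _ _ (step_op (t ++ stepZ (-1) s) f)) => [|x]; last by rewrite step_opB.
  rewrite -(rnorm_step_op hE _ mf); apply: eq_rnorm => l; exact: step_funB.
rewrite -d3 in d2.
have -> : r = r' * (N f + N f + 1) by rewrite /r' divfK// gt_eqF.
move: d1 d2; rewrite !ler_norml => /andP[? ?] /andP[? ?]; apply/andP; split; lra.
Qed.

Lemma ucalc_spectral_integral phi f h : cmeasurable phi -> ucalc phi f h ->
  spectral_integral mu E phi f h.
Proof.
move=> mphi hc; have [mf mh _] := hc; split => // m a A mA.
pose s : @step R := [seq (a i, exist _ (A i) (mA i)) | i <- enum 'I_m].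
have -> : (fun x => h x - \sum_(i < m) a i * E (A i) f x) =
    (fun x => h x - step_op s f x).
  by apply/funext => x; rewrite /step_operator /s big_map big_enum.
have [ms] := ucalc_norm mf mphi hc s.
have mhs := memLpB (two_ge1 R) mh (step_op_mem hE s mf).
rewrite rnormE// => ->; rewrite poweR_EFin -rnorm_powR//.
apply: eq_integral => l _; rewrite powR_mulrn ?normc_ge0//.
by rewrite /step_fun /s big_map big_enum.
Qed.

Lemma ucalc_rnorm phi f h (mf : L2 f) : cmeasurable phi -> ucalc phi f h ->
  memLp 2 (smeas hE mf) phi /\ N h = rnorm (smeas hE mf) 2 phi.
Proof.
move=> mphi hc; have := ucalc_norm mf mphi hc [::].
have -> : (fun l => phi l - step_fun [::] l) = phi.
  by apply/funext => l; rewrite /step_fun big_nil subr0.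
by rewrite (_ : (fun x => h x - _) = h)//; apply/funext => x;
  rewrite /step_operator big_nil subr0.
Qed.

Lemma ucalc_bound phi f h (B : R) : cmeasurable phi -> 0 <= B ->
  (forall l, nc (phi l) <= B) -> ucalc phi f h -> N h <= B * N f.
Proof.
move=> mphi B0 hB hc; have [mf mh _] := hc.
have [_ ->] := ucalc_rnorm mf mphi hc.
have [_] := rnorm_sup (smeas hE mf) mphi B0 hB.
by rewrite smeas_mass.
Qed.

Lemma step_fun_bounded s : exists B : R, forall l, nc (step_fun s l) <= B.
Proof.
exists (\sum_(c <- s) nc c.1) => l; rewrite /step_fun.
elim: s => [|c t IH]; first by rewrite !big_nil Normc.normc0.
rewrite !big_cons; apply: le_trans (normcD _ _) _; apply: lerD => //.
by rewrite Normc.normcM ler_piMr ?normc_ge0// normc_real ger0_norm// indicE;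
  case: (_ \in _).
Qed.

Lemma ucalc_step s f : L2 f -> ucalc (step_fun s) f (step_op s f).
Proof.
move=> mf; split => //; first exact: step_op_mem.
move=> e e0; exists s; split => [l|]; first by rewrite subrr Normc.normc0 ltW.
rewrite (_ : (fun x => _) = fun=> 0); first by rewrite /rnorm cnorm0//= ltW.
by apply/funext => x; rewrite subrr.
Qed.

Lemma ucalc_uniq phi f f' h k : cmeasurable phi -> ucalc phi f h -> ucalc phi f' k ->
  ae_eqc mu f f' -> ae_eqc mu h k.
Proof.
move=> mphi hh hk ff'.
have [mf mh] := ucalc_mem hh; have [mf' mk] := ucalc_mem hk.
have hc := ucalc_lin_vec (-1) hk hh.
have z : N (fun x => -1 * f' x + f x) = 0.
  rewrite -[RHS](_ : N (fun=> 0) = 0); last by rewrite /rnorm cnorm0.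
  apply: ae_eq_rnorm => //.
  - by apply: cmeasurable_lin; [exact: mf'.1|exact: mf.1].
  - exact: cmeasurable_cst.
  - by apply: filterS ff' => x ->; rewrite mulN1r addNr.
apply: (rnormB_eq0 (two_ge1 R) mh mk).
have [mfz mhz hz] := hc.
apply/ler_addgt0Pr => r r0; rewrite add0r.
have [t [t1 t2]] := hz _ r0.
have := ucalc_near hc (ltW r0) t1; rewrite z mulr0 => t3.
have [_ hN] := ucalc_norm mfz mphi hc [::].
have ht : N (step_op t (fun x => -1 * f' x + f x)) <= 0.
  rewrite -(rnorm_step_op hE t mfz).
  have [B hB] := step_fun_bounded t.
  have B0 : 0 <= B by apply: le_trans (hB point); exact: normc_ge0.
  have [_] := rnorm_sup (smeas hE mfz) (cmeasurable_step t) B0 hB.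
  by rewrite smeas_mass z mulr0.
rewrite (@eq_rnorm _ _ _ _ _ _ (fun x => -1 * k x + h x)) => [|x]; last by ring.
apply: le_trans (le_rnorm_dist (two_ge1 R) mhz (step_op_mem hE t mfz)) _.
by apply: le_trans (lerD t3 ht) _; rewrite addr0 ltW.
Qed.

Lemma ucalc_ae phi f h k : ucalc phi f h -> ae_eqc mu h k -> cmeasurable k ->
  ucalc phi f k.
Proof.
move=> [mf mh hh] hk mk; have mk' := ae_memLp (ltr0n _ 2) mk hk mh.
split => // e e0; have [s [s1 s2]] := hh _ e0; exists s; split => //.
have ms := step_op_mem hE s mf.
rewrite (@ae_eq_rnorm _ _ _ _ _ _ (fun x => h x - step_op s f x))//.
- by apply: cmeasurableB => //; exact: ms.1.
- by apply: cmeasurableB; [exact: mh.1|exact: ms.1].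
- by apply: filterS hk => x ->.
Qed.

Lemma ucalc_exists phi f (B : R) : cmeasurable phi -> (forall l, nc (phi l) <= B) ->
  L2 f -> exists h, ucalc phi f h.
Proof.
move=> mphi hB mf.
have inv0 n : 0 < (n.+1%:R : R)^-1 by rewrite invr_gt0.
have := fun n => step_approx mphi hB (inv0 n) => /choice[s hs].
have msn n := step_op_mem hE (s n) mf.
have near0 (e : R) : 0 < e -> exists K, forall n, (K <= n)%N -> n.+1%:R^-1 <= e.
  move=> e0; exists (Num.truncn e^-1) => n Kn.
  rewrite -[leRHS]invrK lef_pV2 ?posrE ?invr_gt0//.
  apply: ltW; apply: lt_le_trans (truncnS_gt _) _; by rewrite ler_nat.
have [|h mh hh] := @Lp_complete _ _ _ mu 2 (fun n => step_op (s n) f) (two_ge1 R) msn.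
  move=> e e0; pose e' := e / (N f + N f + 1).
  have N1 : 0 < N f + N f + 1 by rewrite ltr_wpDl// addr_ge0// rnorm_ge0.
  have e'0 : 0 < e' by rewrite divr_gt0.
  have [K hK] := near0 _ e'0; exists K => i j Ki Kj.
  rewrite rnormE; last exact: memLpB.
  rewrite lee_fin (@eq_rnorm _ _ _ _ _ _ (step_op (s i ++ stepZ (-1) (s j)) f)) => [|x]; last by rewrite step_opB.
  apply: le_trans (step_op_bound mf (_ : 0 <= e' + e') _) _.
  - by rewrite addr_ge0// ltW.
  - move=> l; rewrite step_funB.
    rewrite (_ : _ - _ = - (phi l - step_fun (s i) l) + (phi l - step_fun (s j) l)); last by ring.
    apply: le_trans (normcD _ _) _; rewrite normcN'.
    by apply: lerD; [apply: le_trans (hs i l) (hK _ Ki)|apply: le_trans (hs j l) (hK _ Kj)].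
  have -> : e = e' * (N f + N f + 1) by rewrite /e' divfK// gt_eqF.
  rewrite mulrDl !mulrDr; lra.
exists h; split => // e e0.
have [K1 hK1] := hh _ e0; have [K2 hK2] := near0 _ e0.
exists (s (maxn K1 K2)); split => [l|].
  by apply: le_trans (hs _ l) _; apply: hK2; rewrite leq_maxr.
have := hK1 _ (leq_maxl K1 K2); rewrite rnormE; last exact: memLpB.
by rewrite lee_fin rnorm_distC.
Qed.

(** Products of step functions correspond to composition of operators, since
    [E A] composed with [E B] is [E (A `&` B)]. *)
Lemma ucalc_mul phi psi f h k (B C : R) : 0 <= B -> 0 <= C ->
  (forall l, nc (phi l) <= B) -> (forall l, nc (psi l) <= C) ->
  ucalc phi f h -> ucalc psi h k -> ucalc (fun l => psi l * phi l) f k.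
Proof.
move=> B0 C0 hB hC ch ck; have [mf mh hh] := ch; have [_ mk hk] := ck.
split => // e e0; pose e' := Num.min 1 (e / (B + C + 1 + 1)).
have D0 : 0 < B + C + 1 + 1 by rewrite ltr_wpDl// !addr_ge0.
have e'0 : 0 < e' by rewrite /e' lt_min ltr01 divr_gt0.
have e'1 : e' <= 1 by rewrite /e' ge_min lexx.
have e'e : e' * (B + C + 1 + 1) <= e.
  by rewrite -ler_pdivlMr// /e' ge_min lexx orbT.
have [s [s1 s2]] := hk _ e'0; have [t [t1 t2]] := hh _ e'0.
have sB l : nc (step_fun s l) <= C + 1.
  rewrite (_ : step_fun s l = psi l - (psi l - step_fun s l)); last by ring.
  by apply: le_trans (normcB _ _) _; rewrite lerD// (le_trans (s1 l)).
exists (stepM s t); split => [l|].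
  rewrite step_funM (_ : _ - _ = (psi l - step_fun s l) * phi l +
    step_fun s l * (phi l - step_fun t l)); last by ring.
  apply: le_trans (normcD _ _) _; rewrite !Normc.normcM.
  apply: (@le_trans _ _ (e' * B + (C + 1) * e')).
    by apply: lerD; apply: ler_pM; rewrite ?normc_ge0.
  by apply: le_trans e'e; rewrite !mulrDr; lra.
have ms := step_op_mem hE s mh; have mt := step_op_mem hE t mf.
have mst := step_op_mem hE s mt; have mM := step_op_mem hE (stepM s t) mf.
apply: le_trans (rnorm_triangle (two_ge1 R) mk ms mM) _.
have -> : N (fun x => step_op s h x - step_op (stepM s t) f x) =
    N (step_op s (fun x => -1 * step_op t f x + h x)).
  apply: ae_eq_rnorm => //.
  - by apply: cmeasurableB; [exact: ms.1|exact: mM.1].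
  - by apply: (step_op_mem hE s (memLp_lin (-1) (two_ge1 R) mt mh)).1.
  have h1 := step_op_comp s t mf; have h2 := step_op_lin s (-1) mt mh.
  by apply: filterS2 h1 h2 => x -> ->; ring.
have h3 : N (step_op s (fun x => -1 * step_op t f x + h x)) <= (C + 1) * e'.
  apply: le_trans (step_op_bound (memLp_lin (-1) (two_ge1 R) mt mh) (addr_ge0 C0 ler01) sB) _.
  rewrite ler_wpM2l ?addr_ge0//.
  by rewrite (@eq_rnorm _ _ _ _ _ _ (fun x => h x - step_op t f x))// => x; ring.
apply: le_trans (lerD s2 h3) _; apply: le_trans e'e.
have : 0 <= e' * B by rewrite mulr_ge0// ltW.
rewrite !mulrDr; lra.
Qed.

(** By the isometry the square of the distance is an integral in the scalar
    spectral measure of [f], a finite measure, where dominated convergence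
    applies. *)
Lemma ucalc_cvg (phi_ : nat -> mR -> R[i]) phi f (h_ : nat -> T -> R[i]) h (B : R) :
  (forall n, cmeasurable (phi_ n)) -> cmeasurable phi ->
  (forall n l, nc (phi_ n l) <= B) ->
  (forall l, ccvg (phi_ ^~ l) (phi l)) ->
  (forall n, ucalc (phi_ n) f (h_ n)) -> ucalc phi f h -> cvg_norm mu 2 h_ h.
Proof.
move=> mphi_ mphi hB hcvg h1 h2.
have [mf mh] := ucalc_mem h2; have mh_ n := (ucalc_mem (h1 n)).2.
have hd n := ucalc_lin (-1) h2 (h1 n).
have md n : cmeasurable (fun l => -1 * phi l + phi_ n l) by exact: cmeasurable_lin.
have hB' l : nc (phi l) <= B.
  have hl := ccvg_normc (hcvg l).
  rewrite -(cvg_lim _ hl)//; apply: limr_le; first by apply/cvg_ex; exists (nc (phi l)).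
  by apply: nearW => n; exact: hB.
have B0 : 0 <= B by apply: le_trans (hB' point); exact: normc_ge0.
pose nu := smeas hE mf.
have E1 n : N (fun x => h_ n x - h x) ^+ 2 = (\int[nu]_l nc (-1 * phi l + phi_ n l)%R ^+ 2)%R.
  rewrite (@eq_rnorm _ _ _ _ _ _ (fun x => -1 * h x + h_ n x)) => [|x]; last by ring.
  have [m ->] := ucalc_rnorm mf (md n) (hd n).
  by rewrite rnorm_sqr.
have m2 n : measurable_fun setT (fun l : mR => (nc (-1 * phi l + phi_ n l) ^+ 2)%:E).
  by apply/measurable_EFinP/measurable_funX/measurable_normc.
have icst : nu.-integrable setT (EFin \o cst ((B + B) ^+ 2)).
  exact: finite_measure_integrable_cst.
have c0 l : (nc (-1 * phi l + phi_ n l) ^+ 2)%:E @[n --> \oo] --> 0%E.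
  have c1 : nc (-1 * phi l + phi_ n l) @[n --> \oo] --> (0 : R).
    have := ccvg_normc (ccvg_lin 1 (hcvg l) (ccvg_cst (-1 * phi l))).
    rewrite mul1r mulN1r subrr Normc.normc0; apply: cvg_trans.
    by apply: near_eq_cvg; apply: nearW => n; rewrite mul1r addrC.
  have c2 : nc (-1 * phi l + phi_ n l) ^+ 2 @[n --> \oo] --> (0 : R).
    rewrite -[X in _ --> X](mulr0 (0 : R)); under eq_cvg do rewrite expr2.
    exact: cvgM.
  by apply: cvg_EFin; [exact: nearW|exact: c2].
have dom n l : (`|(nc (-1 * phi l + phi_ n l) ^+ 2)%:E| <= (EFin \o cst ((B + B) ^+ 2)%R) l)%E.
  rewrite /comp /cst gee0_abs ?lee_fin ?sqr_ge0// ler_sqr ?nnegrE ?normc_ge0 ?addr_ge0//.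
  apply: le_trans (normcD (-1 * phi l) (phi_ n l)) _.
  by rewrite mulN1r normcN' lerD.
have [_ _] := dominated_convergence measurableT m2 (measurable_cst 0%E)
  (aeW _ (fun l _ => c0 l)) icst (aeW _ (fun l n _ => dom n l)).
rewrite integral0 => /fine_cvg hlim.
move=> e e0.
have e20 : 0 < e ^+ 2 by rewrite exprn_gt0.
have /cvgr0Pnorm_lt /(_ _ e20)[K _ hK] := hlim.
exists K => n Kn; rewrite rnormE; last exact: memLpB.
rewrite lee_fin -ler_sqr ?nnegrE ?rnorm_ge0 ?(ltW e0)// E1.
by apply: le_trans (ler_norm _) _; apply: ltW; exact: hK.
Qed.

End calculus.

(** * Approximation by nondecreasing polynomials *)

Section bernstein.
Context {R : realType}.
Implicit Types (c : nat -> R) (psi : R -> R) (n : nat) (x : R).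

(** Bernstein polynomials, by de Casteljau's recursion: this form makes their
    derivative, positivity and second moment immediate inductions. *)
Fixpoint bern n c : {poly R} :=
  if n is m.+1 then (1 - 'X) * bern m c + 'X * bern m (fun k => c k.+1) else (c 0%N)%:P.

Lemma eq_bern n c c' : c =1 c' -> bern n c = bern n c'.
Proof. by move=> /funext ->. Qed.

Lemma bernS_horner n c x :
  (bern n.+1 c).[x] = (1 - x) * (bern n c).[x] + x * (bern n (fun k => c k.+1)).[x].
Proof. by rewrite /= !hornerE. Qed.

Lemma bern_le n c c' x : 0 <= x <= 1 -> (forall k, (k <= n)%N -> c k <= c' k) ->
  (bern n c).[x] <= (bern n c').[x].
Proof.
move=> /andP[x0 x1]; elim: n c c' => [|n IH] c c' h.
  by rewrite /= !hornerC h.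
rewrite !bernS_horner lerD// ler_wpM2l ?subr_ge0//; apply: IH => k kn.
  by apply: h; rewrite ltnW.
exact: h.
Qed.

Lemma bern_deriv n c :
  (bern n.+1 c)^`() = n.+1%:R *: bern n (fun k => c k.+1 - c k).
Proof.
have lin m : forall c1 c2, bern m (fun k => c1 k - c2 k) = bern m c1 - bern m c2.
  by elim: m => [|m IH] c1 c2 /=; [rewrite polyCB|rewrite !IH; ring].
have d1 : (1 - 'X : {poly R})^`() = -1.
  by rewrite derivB derivX -polyC1 derivC sub0r.
elim: n c => [|n IH] c.
  by rewrite /= derivD !derivM d1 !derivC derivX scale1r polyCB; ring.
rewrite (_ : bern n.+2 c = (1 - 'X) * bern n.+1 c + 'X * bern n.+1 (fun k => c k.+1))//.
rewrite derivD !derivM d1 derivX !IH.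
have e1 : bern n.+1 (fun k => c k.+1 - c k) =
    (1 - 'X) * bern n (fun k => c k.+1 - c k) +
    'X * bern n (fun k => c k.+2 - c k.+1) by [].
have e2 : bern n.+1 (fun k => c k.+1 - c k) =
  bern n.+1 (fun k => c k.+1) - bern n.+1 c by rewrite lin.
rewrite -[in RHS](@natr1 _ n.+1) scalerDl scale1r {2}e2 e1 -!mul_polyC.
move: (bern n.+1 _) (bern n.+1 _) (bern n _) (bern n _) => b0 b1 D1 D2; ring.
Qed.

(** The second moment of the binomial law: the last term is its variance. *)
Lemma bern_affine_sqr n (a b t x : R) :
  (bern n (fun k => a + b * (k%:R + t) ^+ 2)).[x] =
  a + b * ((n%:R * x + t) ^+ 2 + n%:R * (x * (1 - x))).
Proof.
elim: n t => [|n IH] t; first by rewrite /= hornerC mul0r mul0r add0r addr0.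
rewrite bernS_horner IH.
rewrite (eq_bern _ (c' := fun k => a + b * (k%:R + (1 + t)) ^+ 2)) => [|k].
  rewrite IH -natr1; ring.
by rewrite -natr1 addrA.
Qed.

(** Bernstein's argument. The deviation [L |y - x|] is at most a quadratic
    polynomial in [y], by the inequality between arithmetic and geometric
    means, and [bern_affine_sqr] gives the mean of that polynomial. *)
Lemma bern_approx psi (L e : R) : 0 <= L -> 0 < e ->
  (forall x y, `|psi x - psi y| <= L * `|x - y|) ->
  exists n, forall x, 0 <= x <= 1 ->
    `|(bern n.+1 (fun k => psi (k%:R / n.+1%:R))).[x] - psi x| <= e.
Proof.
move=> L0 e0 hL; pose D : R := e / (L + 1).
have L1 : 0 < L + 1 by rewrite ltr_wpDl.
have D0 : 0 < D by rewrite divr_gt0.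
(* The degree makes the variance term, of order 1 / (D n), at most [D / 2]. *)
exists (Num.truncn (D^-1 ^+ 2)) => x x01; set n := Num.truncn _.
have hn : D^-1 ^+ 2 < n.+1%:R by rewrite /n truncnS_gt.
have n0 : 0 < n.+1%:R :> R by rewrite ltr0n.
have DE : D * (L + 1) = e by rewrite /D divfK// gt_eqF.
have x2 : 0 <= x * (1 - x) <= 1 by move: x01 => /andP[? ?]; apply/andP; split; nra.
have key k : `|psi (k%:R / n.+1%:R) - psi x| <=
    L * (D / 2) + L / (2 * D * n.+1%:R ^+ 2) * (k%:R + - (n.+1%:R * x)) ^+ 2.
  apply: le_trans (hL _ _) _.
  have -> : L / (2 * D * n.+1%:R ^+ 2) * (k%:R + - (n.+1%:R * x)) ^+ 2 =
      L * ((k%:R / n.+1%:R - x) ^+ 2 / (2 * D)).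
    by field; rewrite !gt_eqF.
  rewrite -mulrDr ler_wpM2l//.
  set y := k%:R / n.+1%:R - x; rewrite -(real_normK (num_real y)); set z := `|y|.
  (* This is [z <= D / 2 + z^2 / (2 D)]. *)
  rewrite -subr_ge0 (_ : _ - _ = (z - D) ^+ 2 / (2 * D)); last first.
    by field; rewrite gt_eqF.
  by rewrite divr_ge0 ?sqr_ge0// mulr_ge0// ltW.
pose q := L * (D / 2) + L / (2 * D * n.+1%:R ^+ 2) * (n.+1%:R * (x * (1 - x))).
have qe : q <= e.
  have -> : q = L * (D / 2 + (x * (1 - x)) / (2 * D * n.+1%:R)).
    by rewrite /q; field; rewrite !gt_eqF.
  have h2 : (x * (1 - x)) / (2 * D * n.+1%:R) <= D / 2.
    have den0 : 0 < 2 * D * n.+1%:R by apply: mulr_gt0 => //; apply: mulr_gt0.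
    rewrite (ler_pdivrMr _ _ den0).
    have -> : D / 2 * (2 * D * n.+1%:R) = D ^+ 2 * n.+1%:R by field.
    have : 1 <= D ^+ 2 * n.+1%:R.
      by rewrite mulrC -ler_pdivrMr ?exprn_gt0// mul1r -exprVn ltW.
    by move: x2 => /andP[? ?]; lra.
  rewrite -DE mulrDr; apply: le_trans (lerD (lexx _) (ler_wpM2l L0 h2)) _.
  by rewrite -mulrDr -splitr mulrDr mulr1 mulrC lerDl ltW.
have up : (bern n.+1 (fun k => psi (k%:R / n.+1%:R))).[x] <= psi x + q.
  apply: le_trans (bern_le x01 (c' := fun k => (psi x + L * (D / 2)) +
    L / (2 * D * n.+1%:R ^+ 2) * (k%:R + - (n.+1%:R * x)) ^+ 2) _) _.
    by move=> k _; have := key k; rewrite ler_norml lerBlDl addrA => /andP[_].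
  by rewrite bern_affine_sqr subrr expr0n/= add0r /q addrA.
have lo : psi x - q <= (bern n.+1 (fun k => psi (k%:R / n.+1%:R))).[x].
  apply: le_trans (bern_le x01 (c := fun k => (psi x - L * (D / 2)) +
    (- (L / (2 * D * n.+1%:R ^+ 2))) * (k%:R + - (n.+1%:R * x)) ^+ 2) _).
    by rewrite bern_affine_sqr subrr expr0n/= add0r /q opprD addrA mulNr.
  by move=> k _; have := key k; rewrite ler_norml lerBrDl opprD addrA mulNr => /andP[+ _].
by rewrite ler_norml; apply/andP; split; lra.
Qed.

Lemma bern_deriv_ge0 n c x : 0 <= x <= 1 -> (forall k, c k <= c k.+1) ->
  0 <= (bern n.+1 c)^`().[x].
Proof.
move=> x01 hc; rewrite bern_deriv hornerZ mulr_ge0//.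
have <- : (bern n (fun k => 0 + 0 * (k%:R + 0) ^+ 2)).[x] = 0.
  by rewrite bern_affine_sqr mul0r addr0.
by apply: bern_le => // k _; rewrite mul0r addr0 subr_ge0.
Qed.

Lemma bernoulli_inv n (t : R) : 0 <= t <= 1 -> (1 - t) ^+ n * (1 + n%:R * t) <= 1.
Proof.
move=> /andP[t0 t1]; elim: n => [|n IH]; first by rewrite expr0 mul0r addr0 mulr1.
apply: le_trans IH; rewrite exprSr -mulrA ler_wpM2l ?exprn_ge0 ?subr_ge0//.
rewrite -natr1 -subr_ge0 (_ : _ - _ = (n%:R + 1) * t ^+ 2); last by ring.
by rewrite mulr_ge0 ?sqr_ge0 ?addr_ge0.
Qed.

(** The odd polynomials [s (1 - (1 - s^2 / B^2)^n)] have no linear term, are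
    nondecreasing on [[- B, B]], and approach the identity there. *)
Definition flat_id (B : R) n : {poly R} :=
  'X * (1 - (1 - (B ^- 2) *: 'X ^+ 2) ^+ n).

Lemma flat_id_horner B n x :
  (flat_id B n).[x] = x * (1 - (1 - x ^+ 2 / B ^+ 2) ^+ n).
Proof.
by rewrite /flat_id hornerM hornerX hornerD hornerN horner_exp hornerD hornerN hornerZ hornerXn -polyC1 !hornerC [_^-1 * _]mulrC.
Qed.

Lemma flat_id_deriv B n x : (flat_id B n)^`().[x] =
  1 - (1 - x ^+ 2 / B ^+ 2) ^+ n +
  n%:R * (1 - x ^+ 2 / B ^+ 2) ^+ n.-1 * (2 * x ^+ 2 / B ^+ 2).
Proof.
pose p : {poly R} := 1 - (B ^- 2) *: 'X ^+ 2.
have px : p.[x] = 1 - x ^+ 2 / B ^+ 2.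
  by rewrite hornerD hornerN hornerZ hornerXn -polyC1 hornerC [_^-1 * _]mulrC.
have dp : p^`() = - ((B ^- 2) *: ('X *+ 2)).
  by rewrite derivB -polyC1 derivC sub0r derivZ derivXn expr1.
rewrite /flat_id -/p derivM derivX mul1r derivB -polyC1 derivC sub0r deriv_exp dp.
rewrite hornerD hornerM hornerX hornerN hornerMn hornerM hornerN hornerZ hornerMn.
rewrite hornerD hornerN hornerC !horner_exp px hornerX.
by rewrite -[_ *+ n]mulr_natl -[x *+ 2]mulr_natl; ring.
Qed.

Lemma flat_id_approx (B e : R) : 0 < B -> 0 < e -> exists n,
  forall x, `|x| <= B -> [/\ `|(flat_id B n).[x]| <= B,
    0 <= (flat_id B n)^`().[x] & `|(flat_id B n).[x] - x| <= e].
Proof.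
move=> B0 e0; pose t0 := e ^+ 2 / B ^+ 2.
have t00 : 0 < t0 by rewrite divr_gt0 ?exprn_gt0.
(* For [|x| > e] the factor [(1 - x^2 / B^2)^n] is at most [1 / (1 + n t0)],
   hence at most [e / B]. *)
exists (Num.truncn (B / e / t0)).+1 => x xB; set n := (Num.truncn _).+1.
have hn : B / e / t0 < n%:R by rewrite /n truncnS_gt.
pose t := x ^+ 2 / B ^+ 2.
have t01 : 0 <= t <= 1.
  rewrite divr_ge0 ?sqr_ge0//= ler_pdivrMr ?exprn_gt0// mul1r.
  by rewrite -(real_normK (num_real x)) ler_sqr ?nnegrE ?normr_ge0// ltW.
have /andP[t0' t1'] := t01.
have u01 : 0 <= 1 - t <= 1 by apply/andP; split; lra.
have un m : 0 <= (1 - t) ^+ m <= 1.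
  by rewrite exprn_ge0 ?exprn_ile1//; case/andP: u01.
have /andP[un0 un1] := un n; have /andP[um0 um1] := un n.-1.
split.
- rewrite flat_id_horner -/t normrM; apply: le_trans xB; rewrite ler_piMr//.
  by rewrite ger0_norm ?subr_ge0//; lra.
- rewrite flat_id_deriv -/t addr_ge0 ?subr_ge0// mulr_ge0//; first exact: mulr_ge0.
  by rewrite -mulrA mulr_ge0.
rewrite flat_id_horner -/t (_ : _ - _ = - (x * (1 - t) ^+ n)); last by ring.
rewrite normrN normrM (ger0_norm un0).
have [xe|xe] := leP `|x| e; first by apply: le_trans xe; rewrite ler_piMr.
have h := bernoulli_inv n t01.
have tt0 : t0 <= t.
  rewrite /t /t0 ler_pM2r ?invr_gt0 ?exprn_gt0//.
  by rewrite -(real_normK (num_real x)) ler_sqr ?nnegrE ?normr_ge0// ltW.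
have h2 : B / e <= 1 + n%:R * t.
  have : B / e <= n%:R * t0 by rewrite -ler_pdivrMr// ltW.
  have : n%:R * t0 <= n%:R * t by rewrite ler_wpM2l.
  lra.
apply: (@le_trans _ _ (B * (1 - t) ^+ n)); first by rewrite ler_wpM2r.
have h3 : (1 - t) ^+ n * (B / e) <= 1 by apply: le_trans h; rewrite ler_wpM2l.
by move: h3; rewrite mulrA ler_pdivrMr// mul1r mulrC.
Qed.

(** Bernstein polynomials of a nondecreasing function are nondecreasing.
    Composition with [flat_id] preserves this and makes them vanish to second
    order at the origin, the form that [Green_poly] requires. *)
Lemma nondecreasing_poly_approx psi (L B e : R) : 0 <= L -> 0 < B -> 0 < e ->
  (forall x y, `|psi x - psi y| <= L * `|x - y|) -> {homo psi : x y / x <= y} ->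
  psi 0 = 0 ->
  exists q : {poly R}, [/\ q`_0 = 0, q`_1 = 0 & forall x, `|x| <= B ->
    0 <= q^`().[x] /\ `|q.[x] - psi x| <= e].
Proof.
move=> L0 B0 e0 hL hpsi psi0.
(* The interval [- B, B] is moved to the unit interval. *)
pose psi1 y := psi (2 * B * y - B).
have psi1L x y : `|psi1 x - psi1 y| <= (L * (2 * B)) * `|x - y|.
  apply: le_trans (hL _ _) _; rewrite (_ : _ - _ = (2 * B) * (x - y)); last by ring.
  by rewrite normrM (ger0_norm (_ : 0 <= 2 * B)) ?mulrA// mulr_ge0// ltW.
have LB0 : 0 <= L * (2 * B) by rewrite mulr_ge0// mulr_ge0// ltW.
have e30 : 0 < e / 3 by rewrite divr_gt0.
have [n hn] := bern_approx LB0 e30 psi1L.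
pose b := bern n.+1 (fun k => psi1 (k%:R / n.+1%:R)).
pose aff : {poly R} := (2 * B)^-1 *: ('X + B%:P).
have affE x : aff.[x] = (x + B) / (2 * B) by rewrite /aff !hornerE/= mulrC.
have aff01 x : `|x| <= B -> 0 <= aff.[x] <= 1.
  rewrite ler_norml => /andP[x1 x2]; rewrite affE divr_ge0 ?mulr_ge0//=; try lra.
  rewrite ler_pdivrMr ?mulr_gt0//; lra.
have affd : aff^`() = ((2 * B)^-1)%:P.
  by rewrite /aff derivZ derivD derivX derivC addr0 -mul_polyC mulr1.
pose p1 := b \Po aff; pose p2 := p1 - (p1.[0])%:P.
have B00 : `|0 : R| <= B by rewrite normr0 ltW.
have p1a x : `|x| <= B -> `|p1.[x] - psi x| <= e / 3.
  move=> xB; rewrite /p1 horner_comp.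
  have -> : psi x = psi1 aff.[x].
    by rewrite /psi1 affE; congr psi; field; rewrite gt_eqF.
  exact: hn (aff01 _ xB).
have p2a x : `|x| <= B -> `|p2.[x] - psi x| <= e / 3 + e / 3.
  move=> xB; rewrite /p2 !hornerE.
  rewrite (_ : _ - _ = (p1.[x] - psi x) - (p1.[0] - psi 0)); last by rewrite psi0; ring.
  by apply: le_trans (ler_normB _ _) _; apply: lerD; exact: p1a.
have p2d x : `|x| <= B -> 0 <= p2^`().[x].
  move=> xB; rewrite /p2 derivB derivC subr0 /p1 deriv_comp affd !hornerE horner_comp.
  apply: mulr_ge0; last by rewrite invr_ge0 mulr_ge0// ltW.
  apply: bern_deriv_ge0 => [|k]; first exact: aff01.
  apply: hpsi; rewrite lerD2r ler_wpM2l ?mulr_ge0 ?(ltW B0)//.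
  by rewrite ler_pM2r ?invr_gt0// ler_nat.
have L1 : 0 < L + 1 by rewrite ltr_wpDl.
have eL : 0 < e / 3 / (L + 1) by rewrite divr_gt0.
have [m hm] := flat_id_approx B0 eL.
exists (p2 \Po flat_id B m).
have f0 : (flat_id B m).[0] = 0 by rewrite flat_id_horner mul0r.
split.
- by rewrite -horner_coef0 horner_comp f0 /p2 !hornerE subrr.
- have -> : (p2 \Po flat_id B m)`_1 = (p2 \Po flat_id B m)^`()`_0 by rewrite coef_deriv.
  rewrite -horner_coef0 deriv_comp !hornerE flat_id_deriv.
  by rewrite expr0n/= mulr0 !mul0r subr0 expr1n subrr add0r !mulr0.
move=> x xB; have [h1 h2 h3] := hm _ xB; split.
  by rewrite deriv_comp !hornerE horner_comp mulr_ge0// p2d.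
rewrite horner_comp (_ : _ - psi x = (p2.[(flat_id B m).[x]] - psi (flat_id B m).[x]) +
  (psi (flat_id B m).[x] - psi x)); last by ring.
apply: le_trans (ler_normD _ _) _.
have h4 := p2a _ h1; have h5 := hL (flat_id B m).[x] x.
have h6 : L * `|(flat_id B m).[x] - x| <= e / 3.
  apply: (@le_trans _ _ ((L + 1) * (e / 3 / (L + 1)))); last by rewrite mulrC divfK// gt_eqF.
  by apply: ler_pM => //; rewrite lerDl.
lra.
Qed.

End bernstein.

(** * Local finiteness of smooth measures *)

Section local_finiteness.
Context {R : realType}.
Local Notation mR := (measurableTypeR R).

Lemma ge0_le_integral_monotone d (T : measurableType d) (mu : {measure set T -> \bar R})
    (f g : T -> \bar R) : (forall x, 0 <= f x)%E -> (forall x, f x <= g x)%E ->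
  (\int[mu]_x f x <= \int[mu]_x g x)%E.
Proof.
move=> f0 fg; have g0 x : (0 <= g x)%E by exact: le_trans (f0 x) (fg x).
rewrite !ge0_integralTE//; apply: le_ereal_sup => _ [h hf <-].
by exists h => // x; exact: le_trans (hf x) (fg x).
Qed.

Definition box n (a : 'I_n -> R) (r : R) : set (n.-tuple mR) :=
  [set t | forall i, a i - r <= tnth t i <= a i + r].

Lemma measurable_box n (a : 'I_n -> R) r : measurable (box a r).
Proof.
have -> : box a r = \bigcap_(i in [set: 'I_n])
    ((fun t : n.-tuple mR => tnth t i) @^-1` `[a i - r, a i + r]).
  apply/seteqP; split => t /= h i; first by rewrite /= in_itv/= h.
  by have := h i I; rewrite /= in_itv/=.
apply: fin_bigcap_measurable => // i _.
by rewrite -[X in measurable X]setTI; exact: measurable_tnth.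
Qed.

Lemma leb_box n (a : 'I_n -> R) r : (leb n (box a r) < +oo)%E.
Proof.
elim: n a => [|n IH] a.
  by rewrite /leb/= diracE; case: (_ \in _) => //=; rewrite ltry.
have -> : leb n.+1 (box a r) = (@lebesgue_measure R \x leb n)%E
    (`[a ord0 - r, a ord0 + r]%classic `*` box (fun i => a (lift ord0 i)) r).
  rewrite /= /leb_cons /pushforward; congr (_ _).
  apply/seteqP; split => -[x t] /=.
    move=> h; split => /=.
      by have := h ord0; rewrite tnth0 in_itv/=.
    by move=> i; have := h (lift ord0 i); rewrite tnthS.
  rewrite in_itv/= => -[h1 h2] i; have [j ->|->] := unliftP ord0 i.
    by rewrite tnthS; exact: h2.
  by rewrite tnth0.
rewrite product_measure1E//; last exact: measurable_box.
have fin : @lebesgue_measure R `[a ord0 - r, a ord0 + r]%classic \is a fin_num.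
  by rewrite lebesgue_measure_itv/=; case: ifPn => // _; rewrite -EFinB.
exact: lte_mul_pinfty (measure_ge0 _ _) fin (IH _).
Qed.

Context {n : nat} {M : ptopologicalType}.
Variables (atlas : set (chart R n M)) (mu : {measure set (borel M) -> \bar R}).
Hypotheses (hM : smooth_manifold atlas) (hmu : smooth_measure atlas mu).

Lemma open_measurable (U : set M) : open U -> measurable (U : set (borel M)).
Proof. by move=> oU; exact: sub_sigma_algebra. Qed.

(** In a chart, the density is bounded near the image of [x], and a small ball
    there lies in a box of finite Lebesgue measure. *)
Lemma locally_finite (x : M) : exists U : set M, [/\ open U, U x & (mu U < +oo)%E].
Proof.
case: hM => _ _ hchart hcov _.
have [c hc cx] := hcov x; have [oD oI K cmapc cinvc] := hchart _ hc.
have [rho [smr rho0 rhoE]] := hmu hc.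
pose y := cmap c x.
have cy : cimg c y by exists x.
have rho_cont : {for y, continuous rho} by have [] := smr [::] y cy.
have nr : \forall z \near y, rho z \in `](rho y - 1), (rho y + 1)[.
  apply: (rho_cont [set w | w \in `](rho y - 1), (rho y + 1)[]).
  by apply: near_in_itvoo; rewrite in_itv/= ltrBlDr ltrDl ltr01.
have : \forall z \near y, cimg c z /\ rho z < rho y + 1.
  near=> z; split; first by near: z; exact: open_nbhs_nbhs.
  have h : rho z \in `](rho y - 1), (rho y + 1)[.
    by near: z.
  by move: h; rewrite in_itv/= => /andP[].
move=> /nbhs_ballP[r /= r0 hr].
pose U := cdom c `&` cmap c @^-1` ball y r.
have oU : open U.
  rewrite openE => z [dz bz]; apply: filterI; first exact: open_nbhs_nbhs.
  apply: (cmapc _ dz); apply: open_nbhs_nbhs; split => //; exact: ball_open.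
exists U; split => //; first by split => //; exact: ballxx.
rewrite rhoE; [|exact: open_measurable|by move=> z []].
pose a (i : 'I_n) := y 0 i.
apply: (@le_lt_trans _ _ (\int[leb n]_t ((rho y + 1) * \1_(box a r) t)%:E)%E).
  apply: ge0_le_integral_monotone => t.
    case: ifPn => // /set_mem[z [dz _] <-]; rewrite lee_fin; apply: rho0; by exists z.
  case: ifPn => [/set_mem[z [dz bz] zt]|_].
    rewrite lee_fin indicE mem_set => [|i].
      by rewrite mulr1 ltW// -zt; have [] := hr _ bz.
    move: bz; rewrite /= zt => -[_ /(_ 0 i)]; rewrite /ball/= /row_of !mxE /a.
    by rewrite ltr_distlC => /andP[/ltW -> /ltW ->].
  rewrite lee_fin mulr_ge0// addr_ge0//; exact: rho0.
have mb := measurable_box a r.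
have c0 : 0 <= rho y + 1 by rewrite addr_ge0//; exact: rho0.
under eq_integral do rewrite EFinM.
rewrite ge0_integralZl_EFin//; last exact/measurable_EFinP/measurable_indic.
rewrite integral_indic// setIT lte_mul_pinfty//; exact: leb_box.
Unshelve. all: by end_near. Qed.

Lemma compact_finite (K : set M) : compact K ->
  exists2 V : set M, open V /\ K `<=` V & (mu V < +oo)%E.
Proof.
rewrite compact_cover => cK.
have /choice[U hU] := locally_finite.
have [D _ KD] := cK M setT U (fun i _ => let: And3 h _ _ := hU i in h)
  (fun x _ => ex_intro2 _ _ x I (let: And3 _ h _ := hU x in h)).
suff [V [oV hV] fV] : exists2 V : set M, open V /\ (forall i, i \in enum_fset D -> U i `<=` V) &
    (mu V < +oo)%E.
  exists V => //; split => // x /KD[i iD]; exact: hV.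
elim: (enum_fset D) => [|i s [V [oV hV] fV]].
  by exists set0; rewrite ?measure0 ?ltry//; split => //; exact: open0.
have [oi _ fi] := hU i.
exists (U i `|` V).
  split; first exact: openU.
  move=> j; rewrite inE => /orP[/eqP ->|/hV]; first exact: subsetUl.
  by move=> h; apply: subset_trans h _; exact: subsetUr.
apply: le_lt_trans (measureU2 _ _ _) _; [exact: open_measurable..|].
exact: lte_add_pinfty.
Qed.

Lemma continuous_borel (f : M -> R) : continuous f ->
  measurable_fun setT (f : borel M -> R).
Proof.
move=> cf; apply: (measurability (@RGenOInfty.G R)).
  exact: RGenOInfty.measurableE.
move=> _ [_ [r ->] <-]; rewrite setTI; apply: open_measurable.
by apply: open_comp; [move=> x _; exact: cf|exact: interval_open].
Qed.

End local_finiteness.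

(** * Smooth functions of several variables *)

Section smooth_algebra.
Context {R : realType} {n : nat}.
Implicit Types (F G : 'rV[R]_n -> R) (U : set 'rV[R]_n).
Local Notation e i := (delta_mx 0 i : 'rV[R]_n).

Lemma open_near U x (P : 'rV[R]_n -> Prop) : open U -> U x -> (forall y, U y -> P y) ->
  \forall y \near x, P y.
Proof. by move=> oU Ux h; apply: filterS h _; exact: open_nbhs_nbhs. Qed.

Lemma partial_local U F G : open U -> (forall x, U x -> F x = G x) ->
  forall i x, U x -> partial i F x = partial i G x.
Proof.
move=> oU FG i x Ux; rewrite /partial; apply: near_eq_derive; exact: open_near FG.
Qed.

(** The derivatives of a product are sums of products, so smoothness cannot be
    proved by induction for one product at a time: it is proved at once for a
    class of functions that is stable under differentiation. *)
Lemma smooth_on_class U (A : set ('rV[R]_n -> R)) : open U ->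
  (forall F x, A F -> U x -> {for x, continuous F} /\ forall i, derivable F x (e i)) ->
  (forall F i, A F -> exists2 G, A G & forall x, U x -> partial i F x = G x) ->
  forall F, A F -> smooth_on U F.
Proof.
move=> oU h1 h2 F AF s x Ux.
suff [G AG FG] : exists2 G, A G & forall x, U x -> iter_partial s F x = G x.
  have [c d] := h1 _ _ AG Ux.
  have near_FG : \forall y \near x, G y = iter_partial s F y.
    by apply: (open_near oU Ux) => y Uy; rewrite FG.
  split.
    move: c; rewrite /prop_for /continuous_at -FG//; apply: cvg_trans.
    exact: near_eq_cvg near_FG.
  by move=> i; apply: near_eq_derivable (d i).
elim: s => [|i s [G AG FG]]; first by exists F.
have [G' AG' GG'] := h2 _ i AG.
exists G' => // y Uy; rewrite -GG'//; exact: (partial_local oU FG).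
Qed.

Lemma iter_partial_rcons s i F : iter_partial (rcons s i) F = iter_partial s (partial i F).
Proof. by rewrite /iter_partial foldr_rcons. Qed.

Lemma smooth_on_partial U F i : smooth_on U F -> smooth_on U (partial i F).
Proof. by move=> h s x Ux; have := h (rcons s i) x Ux; rewrite iter_partial_rcons. Qed.

Lemma smooth_on_continuous U F x : smooth_on U F -> U x -> {for x, continuous F}.
Proof. by move=> h Ux; have [] := h [::] x Ux. Qed.

Lemma smooth_on_derivable U F x i : smooth_on U F -> U x -> derivable F x (e i).
Proof. by move=> h Ux; have [_] := h [::] x Ux; apply. Qed.

Lemma derivable_add F G (x v : 'rV[R]_n) : derivable F x v -> derivable G x v ->
  derivable (fun y => F y + G y) x v.
Proof. by move=> dF dG; have := derivableD dF dG. Qed.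

Lemma derivable_mul F G (x v : 'rV[R]_n) : derivable F x v -> derivable G x v ->
  derivable (fun y => F y * G y) x v.
Proof. by move=> dF dG; have := derivableM dF dG. Qed.

Lemma partialD F G i x : derivable F x (e i) -> derivable G x (e i) ->
  partial i (fun y => F y + G y) x = partial i F x + partial i G x.
Proof. by move=> dF dG; exact: (deriveD dF dG). Qed.

Lemma partialM F G i x : derivable F x (e i) -> derivable G x (e i) ->
  partial i (fun y => F y * G y) x = F x * partial i G x + partial i F x * G x.
Proof.
by move=> dF dG; rewrite [X in _ = _ + X]mulrC; exact: (deriveM dF dG).
Qed.

Lemma partial_cst (a : R) i (x : 'rV[R]_n) : partial i (fun=> a) x = 0.
Proof. exact: derive_cst. Qed.

Lemma smooth_on_cst U (a : R) : open U -> smooth_on U (fun _ : 'rV[R]_n => a).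
Proof.
move=> oU; apply: (@smooth_on_class _ [set F | exists a, F = fun=> a]) => //=.
- move=> _ x [b ->] Ux; split; first exact: cst_continuous.
  by move=> i; exact: derivable_cst.
- move=> _ i [b ->]; exists (fun=> 0); first by exists 0.
  by move=> x _; exact: partial_cst.
- by exists a.
Qed.

Lemma smooth_onD U F G : open U -> smooth_on U F -> smooth_on U G ->
  smooth_on U (fun x => F x + G x).
Proof.
move=> oU sF sG.
apply: (@smooth_on_class _ [set H | exists F' G', [/\ smooth_on U F', smooth_on U G' &
  H = fun x => F' x + G' x]]) => //=; last by exists F, G.
- move=> _ x [F1 [G1 [s1 s2 ->]]] Ux; split.
    by apply: continuousD; [exact: smooth_on_continuous s1 Ux|exact: smooth_on_continuous s2 Ux].
  by move=> i; apply: derivable_add; [exact: smooth_on_derivable s1 Ux|exact: smooth_on_derivable s2 Ux].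
- move=> _ i [F1 [G1 [s1 s2 ->]]]; exists (fun x => partial i F1 x + partial i G1 x).
    exists (partial i F1), (partial i G1).
    by split; [exact: smooth_on_partial s1|exact: smooth_on_partial s2|].
  by move=> x Ux; apply: partialD; exact: smooth_on_derivable Ux.
Qed.

Lemma smooth_onM U F G : open U -> smooth_on U F -> smooth_on U G ->
  smooth_on U (fun x => F x * G x).
Proof.
move=> oU sF sG.
pose val (l : seq (('rV[R]_n -> R) * ('rV[R]_n -> R))) x := \sum_(p <- l) p.1 x * p.2 x.
pose ok (l : seq (('rV[R]_n -> R) * ('rV[R]_n -> R))) :=
  foldr (fun p P => smooth_on U p.1 /\ smooth_on U p.2 /\ P) True l.
have okc l x : ok l -> U x ->
    {for x, continuous (val l)} /\ forall i, derivable (val l) x (e i).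
  elim: l => [_ Ux|p l IH [s1 [s2 okl]] Ux].
    have -> : val [::] = fun=> 0 by apply/funext => y; rewrite /val big_nil.
    by split => [|i]; [exact: cst_continuous|exact: derivable_cst].
  have [c dr] := IH okl Ux.
  have -> : val (p :: l) = fun y => p.1 y * p.2 y + val l y.
    by apply/funext => y; rewrite /val big_cons.
  split.
    apply: continuousD c; apply: continuousM.
      exact: smooth_on_continuous s1 Ux.
    exact: smooth_on_continuous s2 Ux.
  move=> i; apply: derivable_add (dr i); apply: derivable_mul.
    exact: smooth_on_derivable s1 Ux.
  exact: smooth_on_derivable s2 Ux.
apply: (@smooth_on_class _ [set H | exists2 l, ok l & H = val l]) => //=.
- by move=> _ x [l okl ->] Ux; exact: okc.
- move=> _ i [l okl ->].
  suff [l' okl' h] : exists2 l', ok l' & forall x, U x -> partial i (val l) x = val l' x.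
    by exists (val l') => //; exists l'.
  elim: l okl => [_|p l IH [s1 [s2 okl]]].
    exists [::] => // x _; rewrite {2}/val big_nil.
    have -> : val [::] = fun=> 0 by apply/funext => y; rewrite /val big_nil.
    exact: partial_cst.
  have [l' okl' h] := IH okl.
  exists [:: (p.1, partial i p.2), (partial i p.1, p.2) & l'].
    split; first exact: s1.
    split; first exact: smooth_on_partial s2.
    by split; first exact: smooth_on_partial s1.
  move=> x Ux.
  have -> : val (p :: l) = fun y => p.1 y * p.2 y + val l y.
    by apply/funext => y; rewrite /val big_cons.
  have d1 := smooth_on_derivable (i := i) s1 Ux; have d2 := smooth_on_derivable (i := i) s2 Ux.
  rewrite partialD.
  - by rewrite (partialM d1 d2) (h x Ux) /val !big_cons/= addrA.
  - exact: derivable_mul.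
  - by have [_] := okc l x okl Ux; apply.
- exists [:: (F, G)] => //=; apply/funext => x; by rewrite /val big_seq1.
Qed.

Lemma smooth_on_poly U F (q : {poly R}) : open U -> smooth_on U F ->
  smooth_on U (fun x => q.[F x]).
Proof.
move=> oU sF; elim/poly_ind: q => [|q a IH].
  rewrite (_ : (fun x => _) = fun=> 0); first exact: smooth_on_cst.
  by apply/funext => x; rewrite horner0.
rewrite (_ : (fun x => _) = fun x => q.[F x] * F x + a).
  by apply: (smooth_onD oU); [exact: (smooth_onM oU IH sF)|exact: smooth_on_cst].
by apply/funext => x; rewrite hornerD hornerM hornerX hornerC.
Qed.

Lemma partial_poly U F (q : {poly R}) i x : open U -> smooth_on U F -> U x ->
  partial i (fun y => q.[F y]) x = q^`().[F x] * partial i F x.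
Proof.
move=> oU sF Ux; elim/poly_ind: q => [|q a IH].
  rewrite deriv0 horner0 mul0r -(partial_cst 0 i x); congr (partial _ _ _).
  by apply/funext => y; rewrite horner0.
rewrite (_ : (fun x => _) = fun x => q.[F x] * F x + a); last first.
  by apply/funext => y; rewrite hornerD hornerM hornerX hornerC.
have sq := smooth_on_poly q oU sF.
rewrite partialD; last 2 first.
- exact: smooth_on_derivable (smooth_onM oU sq sF) Ux.
- exact: derivable_cst.
rewrite partialM; [|exact: smooth_on_derivable Ux..].
rewrite IH partial_cst addr0 derivD derivM derivX derivC mulr1 addr0.
rewrite hornerD hornerM hornerX; ring.
Qed.

Lemma partial_partial_poly U F (q : {poly R}) i j x : open U -> smooth_on U F -> U x ->
  partial i (partial j (fun y => q.[F y])) x =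
  q^`().[F x] * partial i (partial j F) x +
  q^`()^`().[F x] * (partial i F x * partial j F x).
Proof.
move=> oU sF Ux.
rewrite (partial_local oU (G := fun y => q^`().[F y] * partial j F y))//; last first.
  by move=> y Uy; exact: partial_poly Uy.
have sp := smooth_on_partial j sF; have sq := smooth_on_poly q^`() oU sF.
rewrite partialM; [|exact: smooth_on_derivable Ux..].
by rewrite (partial_poly _ _ oU)// mulrA.
Qed.

End smooth_algebra.

(** * Integration by parts on the manifold *)

Lemma Lipschitz_continuous (R : realType) (psi : R -> R) (L : R) : 0 <= L ->
  (forall x y, `|psi x - psi y| <= L * `|x - y|) -> continuous psi.
Proof.
move=> L0 hL; have L1 : 0 < L + 1 by rewrite ltr_wpDl.
move=> x; apply/cvgrPdist_le => e e0; near=> y.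
apply: le_trans (hL _ _) _.
apply: (@le_trans _ _ ((L + 1) * (e / (L + 1)))); last by rewrite mulrC divfK// gt_eqF.
apply: ler_pM => //; first by rewrite lerDl.
near: y; apply/nbhs_ballP; exists (e / (L + 1)) => /=; first exact: (divr_gt0 e0 L1).
by move=> y; rewrite /ball/= => /ltW.
Unshelve. all: by end_near. Qed.

Section operator.
Context {R : realType} {n : nat} {M : ptopologicalType}.
Variables (atlas : set (chart R n M)) (mu : {measure set (borel M) -> \bar R}).
Variable Delta : (M -> R) -> M -> R.
Hypotheses (hM : smooth_manifold atlas) (hD : diffusion_operator atlas Delta).
Hypotheses (hmu : smooth_measure atlas mu) (hsym : symmetric_wrt atlas mu Delta).
Implicit Types (f g : M -> R) (q : {poly R}) (c : chart R n M).

Lemma atlas_chart c : atlas c -> is_chart c. Proof. by case: hM => _ _ h _ _; exact: h. Qed.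

Lemma atlas_cover (x : M) : exists2 c, atlas c & cdom c x.
Proof. by case: hM => _ _ _ h _; exact: h. Qed.

Lemma atlas_open c : atlas c -> open (cimg c).
Proof. by move=> /atlas_chart[]. Qed.

Lemma smooth_poly f q : smooth atlas f -> smooth atlas (fun x => q.[f x]).
Proof. by move=> sf c hc; apply: (smooth_on_poly q (atlas_open hc) (sf _ hc)). Qed.

Lemma smooth_lin f g (a b : R) : smooth atlas f -> smooth atlas g ->
  smooth atlas (fun x => a * f x + b * g x).
Proof.
move=> sf sg c hc; have oc := atlas_open hc.
have h (u : M -> R) (r : R) : smooth atlas u -> smooth_on (cimg c) (fun y => r * (u \o cinv c) y).
  by move=> su; exact: (smooth_onM oc (smooth_on_cst r oc) (su _ hc)).
exact: (smooth_onD oc (h f a sf) (h g b sg)).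
Qed.

Lemma smooth_on_sum (U : set 'rV[R]_n) (I : Type) (s : seq I) (F : I -> 'rV[R]_n -> R) :
  open U -> (forall i, smooth_on U (F i)) -> smooth_on U (fun y => \sum_(i <- s) F i y).
Proof.
move=> oU sF; elim: s => [|i s IH].
  rewrite (_ : (fun y => _) = fun=> 0); first exact: smooth_on_cst.
  by apply/funext => y; rewrite big_nil.
rewrite (_ : (fun y => _) = fun y => F i y + \sum_(j <- s) F j y).
  exact: (smooth_onD oU (sF i) IH).
by apply/funext => y; rewrite big_cons.
Qed.

Lemma chart_continuous g : (forall c, atlas c -> exists2 G, smooth_on (cimg c) G &
  forall y, cimg c y -> g (cinv c y) = G y) -> continuous g.
Proof.
move=> h x; have [c hc cx] := atlas_cover x.
have [oD oI K cmapc _] := atlas_chart hc.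
have [G sG gG] := h _ hc.
have cy : cimg c (cmap c x) by exists x.
have cG := smooth_on_continuous sG cy.
have near_gG : \forall z \near x, G (cmap c z) = g z.
  apply: filterS (open_nbhs_nbhs (conj oD cx)) => z cz.
  by rewrite -gG ?K//; exists z.
have : G (cmap c z) @[z --> x] --> G (cmap c x) by exact: (cvg_comp _ _ (cmapc x cx) cG).
rewrite -[G (cmap c x)]gG// K// => hG.
by apply: cvg_trans hG; exact: near_eq_cvg near_gG.
Qed.

Lemma smooth_continuous f : smooth atlas f -> continuous f.
Proof. by move=> sf; apply: chart_continuous => c hc; exists (f \o cinv c) => //; exact: sf. Qed.

Lemma Delta_continuous f : smooth atlas f -> continuous (Delta f).
Proof.
move=> sf; apply: chart_continuous => c hc; have oc := atlas_open hc.
have [sigma [b [[ss sb] _ _ DE]]] := hD hc.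
exists (fun y => \sum_(i < n) \sum_(j < n)
   sigma i j y * partial i (partial j (f \o cinv c)) y +
   \sum_(i < n) b i y * partial i (f \o cinv c) y).
  have sfc : smooth_on (cimg c) (f \o cinv c) := sf _ hc.
  have sp i := smooth_on_partial i sfc.
  apply: (smooth_onD oc).
    exact: (smooth_on_sum _ oc (fun i => smooth_on_sum _ oc (fun j =>
      smooth_onM oc (ss i j) (smooth_on_partial i (sp j))))).
  exact: (smooth_on_sum _ oc (fun i => smooth_onM oc (sb i) (sp i))).
by move=> y cy; exact: DE.
Qed.

(** The carre du champ of [f]. *)
Definition Gam f (x : M) : R := (Delta (fun z => f z ^+ 2) x - 2 * f x * Delta f x) / 2.

(** The chain rule in coordinates. [G] is the value of the quadratic form of
    the second order coefficients at the gradient of [f], hence its sign; it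
    does not depend on [q]. *)
Lemma Delta_poly_chart f c x : smooth atlas f -> atlas c -> cdom c x ->
  exists G : R, 0 <= G /\ forall q,
  Delta (fun z => q.[f z]) x = q^`().[f x] * Delta f x + q^`()^`().[f x] * G.
Proof.
move=> sf hc cx; have oc := atlas_open hc.
have [oD oI K cmapc _] := atlas_chart hc.
have [sigma [b [[ss sb] _ pos DE]]] := hD hc.
pose y := cmap c x; have cy : cimg c y by exists x.
pose F := f \o cinv c; have sfc : smooth_on (cimg c) F := sf _ hc.
exists (\sum_(i < n) \sum_(j < n) sigma i j y * partial i F y * partial j F y); split.
  have := pos y (\row_i partial i F y) cy.
  by congr (0 <= _); apply: eq_bigr => i _; apply: eq_bigr => j _; rewrite !mxE.
move=> q; have xE : cinv c y = x by exact: K.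
pose Op (H : 'rV[R]_n -> R) := \sum_(i < n) \sum_(j < n)
   sigma i j y * partial i (partial j H) y + \sum_(i < n) b i y * partial i H y.
have -> : Delta f x = Op F by rewrite -xE; exact: DE.
have -> : Delta (fun z => q.[f z]) x = Op (fun y => q.[F y]).
  by rewrite -xE; exact: (DE _ _ (smooth_poly q sf) cy).
have -> : f x = F y by rewrite /F/= xE.
rewrite /Op mulrDr addrAC; congr (_ + _).
  rewrite !mulr_sumr -big_split/=; apply: eq_bigr => i _.
  rewrite !mulr_sumr -big_split/=; apply: eq_bigr => j _.
  rewrite (partial_partial_poly q i j oc sfc cy); ring.
rewrite mulr_sumr; apply: eq_bigr => i _.
rewrite (partial_poly q i oc sfc cy); ring.
Qed.

Lemma deriv_sqX (s : R) :
  ('X^2 : {poly R})^`().[s] = 2 * s /\ ('X^2 : {poly R})^`()^`().[s] = 2.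
Proof.
have -> : ('X^2 : {poly R})^`() = 'X *+ 2 by rewrite derivXn expr1.
by rewrite derivMn derivX !hornerMn hornerX hornerC mulr_natl.
Qed.

(** The remainder of [Delta_poly_chart] is the same for all polynomials, and
    the square function identifies it as [Gam f]. *)
Lemma Delta_poly f q x : smooth atlas f ->
  Delta (fun z => q.[f z]) x = q^`().[f x] * Delta f x + q^`()^`().[f x] * Gam f x.
Proof.
move=> sf; have [c hc cx] := atlas_cover x.
have [G [_ GE]] := Delta_poly_chart sf hc cx.
suff -> : Gam f x = G by [].
rewrite /Gam (_ : (fun z => f z ^+ 2) = (fun z => ('X^2 : {poly R}).[f z])); last first.
  by apply/funext => z; rewrite hornerXn.
by rewrite GE (deriv_sqX _).1 (deriv_sqX _).2; field.
Qed.

Lemma Gam_ge0 f x : smooth atlas f -> 0 <= Gam f x.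
Proof.
move=> sf; have [c hc cx] := atlas_cover x.
have [G [G0 GE]] := Delta_poly_chart sf hc cx.
have := Delta_poly 'X^2 x sf; rewrite GE (deriv_sqX _).1 (deriv_sqX _).2.
by move=> h; suff -> : Gam f x = G by []; lra.
Qed.

Lemma Delta_lin f g (a b : R) x : smooth atlas f -> smooth atlas g ->
  Delta (fun z => a * f z + b * g z) x = a * Delta f x + b * Delta g x.
Proof.
move=> sf sg; have [c hc cx] := atlas_cover x.
have oc := atlas_open hc; have [oD oI K cmapc _] := atlas_chart hc.
have [sigma [bb [_ _ _ DE]]] := hD hc.
pose y := cmap c x; have cy : cimg c y by exists x.
pose F := f \o cinv c; pose G := g \o cinv c.
pose Op (H : 'rV[R]_n -> R) := \sum_(i < n) \sum_(j < n)
   sigma i j y * partial i (partial j H) y + \sum_(i < n) bb i y * partial i H y.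
have xE : cinv c y = x by exact: K.
have EF : Delta f x = Op F by rewrite -xE; exact: DE.
have EG : Delta g x = Op G by rewrite -xE; exact: DE.
have -> : Delta (fun z => a * f z + b * g z) x = Op (fun y => a * F y + b * G y).
  by rewrite -xE; exact: (DE _ _ (smooth_lin a b sf sg) cy).
rewrite EF EG /Op.
have sF : smooth_on (cimg c) F := sf _ hc; have sG : smooth_on (cimg c) G := sg _ hc.
have scF : smooth_on (cimg c) (fun y => a * F y) := smooth_onM oc (smooth_on_cst a oc) sF.
have scG : smooth_on (cimg c) (fun y => b * G y) := smooth_onM oc (smooth_on_cst b oc) sG.
have pZ H r j z : smooth_on (cimg c) H -> cimg c z ->
    partial j (fun y => r * H y) z = r * partial j H z.
  move=> sH cz; rewrite partialM; [|exact: derivable_cst|exact: smooth_on_derivable sH cz].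
  by rewrite partial_cst mul0r addr0.
have pL i z : cimg c z -> partial i (fun y => a * F y + b * G y) z =
    a * partial i F z + b * partial i G z.
  move=> cz; rewrite partialD; [|exact: smooth_on_derivable scF cz|exact: smooth_on_derivable scG cz].
  by rewrite !pZ.
have ppL i j : partial i (partial j (fun y => a * F y + b * G y)) y =
    a * partial i (partial j F) y + b * partial i (partial j G) y.
  rewrite (partial_local oc (pL j))//.
  have s1 := smooth_on_partial j sF; have s2 := smooth_on_partial j sG.
  rewrite partialD ?pZ//.
    exact: smooth_on_derivable (smooth_onM oc (smooth_on_cst a oc) s1) cy.
  exact: smooth_on_derivable (smooth_onM oc (smooth_on_cst b oc) s2) cy.
rewrite !mulrDr addrACA; congr (_ + _).
  rewrite !mulr_sumr -big_split/=; apply: eq_bigr => i _.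
  rewrite !mulr_sumr -big_split/=; apply: eq_bigr => j _.
  rewrite (ppL i j) mulrDr.
  rewrite [X in X + _ = _]mulrCA [X in _ + X = _]mulrCA.
  by [].

rewrite !mulr_sumr -big_split/=; apply: eq_bigr => i _.
by rewrite pL// mulrDr !(mulrCA (bb i y)).
Qed.

Lemma supp_notin f x : ~ supp f x -> f x = 0.
Proof.
by move=> sx; apply: contrapT => /eqP fx; apply: sx; exact: subset_closure.
Qed.

Lemma Delta_supp f x : smooth atlas f -> ~ supp f x -> Delta f x = 0.
Proof.
move=> sf sx; have [c hc cx] := atlas_cover x.
have oc := atlas_open hc; have [oD oI K cmapc cinvc] := atlas_chart hc.
have [sigma [b [_ _ _ DE]]] := hD hc.
pose y := cmap c x; have cy : cimg c y by exists x.
rewrite -(K x cx) -/y DE//.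
pose F := f \o cinv c.
pose U := cimg c `&` cinv c @^-1` (~` supp f).
have oS : open (~` supp f) by apply: closed_openC; exact: closed_closure.
have oU : open U.
  rewrite openE => z [cz sz]; apply: filterI; first exact: open_nbhs_nbhs.
  by apply: (cinvc _ cz); exact: open_nbhs_nbhs.
have Uy : U y by split => //=; rewrite K.
have F0 z : U z -> F z = (fun=> 0) z by move=> [_ sz]; exact: supp_notin.
have p0 i z : U z -> partial i F z = (fun=> 0) z.
  by move=> Uz; rewrite (partial_local oU F0)// partial_cst.
rewrite big1 => [|i _].
  by rewrite add0r big1// => i _; rewrite -/F p0// mulr0.
by rewrite big1// => j _; rewrite -/F (partial_local oU (p0 j))// partial_cst mulr0.
Qed.

Lemma Cc_poly f q : q`_0 = 0 -> Cc_smooth atlas f -> Cc_smooth atlas (fun x => q.[f x]).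
Proof.
move=> q0 [sf cf]; split; first exact: smooth_poly.
apply: subclosed_compact cf _; first exact: closed_closure.
apply: closure_subset => x /=; apply: contra_neq => ->.
by rewrite horner_coef0.
Qed.

Lemma Cc_lin f g (a b : R) : Cc_smooth atlas f -> Cc_smooth atlas g ->
  Cc_smooth atlas (fun x => a * f x + b * g x).
Proof.
move=> [sf cf] [sg cg]; split; first exact: smooth_lin.
apply: (subclosed_compact _ (compactU cf cg)); first exact: closed_closure.
rewrite /supp -closureU; apply: closure_subset => x /= h.
have [fx|fx] := eqVneq (f x) 0; [right|by left].
by apply: contraNneq h => gx; rewrite fx gx !mulr0 addr0.
Qed.

Lemma compact_bound (K : set M) (g : M -> R) : continuous g -> compact K ->
  exists2 B : R, 0 < B & forall x, K x -> `|g x| <= B.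
Proof.
move=> cg cK.
have := @continuous_compact _ _ g K (continuous_subspaceT cg) cK.
move=> /compact_bounded[r [_ hr]].
exists (Num.max r 0 + 1); first by rewrite ltr_wpDl// le_max lexx orbT.
move=> x Kx; apply: (hr (Num.max r 0 + 1)).
  have : r <= Num.max r 0 by rewrite le_max lexx.
  by move=> /le_lt_trans; apply; rewrite ltrDl.
by exists x.
Qed.

Lemma integrable_Cc (K : set M) (g : M -> R) : continuous g -> compact K ->
  (forall x, ~ K x -> g x = 0) ->
  mu.-integrable setT (EFin \o (g : borel M -> R)).
Proof.
move=> cg cK g0.
have [B B0 hB] := compact_bound cg cK.
have [V [oV KV] fV] := compact_finite hM hmu cK.
have mV := open_measurable oV.
have iV : mu.-integrable setT (fun x => (B * \1_V x)%:E).
  apply/integrableP; split.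
    by apply/measurable_EFinP; apply: measurable_funM => //; exact: measurable_indic.
  under eq_integral do rewrite gee0_abs ?lee_fin ?mulr_ge0 ?(ltW B0)// EFinM.
  rewrite ge0_integralZl_EFin ?(ltW B0)//; last exact/measurable_EFinP/measurable_indic.
  by rewrite integral_indic// setIT; apply: lte_mul_pinfty => //; rewrite lee_fin ltW.
apply: le_integrable iV => //.
  by apply/measurable_EFinP; exact: continuous_borel.
move=> x _ /=; rewrite lee_fin [leRHS]ger0_norm ?mulr_ge0 ?(ltW B0)//.
have [Kx|Kx] := pselect (K x).
  by rewrite indicE mem_set ?mulr1 ?hB//; exact: KV.
by rewrite g0// normr0 mulr_ge0// ltW.
Qed.

(** Integration by parts: testing the symmetry of [Delta] on [f] and [b o f]
    involves the Wronskian [s b' - b] of the identity and [b]; the polynomials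
    of this form are those that vanish to second order at the origin. *)
Lemma Green_poly f q : q`_0 = 0 -> q`_1 = 0 -> Cc_smooth atlas f ->
  (\int[mu]_x (q.[f x] * Delta f x) = - \int[mu]_x (q^`().[f x] * Gam f x))%R.
Proof.
move=> q0 q1 Cf; have [sf cf] := Cf.
(* Dividing the coefficient of degree k by k - 1 solves [s b'(s) - b(s) =
   q(s)]. *)
pose b := \poly_(k < size q) (q`_k / (k.-1)%:R).
have bE k : b`_k = q`_k / (k.-1)%:R.
  by rewrite coef_poly; case: ltnP => // h; rewrite nth_default// mul0r.
have wq : 'X * b^`() - b = q.
  apply/polyP => -[|[|k]]; rewrite coefB coefXM/= ?coef_deriv !bE/=.
  - by rewrite q0 mul0r subrr.
  - by rewrite invr0 !mulr0 mul0rn subrr.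
  - have k0 : k.+1%:R != 0 :> R by rewrite pnatr_eq0.
    by rewrite -[_ *+ k.+2]mulr_natr -[k.+2%:R]natr1 mulrDr mulr1 addrK divfK.
have wq' : 'X * b^`()^`() = q^`().
  by rewrite -wq derivB derivM derivX mul1r addrC addKr.
have b0 : b`_0 = 0 by rewrite bE q0 mul0r.
have Cb := Cc_poly b0 Cf.
have cD := Delta_continuous sf; have cfc := smooth_continuous sf.
have cq r : continuous (fun x => r.[f x]) by exact: smooth_continuous (smooth_poly r sf).
have cG : continuous (Gam f).
  have c2 : continuous (Delta (fun z => f z ^+ 2)).
    rewrite (_ : (fun z => f z ^+ 2) = (fun z => ('X^2 : {poly R}).[f z])); last first.
      by apply/funext => z; rewrite hornerXn.
    exact/Delta_continuous/smooth_poly.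
  move=> x; apply: cvgM; last exact: cvg_cst.
  apply: cvgB; first exact: c2.
  apply: cvgM; last exact: cD.
  by apply: cvgM; [exact: cvg_cst|exact: cfc].
have zD x : ~ supp f x -> Delta f x = 0 by exact: Delta_supp.
have zG x : ~ supp f x -> Gam f x = 0.
  move=> sx; rewrite /Gam zD// (supp_notin sx) (_ : (fun z => f z ^+ 2) = (fun z => ('X^2 : {poly R}).[f z])); last first.
    by apply/funext => z; rewrite hornerXn.
  rewrite Delta_supp; [by rewrite mulr0 subrr mul0r|exact: smooth_poly|].
  move=> h; apply: sx; move: h; apply: closure_subset => z /=.
  by apply: contra_neq => ->; rewrite hornerXn expr0n.
have int (u v : M -> R) : continuous u -> continuous v -> (forall x, ~ supp f x -> v x = 0) ->
    mu.-integrable setT (EFin \o ((fun x => u x * v x) : borel M -> R)).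
  move=> cu cv v0; apply: (integrable_Cc _ cf).
    by move=> x; apply: cvgM; [exact: cu|exact: cv].
  by move=> x sx; rewrite v0// mulr0.
have := hsym Cf Cb.
have E0 x : f x * Delta (fun z => b.[f z]) x =
    f x * b^`().[f x] * Delta f x + f x * b^`()^`().[f x] * Gam f x.
  by rewrite Delta_poly// mulrDr (mulrA _ _ (Delta f x)) (mulrA _ _ (Gam f x)).
under [in X in _ = X -> _]eq_Rintegral do rewrite E0.
have E1 x : q.[f x] = f x * b^`().[f x] - b.[f x].
  by rewrite -wq hornerD hornerN hornerM hornerX.
have E2 x : q^`().[f x] = f x * b^`()^`().[f x] by rewrite -wq' hornerM hornerX.
have cfb r : continuous (fun x => f x * r.[f x]).
  by move=> x; apply: cvgM; [exact: cfc|exact: cq].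
have i1 := int _ _ (cfb b^`()) cD zD; have i2 := int _ _ (cfb b^`()^`()) cG zG.
have i3 := int _ _ (cq b) cD zD.
rewrite RintegralD//.
under [in X in _ -> X = _]eq_Rintegral do rewrite E1 mulrBl.
rewrite RintegralB//.
under [in X in _ -> _ = - X]eq_Rintegral do rewrite E2.
lra.
Qed.

(** In [Green_poly], both [q^`()] and [Gam f] are nonnegative. *)
Lemma dissipative_poly f q : q`_0 = 0 -> q`_1 = 0 -> Cc_smooth atlas f ->
  (forall x, 0 <= q^`().[f x]) -> (\int[mu]_x (q.[f x] * Delta f x) <= 0)%R.
Proof.
move=> q0 q1 Cf h; rewrite Green_poly// oppr_le0; apply: Rintegral_ge0 => x _.
by rewrite mulr_ge0// Gam_ge0//; exact: Cf.1.
Qed.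

(** Approximating [psi] uniformly on the range of [f] by the polynomials of
    [nondecreasing_poly_approx] changes the integral by a small multiple of
    the integral of [|Delta f|], which is finite. *)
Lemma dissipative_Lipschitz f (psi : R -> R) (L : R) : 0 <= L ->
  (forall x y, `|psi x - psi y| <= L * `|x - y|) -> {homo psi : x y / x <= y} ->
  psi 0 = 0 -> Cc_smooth atlas f ->
  mu.-integrable setT (EFin \o ((fun x => psi (f x) * Delta f x) : borel M -> R)) /\
  (\int[mu]_x (psi (f x) * Delta f x) <= 0)%R.
Proof.
move=> L0 hL hpsi psi0 Cf; have [sf cf] := Cf.
have cpsi : continuous psi by exact: Lipschitz_continuous L0 hL.
have cD := Delta_continuous sf; have cfc := smooth_continuous sf.
have zD x : ~ supp f x -> Delta f x = 0 by exact: Delta_supp.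
have int (u v : M -> R) : continuous u -> continuous v -> (forall x, ~ supp f x -> v x = 0) ->
    mu.-integrable setT (EFin \o ((fun x => u x * v x) : borel M -> R)).
  move=> cu cv v0; apply: (integrable_Cc _ cf).
    by move=> x; apply: cvgM; [exact: cu|exact: cv].
  by move=> x sx; rewrite v0// mulr0.
have cpf : continuous (fun x => psi (f x)).
  by move=> x; apply: (cvg_comp _ _ (cfc x)); exact: cpsi.
have i1 := int _ _ cpf cD zD.
split => //.
have [B0 B00 hB0] := compact_bound cfc cf.
have hB x : `|f x| <= B0.
  have [Kx|Kx] := pselect (supp f x); first exact: hB0.
  by rewrite (supp_notin Kx) normr0 ltW.
have iN : mu.-integrable setT (EFin \o ((fun x => `|Delta f x|) : borel M -> R)).
  apply: (integrable_Cc _ cf); last by move=> x /zD ->; rewrite normr0.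
  by move=> x; apply: (cvg_comp _ _ (cD x)); exact: norm_continuous.
set D := (\int[mu]_x `|Delta f x|)%R.
have D0 : 0 <= D by apply: Rintegral_ge0 => x _.
apply/ler_addgt0Pr => r r0; rewrite add0r.
have D1 : 0 < D + 1 by rewrite ltr_wpDl.
have e0 : 0 < r / (D + 1) by rewrite divr_gt0.
have [q [q0 q1 hq]] := nondecreasing_poly_approx L0 B00 e0 hL hpsi psi0.
have cq : continuous (fun x => q.[f x]) by exact: smooth_continuous (smooth_poly q sf).
have i2 := int _ _ cq cD zD.
have := dissipative_poly q0 q1 Cf (fun x => (hq _ (hB x)).1).
have le12 : (\int[mu]_x (psi (f x) * Delta f x) <=
    \int[mu]_x (q.[f x] * Delta f x + r / (D + 1) * `|Delta f x|))%R.
  apply: le_Rintegral => //.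
    exact: (integrableD measurableT i2 (integrableZl measurableT (r / (D + 1)) iN)).
  move=> x _; rewrite -lerBlDl -mulrBl; apply: le_trans (ler_norm _) _.
  by rewrite normrM ler_wpM2r// distrC; exact: (hq _ (hB x)).2.
move: le12; rewrite RintegralD//; last exact: (integrableZl measurableT (r / (D + 1)) iN).
rewrite RintegralZl// -/D => h1 h2.
have h3 : r / (D + 1) * D <= r.
  by rewrite -[leRHS](divfK (lt0r_neq0 D1)) ler_wpM2l ?lerDl// ltW.
lra.
Qed.

End operator.

(** * Dissipativity of the self-adjoint operator *)

Lemma cauchy_schwarz d (T : measurableType d) (R : realType)
    (mu : {measure set T -> \bar R}) (f g : T -> R[i]) :
  memLp 2 mu f -> memLp 2 mu g ->
  mu.-integrable setT (EFin \o (fun x => nc (f x) * nc (g x))) /\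
  (\int[mu]_x (nc (f x) * nc (g x)) <= rnorm mu 2 f * rnorm mu 2 g)%R.
Proof.
move=> mf mg.
have nmf := measurable_normc mf.1; have nmg := measurable_normc mg.1.
have i1 : mu.-integrable setT (EFin \o (fun x => nc (f x) * nc (g x))).
  apply: (integrable_le_sqr mf mg); first exact: measurable_funM.
  by move=> x; rewrite ger0_norm// mulr_ge0 ?normc_ge0.
split => //.
have h : (2^-1 + 2^-1 = 1 :> R) by lra.
have := hoelder mu nmf nmg (ltr0n _ 2) (ltr0n _ 2) h.
rewrite Lnorm1.
have -> : Lnorm mu 2%:E (EFin \o (nc \o f)) = cnorm 2 mu f by [].
have -> : Lnorm mu 2%:E (EFin \o (nc \o g)) = cnorm 2 mu g by [].
rewrite !rnormE// -EFinM -lee_fin; congr (_ <= _)%E.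
rewrite /Rintegral fineK; last exact: (integrable_fin_num measurableT i1).
by apply: eq_integral => x _ /=; rewrite ger0_norm// mulr_ge0 ?normc_ge0.
Qed.

Section form.
Context {R : realType} {n : nat} {M : ptopologicalType}.
Variables (atlas : set (chart R n M)) (mu : {measure set (borel M) -> \bar R}).
Variable Delta : (M -> R) -> M -> R.
Hypotheses (hM : smooth_manifold atlas) (hD : diffusion_operator atlas Delta).
Hypotheses (hmu : smooth_measure atlas mu) (hsym : symmetric_wrt atlas mu Delta).
Implicit Types (u v f g : borel M -> R[i]) (a : R[i]).
Local Notation L2 := (memLp 2 mu).
Local Notation N := (rnorm mu 2).

Lemma Cc_graph_measurable f g : Cc_graph atlas Delta (-1) f g ->
  cmeasurable f /\ cmeasurable g.
Proof.
move=> [[sr _] [si _] gE].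
have c1 h : smooth atlas h -> measurable_fun setT (h : borel M -> R).
  by move=> sh; apply: continuous_borel; exact: (smooth_continuous hM).
have c2 h : smooth atlas h -> measurable_fun setT (fun x : borel M => -1 * Delta h x).
  move=> sh; apply: measurable_funM => //.
  by apply: continuous_borel; exact: (Delta_continuous hM hD).
split; split; [exact: c1|exact: c1| |].
- by rewrite (_ : _ \o g = fun x => -1 * Delta (Rez \o f) x); [exact: c2|apply/funext => x /=; rewrite gE].
- by rewrite (_ : _ \o g = fun x => -1 * Delta (Imz \o f) x); [exact: c2|apply/funext => x /=; rewrite gE].
Qed.

(** On test functions this is [dissipative_Lipschitz] for the real function
    [Re (a u)]. It passes to the closure because the pairing of [psi (Re (a
    u))] with [Re (a v)] is continuous for the graph norm, [psi] being
    Lipschitz and zero at zero. *)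
Lemma minus_Delta_dissipative u v a (psi : R -> R) (L : R) :
  minus_Delta atlas mu Delta u v -> 0 <= L ->
  (forall x y, `|psi x - psi y| <= L * `|x - y|) -> {homo psi : x y / x <= y} ->
  psi 0 = 0 ->
  mu.-integrable setT (EFin \o (fun x => psi (Rez (a * u x)) * Rez (a * v x))) /\
  (0 <= \int[mu]_x (psi (Rez (a * u x)) * Rez (a * v x)))%R.
Proof.
move=> [mu_ mv happ] L0 hL hpsi psi0.
have cpsi := Lipschitz_continuous L0 hL.
have psib x : `|psi x| <= L * `|x| by have := hL x 0; rewrite psi0 !subr0.
have mpsi w : cmeasurable w -> measurable_fun setT (fun x : borel M => psi (Rez (w x))).
  move=> mw; apply: (@measurableT_comp _ _ _ _ _ _ psi _ (fun x => Rez (w x))).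
    exact: continuous_measurable_fun.
  exact: mw.1.
have iW w z : L2 w -> L2 z ->
    mu.-integrable setT (EFin \o (fun x => psi (Rez (a * w x)) * Rez (a * z x))).
  move=> mw mz; apply: (@integrable_le_sqr _ _ _ _ _ (fun x => (L%:C * a) * w x) (fun x => a * z x)).
  - exact: memLpZ.
  - exact: memLpZ.
  - apply: measurable_funM; first by apply: mpsi; exact: cmeasurableZ mw.1.
    by have := (cmeasurableZ a mz.1).1.
  move=> x; rewrite normrM ler_pM ?normr_Re_le//.
  apply: le_trans (psib _) _; rewrite -mulrA Normc.normcM normc_real (ger0_norm L0).
  by rewrite ler_wpM2l// normr_Re_le.
split; first exact: iW.
apply/ler_addgt0Pr => r r0.
(* [C] collects the constants of the error estimates below. *)
pose C := L * nc a ^+ 2 * (N v + N u + 1) + 1.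
have C0 : 0 <= L * nc a ^+ 2 * (N v + N u + 1).
  apply: mulr_ge0; first by apply: mulr_ge0 => //; exact: sqr_ge0.
  by apply: addr_ge0 => //; apply: addr_ge0; exact: rnorm_ge0.
have C1 : 0 < C by rewrite ltr_wpDl.
pose e := Num.min 1 (r / C).
have e0 : 0 < e by rewrite lt_min ltr01 divr_gt0.
have e1 : e <= 1 by rewrite ge_min lexx.
have eC : e * C <= r by rewrite -ler_pdivlMr// ge_min lexx orbT.
have [f [g [fg uf vg]]] := happ _ e0.
have [mf mg] := Cc_graph_measurable fg.
have mf2 : L2 f.
  have h : L2 (fun x => u x - f x) by split; [exact: cmeasurableB mu_.1 mf|exact: lt_trans uf (ltry _)].
  by have := memLpB (two_ge1 R) mu_ h; congr memLp; apply/funext => x; ring.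
have mg2 : L2 g.
  have h : L2 (fun x => v x - g x) by split; [exact: cmeasurableB mv.1 mg|exact: lt_trans vg (ltry _)].
  by have := memLpB (two_ge1 R) mv h; congr memLp; apply/funext => x; ring.
have muf := memLpB (two_ge1 R) mu_ mf2; have mvg := memLpB (two_ge1 R) mv mg2.
have Nuf : N (fun x => u x - f x) <= e by rewrite -lee_fin -rnormE// ltW.
have Nvg : N (fun x => v x - g x) <= e by rewrite -lee_fin -rnormE// ltW.
have [Cr Ci gE] := fg.
pose F : M -> R := fun x => Rez a * (Rez \o f) x + (- Imz a) * (Imz \o f) x.
have FE x : Rez (a * f x) = F x by rewrite RezM /F /= mulNr.
have CF : Cc_smooth atlas F by exact: Cc_lin.
have gE' x : Rez (a * g x) = - Delta F x.
  by rewrite (Delta_lin hM hD _ _ _ Cr.1 Ci.1) gE !ReImE/=; ring.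
have [_ diss] := dissipative_Lipschitz hM hD hmu hsym L0 hL hpsi psi0 CF.
have ifg := iW _ _ mf2 mg2; have iuv := iW _ _ mu_ mv.
have pos : (0 <= \int[mu]_x (psi (Rez (a * f x)) * Rez (a * g x)))%R.
  rewrite (_ : Rintegral _ _ _ = - \int[mu]_x (psi (F x) * Delta F x))%R ?oppr_ge0//.
  rewrite -mulN1r -RintegralZl//; last first.
    by have [] := dissipative_Lipschitz hM hD hmu hsym L0 hL hpsi psi0 CF.
  by apply: eq_Rintegral => x _; rewrite FE gE'; ring.
have [i1 cs1] := cauchy_schwarz muf mv; have [i2 cs2] := cauchy_schwarz mf2 mvg.
have i3 := integrableZl measurableT (L * nc a ^+ 2) i1.
have i4 := integrableZl measurableT (L * nc a ^+ 2) i2.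
have iS : mu.-integrable setT (EFin \o (fun x => psi (Rez (a * u x)) * Rez (a * v x) +
    (L * nc a ^+ 2 * (nc (u x - f x) * nc (v x)) + L * nc a ^+ 2 * (nc (f x) * nc (v x - g x))))).
  exact: (integrableD measurableT iuv (integrableD measurableT i3 i4)).
have key : (\int[mu]_x (psi (Rez (a * f x)) * Rez (a * g x)) <=
   \int[mu]_x (psi (Rez (a * u x)) * Rez (a * v x) +
    (L * nc a ^+ 2 * (nc (u x - f x) * nc (v x)) + L * nc a ^+ 2 * (nc (f x) * nc (v x - g x)))))%R.
  apply: le_Rintegral => // x _.
  rewrite -lerBlDl.
  rewrite (_ : _ - _ = (psi (Rez (a * f x)) - psi (Rez (a * u x))) * Rez (a * v x) +
     psi (Rez (a * f x)) * (Rez (a * g x) - Rez (a * v x))); last by ring.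
  apply: lerD; apply: le_trans (ler_norm _) _; rewrite normrM.
    have h1 : `|psi (Rez (a * f x)) - psi (Rez (a * u x))| <= L * (nc a * nc (u x - f x)).
      apply: le_trans (hL _ _) _; rewrite ler_wpM2l// -Normc.normcM distrC -RezN -RezD -mulrBr.
      exact: normr_Re_le.
    have h2 : `|Rez (a * v x)| <= nc a * nc (v x) by rewrite -Normc.normcM normr_Re_le.
    apply: le_trans (ler_pM _ _ h1 h2) _ => //.
    by rewrite le_eqVlt; apply/orP; left; apply/eqP; ring.
  have h1 : `|psi (Rez (a * f x))| <= L * (nc a * nc (f x)).
    by apply: le_trans (psib _) _; rewrite ler_wpM2l// -Normc.normcM normr_Re_le.
  have h2 : `|Rez (a * g x) - Rez (a * v x)| <= nc a * nc (v x - g x).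
    by rewrite distrC -RezN -RezD -mulrBr -Normc.normcM normr_Re_le.
  apply: le_trans (ler_pM _ _ h1 h2) _ => //.
  by rewrite le_eqVlt; apply/orP; left; apply/eqP; ring.
move: key; rewrite RintegralD//; last exact: (integrableD measurableT i3 i4).
rewrite RintegralD// !RintegralZl// => key.
have Nf : N f <= N u + 1.
  apply: le_trans (le_rnorm_dist (two_ge1 R) mf2 mu_) _; rewrite rnorm_distC addrC lerD2l.
  exact: le_trans Nuf e1.
have K0 : 0 <= L * nc a ^+ 2 by apply: mulr_ge0 => //; exact: sqr_ge0.
have b1 : L * nc a ^+ 2 * (\int[mu]_x (nc (u x - f x) * nc (v x)))%R <=
    L * nc a ^+ 2 * (e * N v).
  apply: ler_wpM2l => //; apply: le_trans cs1 _.
  by rewrite ler_wpM2r ?rnorm_ge0.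
have b2 : L * nc a ^+ 2 * (\int[mu]_x (nc (f x) * nc (v x - g x)))%R <=
    L * nc a ^+ 2 * ((N u + 1) * e).
  apply: ler_wpM2l => //; apply: le_trans cs2 _.
  by rewrite ler_pM ?rnorm_ge0.
have b3 : L * nc a ^+ 2 * (e * N v) + L * nc a ^+ 2 * ((N u + 1) * e) <= r.
  apply: le_trans eC; rewrite /C mulrDr mulr1.
  rewrite (_ : _ + _ = e * (L * nc a ^+ 2 * (N v + N u + 1))); last by ring.
  by rewrite lerDl ltW.
lra.
Qed.

End form.

(** * The spectral variable as an operator *)

Section resolvent.
Context {d : measure_display} {T : measurableType d} {R : realType}.
Variable mu : {measure set T -> \bar R}.
Variable E : set R -> (T -> R[i]) -> (T -> R[i]).
Hypothesis hE : projection_valued_measure mu E.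
Local Notation mR := (measurableTypeR R).
Local Notation L2 := (memLp 2 mu).
Local Notation N := (rnorm mu 2).
Local Notation step_op := (step_operator E).
Local Notation ucalc := (ucalc mu E).
Implicit Types (f g h u v w : T -> R[i]) (a : R[i]) (s t : @step R).
Implicit Types (phi psi chi : mR -> R[i]).

Lemma cmeasurableM d' (S : measurableType d') (p q : S -> R[i]) :
  cmeasurable p -> cmeasurable q -> cmeasurable (fun x => p x * q x).
Proof.
move=> [pr pi] [qr qi]; split.
  rewrite (_ : _ \o _ = fun x => (Rez \o p) x * (Rez \o q) x - (Imz \o p) x * (Imz \o q) x).
    by apply: measurable_funB; exact: measurable_funM.
  by apply/funext => x; rewrite /comp RezM.
rewrite (_ : _ \o _ = fun x => (Rez \o p) x * (Imz \o q) x + (Imz \o p) x * (Rez \o q) x).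
  by apply: measurable_funD; exact: measurable_funM.
by apply/funext => x; rewrite /comp ImzM.
Qed.

Lemma ucalc_indic (A : set mR) f : measurable A -> L2 f -> ucalc (fun l => (\1_A l)%:C) f (E A f).
Proof.
move=> mA mf; pose B : @bset R := exist _ A mA.
have mEf := E_mem hE B mf.
split => // e e0; exists [:: (1, B)]; split => [l|].
  by rewrite /step_fun big_seq1 mul1r subrr Normc.normc0 ltW.
rewrite (_ : (fun x => _) = fun=> 0); first by rewrite /rnorm cnorm0//= ltW.
by apply/funext => x; rewrite /step_operator big_seq1 mul1r subrr.
Qed.

Lemma normc_indic (A : set mR) (l : mR) : nc ((\1_A l)%:C : R[i]) <= 1.
Proof. by rewrite normc_real ger0_norm// indicE; case: (_ \in _). Qed.

Lemma ucalc_id f : L2 f -> ucalc (fun=> 1) f f.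
Proof.
move=> mf; have := ucalc_indic measurableT mf; rewrite indicT => h.
apply: (ucalc_ae hE h _ mf.1).
by case: hE => _ _ _ hT _; exact: hT.
Qed.

Definition trunc_itv (k : nat) : set mR := `[- k.+1%:R, k.+1%:R].

Lemma measurable_trunc k : measurable (trunc_itv k).
Proof. exact: measurable_itv. Qed.

Lemma trunc_itv_near (l : mR) : \forall k \near \oo, trunc_itv k l.
Proof.
near=> k; rewrite /trunc_itv/= in_itv/= -ler_norml.
apply: (@le_trans _ _ k%:R); last by rewrite ler_nat.
by near: k; exact: nbhs_infty_ger.
Unshelve. all: by end_near. Qed.

(** This reduces spectral integrals of unbounded functions to bounded ones. *)
Lemma trunc_integral (nu : {measure set mR -> \bar R}) phi : cmeasurable phi ->
  (\int[nu]_l (nc ((\1_(trunc_itv k) l)%:C * phi l)%R ^+ 2)%:E)%E @[k --> \oo] -->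
  (\int[nu]_l (nc (phi l) ^+ 2)%:E)%E.
Proof.
move=> mphi.
pose g k l := (nc ((\1_(trunc_itv k) l)%:C * phi l) ^+ 2)%:E.
have gE k l : g k l = ((\1_(trunc_itv k) l * nc (phi l)) ^+ 2)%:E.
  by rewrite /g normc_indicM.
have mg k : measurable_fun setT (g k).
  apply/measurable_EFinP/measurable_funX/measurable_normc.
  exact: cmeasurable_indicM (measurable_trunc k) mphi.
have g0 k l : setT l -> (0 <= g k l)%E by rewrite lee_fin sqr_ge0.
have ndg l : setT l -> {homo g^~ l : m k / (m <= k)%N >-> (m <= k)%E}.
  move=> _ m k mk; rewrite !gE lee_fin ler_sqr ?nnegrE ?mulr_ge0 ?normc_ge0//.
  rewrite ler_wpM2r ?normc_ge0// !indicE ler_nat.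
  case: (boolP (l \in trunc_itv m)) => // /set_mem h.
  rewrite mem_set//; move: h; rewrite /trunc_itv/= !in_itv/= -!ler_norml.
  by move=> /le_trans; apply; rewrite ler_nat.
have := cvg_monotone_convergence measurableT mg g0 ndg.
have -> : (\int[nu]_l (nc (phi l) ^+ 2)%:E)%E = (\int[nu]_l limn (g ^~ l))%E; last by [].
apply: eq_integral => l _; apply/esym/cvg_lim => //; apply: cvg_near_cst.
apply: filterS (trunc_itv_near l) => k tl.
by rewrite gE indicE mem_set// mul1r.
Qed.

(** If [phi] is a truncation of [l], then [phi] applied to [u] is [phi chi]
    applied to [f], so the integrals of the truncated functions against the
    spectral measures of [u] and [f] agree; the truncation is then removed on
    both sides. *)
Lemma spectral_integral_id chi f u v (B C : R) : 0 <= B -> 0 <= C ->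
  cmeasurable chi -> (forall l, nc (chi l) <= B) ->
  (forall l : mR, nc (l%:C * chi l) <= C) ->
  ucalc chi f u -> ucalc (fun l => l%:C * chi l) f v ->
  spectral_integral mu E (fun l => l%:C) u v.
Proof.
move=> B0 C0 mchi hB hC cu cv.
have [mf mu_] := ucalc_mem cu; have [_ mv] := ucalc_mem cv.
split => // m a A mA.
pose s : @step R := [seq (a i, exist _ (A i) (mA i)) | i <- enum 'I_m].
have -> : (fun x => v x - \sum_(i < m) a i * E (A i) u x) =
    (fun x => v x - step_op s u x).
  by apply/funext => x; rewrite /step_operator /s big_map big_enum.
have -> : (fun l : mR => (nc (l%:C - \sum_(i < m) a i * (\1_(A i) l)%:C) ^+ 2)%:E) =
    (fun l : mR => (nc (l%:C - step_fun s l) ^+ 2)%:E).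
  by apply/funext => l; rewrite /step_fun /s big_map big_enum.
have mid : cmeasurable (fun l : mR => l%:C) by apply: cmeasurable_real.
have ms := cmeasurable_step s.
have mids : cmeasurable (fun l : mR => l%:C - step_fun s l) by exact: cmeasurableB.
have [Bs hBs] := step_fun_bounded s.
have Bs0 : 0 <= Bs by apply: le_trans (hBs 0); exact: normc_ge0.
have csu : ucalc (step_fun s) u (step_op s u) by exact: ucalc_step.
have cs := ucalc_mul hE B0 Bs0 hB hBs cu csu.
have cd := ucalc_lin hE (-1) cs cv.
have mdf : cmeasurable (fun l : mR => -1 * (step_fun s l * chi l) + l%:C * chi l).
  by apply: cmeasurable_lin; exact: cmeasurableM.
have mds := memLpB (two_ge1 R) mv (step_op_mem hE s mu_).
have -> : (cnorm 2 mu (fun x => v x - step_op s u x)%R `^ 2 =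
    \int[smeas hE mf]_l (nc ((l%:C - step_fun s l) * chi l)%R ^+ 2)%:E)%E.
  rewrite rnormE// (@eq_rnorm _ _ _ _ _ _ (fun x => -1 * step_op s u x + v x)) => [|x]; last by ring.
  have [mm ->] := ucalc_rnorm hE mf mdf cd.
  rewrite poweR_EFin -rnorm_powR//; apply: eq_integral => l _.
  by rewrite powR_mulrn ?normc_ge0//; congr (nc _ ^+ 2)%:E; ring.
have -> : spectral_dist mu E u = smeas hE mu_ by [].
have lim1 := trunc_integral (nu := smeas hE mf) (cmeasurableM mids mchi).
have lim2 := trunc_integral (nu := smeas hE mu_) mids.
apply: (cvg_unique _ lim1); first exact: ereal_hausdorff.
apply: cvg_trans lim2; apply: near_eq_cvg; apply: nearW => k.
pose phik (l : mR) := (\1_(trunc_itv k) l)%:C * (l%:C - step_fun s l).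
have mphik : cmeasurable phik.
  exact: cmeasurable_indicM (measurable_trunc k) mids.
have bphik l : nc (phik l) <= k.+1%:R + Bs.
  rewrite /phik normc_indicM indicE.
  case: (boolP (l \in trunc_itv k)) => [/set_mem|_]; last by rewrite mul0r addr_ge0.
  rewrite /trunc_itv/= in_itv/= -ler_norml => lk; rewrite mul1r.
  by apply: le_trans (normcB _ _) _; rewrite normc_real lerD.
have [z cz] := ucalc_exists hE mphik bphik mu_.
have kB0 : 0 <= k.+1%:R + Bs by rewrite addr_ge0.
have czf := ucalc_mul hE B0 kB0 hB bphik cu cz.
have [mm1 e1] := ucalc_rnorm hE mu_ mphik cz.
have [mm2 e2] := ucalc_rnorm hE mf (cmeasurableM mphik mchi) czf.
transitivity (N z `^ 2)%:E.
  rewrite e1 -rnorm_powR//; apply: eq_integral => l _.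
  by rewrite powR_mulrn ?normc_ge0.
rewrite e2 -rnorm_powR//; apply: eq_integral => l _.
by rewrite powR_mulrn ?normc_ge0//; congr (nc _ ^+ 2)%:E; rewrite /phik; ring.
Qed.

End resolvent.

(** * Resolvents of a dissipative operator *)

(** One family of inequalities serves all purposes below: [psi] the identity
    gives a nonnegative quadratic form, hence a nonnegative spectrum; the
    positive part gives a maximum principle; truncations of [s ^ (p - 1)] give
    L^p estimates. The direction [a] accounts for complex values. *)
Definition dissipative_graph d (T : measurableType d) (R : realType)
    (mu : {measure set T -> \bar R}) (G : (T -> R[i]) -> (T -> R[i]) -> Prop) :=
  forall u v (a : R[i]) (psi : R -> R) (L : R), G u v -> 0 <= L ->
  (forall x y, `|psi x - psi y| <= L * `|x - y|) -> {homo psi : x y / x <= y} ->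
  psi 0 = 0 ->
  mu.-integrable setT (EFin \o (fun x => psi (Rez (a * u x)) * Rez (a * v x))) /\
  (0 <= \int[mu]_x (psi (Rez (a * u x)) * Rez (a * v x)))%R.

Section resolvent.
Context {d : measure_display} {T : measurableType d} {R : realType}.
Variable mu : {measure set T -> \bar R}.
Variable E : set R -> (T -> R[i]) -> (T -> R[i]).
Variable G : (T -> R[i]) -> (T -> R[i]) -> Prop.
Hypothesis hG : spectral_resolution mu G E.
Hypothesis hdiss : dissipative_graph mu G.
Let hE := hG.1.
Local Notation mR := (measurableTypeR R).
Local Notation L2 := (memLp 2 mu).
Local Notation N := (rnorm mu 2).
Local Notation ucalc := (ucalc mu E).
Implicit Types (f g h u v w : T -> R[i]) (a : R[i]) (s t : @step R).
Implicit Types (phi psi chi : mR -> R[i]).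

Lemma graph_ucalc chi f u v (B C : R) : 0 <= B -> 0 <= C ->
  cmeasurable chi -> (forall l, nc (chi l) <= B) ->
  (forall l : mR, nc (l%:C * chi l) <= C) ->
  ucalc chi f u -> ucalc (fun l => l%:C * chi l) f v -> G u v.
Proof.
move=> B0 C0 mchi hB hC cu cv; apply/(hG.2 u v).2; split; first exact: (ucalc_mem cu).2.
exact: (spectral_integral_id hE B0 C0 mchi hB hC cu cv).
Qed.

(** With [psi] the identity, in the real and imaginary directions,
    dissipativity says that the real part of the inner product of [u] and [v]
    is nonnegative. *)
Lemma dissipative_norm u v (K : R) : G u v -> L2 u -> L2 v -> 0 <= K ->
  K * N u <= N (fun x => v x + K%:C * u x).
Proof.
move=> guv mu_ mv K0.
have id1 (x y : R) : `|id x - id y| <= 1 * `|x - y| by rewrite mul1r.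
have idh : {homo (id : R -> R) : x y / x <= y} by [].
have [ir pr] := hdiss 1 guv ler01 id1 idh erefl.
have [ii pim] := hdiss 'i%C guv ler01 id1 idh erefl.
have mKu : L2 (fun x => K%:C * u x) by exact: memLpZ.
have ms : L2 (fun x => v x + K%:C * u x) by exact: memLpD.
rewrite -ler_sqr ?nnegrE ?mulr_ge0 ?rnorm_ge0// exprMn !rnorm_sqr//.
have iu := memL2_sqr_integrable mu_; have isum := memL2_sqr_integrable ms.
rewrite -RintegralZl//.
have j1 := integrableZl measurableT (2 * K) ir.
have j2 := integrableZl measurableT (2 * K) ii.
have j3 := integrableZl measurableT (K ^+ 2) iu.
have : (\int[mu]_x (2 * K * (id (Rez (1 * u x)) * Rez (1 * v x)) +
   (2 * K * (id (Rez ('i%C * u x)) * Rez ('i%C * v x)) + K ^+ 2 * nc (u x) ^+ 2))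
   <= \int[mu]_x nc (v x + K%:C * u x) ^+ 2)%R.
  apply: le_Rintegral => //.
    exact: (integrableD measurableT j1 (integrableD measurableT j2 j3)).
  move=> x _; rewrite !sqr_nc !ReImE/= -subr_ge0.
  rewrite (_ : _ - _ = Rez (v x) ^+ 2 + Imz (v x) ^+ 2); last by ring.
  by rewrite addr_ge0 ?sqr_ge0.
rewrite RintegralD//; last exact: (integrableD measurableT j2 j3).
rewrite RintegralD//.
rewrite [X in X + (_ + _) <= _]RintegralZl// [X in _ + (X + _) <= _]RintegralZl//.
have p1 : 0 <= 2 * K * (\int[mu]_x (id (Rez (1 * u x)) * Rez (1 * v x)))%R by rewrite !mulr_ge0.
have p2 : 0 <= 2 * K * (\int[mu]_x (id (Rez ('i%C * u x)) * Rez ('i%C * v x)))%R by rewrite !mulr_ge0.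
lra.
Qed.

(** The spectrum of a dissipative graph is nonnegative: a spectral component [w]
    in [[- K, - e]] would satisfy [K |w| <= |v + K w| <= (K - e) |w|]. *)
Lemma spectrum_itv f (K e : R) : L2 f -> 0 < e -> e <= K -> N (E `[- K, - e] f) = 0.
Proof.
move=> mf e0 eK; pose A : set mR := `[- K, - e]%classic.
have mA : measurable A by exact: measurable_itv.
have AP l : A l -> - K <= l <= - e by rewrite /A/= in_itv.
have K0 : 0 < K by exact: lt_le_trans eK.
pose chi (l : mR) : R[i] := (\1_A l)%:C.
have mchi : cmeasurable chi by apply/cmeasurable_real/measurable_indic.
have hB l : nc (chi l) <= 1 by exact: normc_indic.
have cw : ucalc chi f (E A f) by exact: ucalc_indic.
set w := E A f in cw *.
have mid : cmeasurable (fun l : mR => l%:C) by apply: cmeasurable_real.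
have mlchi := cmeasurableM mid mchi.
have hC (l : mR) : nc (l%:C * chi l) <= K.
  rewrite mulrC normc_indicM indicE; case: (boolP (l \in A)) => [/set_mem|_].
    move=> /AP/andP[l1 l2]; rewrite mul1r normc_real ler_norml l1/=.
    by apply: le_trans l2 _; lra.
  by rewrite mul0r ltW.
have [v cv] := ucalc_exists hE mlchi hC mf.
have gwv : G w v by exact: (graph_ucalc ler01 (ltW K0) mchi hB hC cw cv).
have [_ mw] := ucalc_mem cw; have [_ mv] := ucalc_mem cv.
have h1 := dissipative_norm gwv mw mv (ltW K0).
(* On the interval, [v + K w] is the image of [w] under [l + K], which lies
   between 0 and [K - e]. *)
pose phi (l : mR) : R[i] := chi l * (l + K)%:C.
have mphi : cmeasurable phi.
  by apply: cmeasurableM => //; apply: cmeasurable_real; exact: measurable_funD.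
have hphi l : nc (phi l) <= K - e.
  rewrite normc_indicM indicE; case: (boolP (l \in A)) => [/set_mem|_].
    by move=> /AP/andP[l1 l2]; rewrite mul1r normc_real ger0_norm; lra.
  by rewrite mul0r subr_ge0.
have [z cz] := ucalc_exists hE mphi hphi mw.
have Ke0 : 0 <= K - e by rewrite subr_ge0.
have cz' := ucalc_mul hE ler01 Ke0 hB hphi cw cz.
have cvw := ucalc_lin hE K%:C cw cv.
have e1 : (fun l => phi l * chi l) = (fun l : mR => K%:C * chi l + l%:C * chi l).
  apply/funext => l; rewrite /phi /chi.
  have -> : (\1_A l)%:C * (l + K)%:C * (\1_A l)%:C = (l + K)%:C * ((\1_A l) * (\1_A l))%:C :> R[i].
    by rewrite rmorphM/=; ring.
  have -> : \1_A l * \1_A l = \1_A l :> R by rewrite indicE; case: (_ \in _); rewrite ?mul1r ?mul0r.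
  rewrite rmorphD/=; ring.
rewrite e1 in cz'.
have zv : ae_eqc mu z (fun x => K%:C * w x + v x).
  apply: (ucalc_uniq hE _ cz' cvw); last exact: aeW.
  by apply: cmeasurable_lin.
have h2 := ucalc_bound hE mphi Ke0 hphi cz.
have [_ mz] := ucalc_mem cz; have [_ mvw] := ucalc_mem cvw.
have h3 : N z = N (fun x => v x + K%:C * w x).
  rewrite (ae_eq_rnorm (ltr0n _ 2) mz.1 mvw.1 zv); apply: eq_rnorm => x; exact: addrC.
have : K * N w <= (K - e) * N w by apply: le_trans h1 _; rewrite -h3.
rewrite mulrBl lerDl oppr_ge0 pmulr_rle0// => h4.
by apply/eqP; rewrite eq_le h4 rnorm_ge0.
Qed.

Lemma spectrum_ge0 f : L2 f -> N (E `]-oo, 0[ f) = 0.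
Proof.
move=> mf.
pose A k : set mR := `[- k.+1%:R, - k.+1%:R^-1]%classic.
have mA k : measurable (A k) by exact: measurable_itv.
have AE : (`]-oo, (0 : R)[%classic : set mR) = \bigcup_k A k.
  apply/seteqP; split => x /=; rewrite in_itv/=.
    move=> x0.
    have [k kx] : exists k : nat, - x <= k.+1%:R /\ (- x)^-1 <= k.+1%:R.
      have [k _ hk] : \forall k \near \oo, - x <= k%:R /\ (- x)^-1 <= k%:R.
        by near=> k; split; near: k; exact: nbhs_infty_ger.
      by exists k; exact: (hk k.+1 (leqnSn k)).
    exists k => //; rewrite /A/= in_itv/=; case: kx => k1 k2; apply/andP; split; first by rewrite lerNl.
    by rewrite lerNr -[leRHS]invrK lef_pV2// posrE ?ltr0n// ?invr_gt0 oppr_gt0.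
  move=> [k _]; rewrite /A/= in_itv/= => /andP[_] /le_lt_trans; apply.
  by rewrite oppr_lt0 invr_gt0.
have : smeas hE mf (\bigcup_k A k) = 0%E.
  apply/eqP; rewrite eq_le measure_ge0 andbT.
  apply: (@le_trans _ _ (\sum_(0 <= k <oo) smeas hE mf (A k))%E).
    by apply: measure_sigma_subadditive => //; exact: bigcup_measurable.
  rewrite eseries0// => k _ _.
  rewrite /smeas (spectral_distE hE (exist _ _ (mA k)) mf)/= /smass.
  have -> : N (E (A k) f) = 0; last by rewrite expr0n.
  apply: spectrum_itv => //.
  by rewrite (@le_trans _ _ 1)// ?invf_le1// ler1n.
rewrite -AE; have mneg : measurable (`]-oo, (0 : R)[%classic : set mR) by exact: measurable_itv.
rewrite /smeas (spectral_distE hE (exist _ _ mneg) mf)/= /smass => -[].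
by move=> /eqP; rewrite sqrf_eq0 => /eqP.
Unshelve. all: by end_near. Qed.

(** On the spectrum of a nonnegative operator this is the constant 1: it plays
    the role of the unit among functions that vanish on the negative
    half-line. *)
Definition ind0 (l : mR) : R[i] := (\1_(`[0, +oo[ : set R) l)%:C.

Lemma measurable_ind0 : cmeasurable ind0.
Proof. by apply/cmeasurable_real/measurable_indic; exact: measurable_itv. Qed.

Lemma ind0E (l : R) : ind0 l = if 0 <= l then 1 else 0.
Proof.
rewrite /ind0 indicE; case: ifPn => l0.
  by rewrite mem_set//= in_itv/= l0.
by rewrite memNset//= in_itv/= andbT; exact/negP.
Qed.

Lemma ucalc_ind0 f : L2 f -> ucalc ind0 f f.
Proof.
move=> mf.
have mneg : measurable (`]-oo, (0 : R)[%classic : set mR) by exact: measurable_itv.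
have c1 := ucalc_indic hE mneg mf; have c2 := ucalc_lin hE (-1) c1 (ucalc_id hE mf).
have -> : ind0 = (fun l => -1 * (\1_(`]-oo, (0 : R)[%classic : set mR) l)%:C + 1).
  apply/funext => l; rewrite ind0E indicE; case: (leP 0 l) => l0.
    by rewrite memNset/= ?in_itv/= ?mulr0 ?add0r//; apply/negP; rewrite -leNgt.
  by rewrite mem_set/= ?in_itv//= mulr1 addNr.
apply: (ucalc_ae hE c2 _ mf.1).
have mE := E_mem hE (exist _ _ mneg) mf.
have : ae_eqc mu (E `]-oo, 0[ f) (fun=> 0).
  apply: (rnormB_eq0 (two_ge1 R) mE (memLp_cst0 _ _)) => //.
  by under eq_fun do rewrite subr0; rewrite spectrum_ge0.
by apply: filterS => x ->; rewrite mulr0 add0r.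
Qed.

(** The resolvent [lam (lam + A)^-1] as a function on the spectrum. *)
Definition rho (lam : R) (l : mR) : R[i] := if 0 <= l then (lam / (lam + l))%:C else 0.

Lemma rho01 (lam l : R) : 0 < lam -> 0 <= l -> 0 <= lam / (lam + l) <= 1.
Proof.
move=> lam0 l0; have ll : 0 < lam + l by rewrite ltr_wpDr.
apply/andP; split; first by rewrite divr_ge0// ltW.
by rewrite ler_pdivrMr// mul1r lerDl.
Qed.

Lemma normc_rho lam l : 0 < lam -> nc (rho lam l) <= 1.
Proof.
move=> lam0; rewrite /rho; case: ifPn => l0; last by rewrite Normc.normc0.
by have /andP[h0 h1] := rho01 lam0 l0; rewrite normc_real ger0_norm.
Qed.

Lemma measurable_rho lam : 0 < lam -> cmeasurable (rho lam).
Proof.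
move=> lam0.
have -> : rho lam = fun l => (\1_(`[0, +oo[ : set R) l * (lam / (lam + Num.max l 0)))%:C.
  apply/funext => l; rewrite /rho indicE; case: ifPn => l0.
    by rewrite mem_set/= ?in_itv/= ?l0// mul1r max_l.
  by rewrite memNset/= ?mul0r// in_itv/= andbT; exact/negP.
apply: cmeasurable_real; apply: measurable_funM.
  by apply: measurable_indic; exact: measurable_itv.
apply: measurable_funM => //; apply: (@measurableT_comp _ _ _ _ _ _ (fun x : R => (lam + Num.max x 0)^-1) _ id) => //.
apply: continuous_measurable_fun => x.
apply: cvgV; first by rewrite gt_eqF// ltr_wpDr// le_max lexx orbT.
apply: cvgD; first exact: cvg_cst.
by apply: continuous_max; [exact: cvg_id|exact: cvg_cst].
Qed.

Lemma resolvent_graph lam g u : 0 < lam -> ucalc (rho lam) g u ->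
  G u (fun x => lam%:C * (g x - u x)).
Proof.
move=> lam0 cu; have [mg mu_] := ucalc_mem cu.
have mr := measurable_rho lam0.
have c1 := ucalc_lin hE (-1) cu (ucalc_ind0 mg).
have z0 : ucalc (fun=> 0) g (fun=> 0).
  split => //; first exact: memLp_cst0.
  move=> e e0; exists [::]; split => [l|]; first by rewrite /step_fun big_nil subrr Normc.normc0 ltW.
  rewrite (_ : (fun x => _) = fun=> 0); first by rewrite /rnorm cnorm0//= ltW.
  by apply/funext => x; rewrite /step_operator big_nil subrr.
have c2 := ucalc_lin hE lam%:C c1 z0.
have lE (l : mR) : l%:C * rho lam l = lam%:C * (-1 * rho lam l + ind0 l) + 0.
  rewrite ind0E /rho; case: ifPn => l0; last by rewrite !mulr0 !addr0 mulr0.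
  rewrite mulN1r addr0 -(rmorph1 (real_complex R)) -rmorphN -rmorphD -!rmorphM/=.
  by congr (_%:C); field; rewrite gt_eqF// ltr_wpDr.
have bl (l : mR) : nc (l%:C * rho lam l) <= lam * 2.
  rewrite lE addr0 Normc.normcM normc_real gtr0_norm//.
  apply: ler_wpM2l; first exact: ltW.
  apply: le_trans (normcD _ _) _; rewrite mulN1r normcN'.
  have := normc_rho l lam0; have : nc (ind0 l) <= 1 by exact: normc_indic.
  lra.
have lam2 : 0 <= lam * 2 by rewrite mulr_ge0// ltW.
apply: (graph_ucalc ler01 lam2 mr (fun l => normc_rho l lam0) bl cu).
have -> : (fun l : mR => l%:C * rho lam l) = (fun l : mR => lam%:C * (-1 * rho lam l + ind0 l) + 0).
  by apply/funext => l; exact: lE.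
by have := c2; congr ucalc; apply/funext => x; rewrite addr0 mulN1r addrC.
Qed.

(** With [u] the resolvent of [g], the vector [lam (g - u)] is the image of
    [u] under the operator. *)
Lemma resolvent_dissipative lam g u a (psi : R -> R) (L : R) : 0 < lam ->
  ucalc (rho lam) g u -> 0 <= L ->
  (forall x y, `|psi x - psi y| <= L * `|x - y|) -> {homo psi : x y / x <= y} ->
  psi 0 = 0 ->
  mu.-integrable setT (EFin \o (fun x => psi (Rez (a * u x)) * (Rez (a * g x) - Rez (a * u x)))) /\
  (0 <= \int[mu]_x (psi (Rez (a * u x)) * (Rez (a * g x) - Rez (a * u x))))%R.
Proof.
move=> lam0 cu L0 hL hpsi psi0.
have [i1 p1] := hdiss a (resolvent_graph lam0 cu) L0 hL hpsi psi0.
have eqx x : psi (Rez (a * u x)) * (Rez (a * g x) - Rez (a * u x)) =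
    lam^-1 * (psi (Rez (a * u x)) * Rez (a * (lam%:C * (g x - u x)))).
  rewrite !ReImE/=; field; exact: lt0r_neq0.
have -> : (fun x => psi (Rez (a * u x)) * (Rez (a * g x) - Rez (a * u x))) =
   (fun x => lam^-1 * (psi (Rez (a * u x)) * Rez (a * (lam%:C * (g x - u x))))).
  exact/funext.
split; first exact: (integrableZl measurableT lam^-1 i1).
by rewrite RintegralZl// mulr_ge0// invr_ge0 ltW.
Qed.

(** A maximum principle: testing the resolvent equation with the positive part
    of [Re (a u)] shows that the square of its norm is nonpositive. *)
Lemma resolvent_halfplane lam g u a : 0 < lam -> ucalc (rho lam) g u ->
  (forall x, Rez (a * g x) <= 0) -> {ae mu, forall x, Rez (a * u x) <= 0}.
Proof.
move=> lam0 cu ag; have [mg mu_] := ucalc_mem cu.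
pose psi (s : R) := Num.max s 0.
have psi1 x y : `|psi x - psi y| <= 1 * `|x - y|.
  rewrite mul1r /psi; case: (leP x 0) => x0; case: (leP y 0) => y0.
  - by rewrite subrr normr0.
  - by rewrite sub0r normrN gtr0_norm// ler0_norm; lra.
  - by rewrite subr0 gtr0_norm// ger0_norm; lra.
  - by [].
have hpsi : {homo psi : x y / x <= y}.
  by move=> x y xy; rewrite /psi ge_max !le_max xy lexx orbT.
have psi0 : psi 0 = 0 by rewrite /psi maxxx.
have [i1 p1] := resolvent_dissipative a lam0 cu ler01 psi1 hpsi psi0.
pose w x : R[i] := (psi (Rez (a * u x)))%:C.
have mau := cmeasurableZ a mu_.1.
have mpsi : measurable_fun setT (fun x => psi (Rez (a * u x))).
  by apply: measurable_maxr => //; exact: mau.1.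
have mw : L2 w.
  apply: (ae_le_memLp _ _ _ (memLpZ a (two_ge1 R) mu_)) => //.
    exact: cmeasurable_real.
  apply: aeW => x; rewrite /w normc_real ger0_norm ?le_max ?lexx ?orbT//.
  by rewrite /psi ge_max normc_ge0 andbT; exact: Re_le_normc.
have Nw : N w ^+ 2 <= 0.
  rewrite rnorm_sqr// -oppr_ge0 -mulN1r -RintegralZl//; last exact: memL2_sqr_integrable.
  apply: le_trans p1 _; apply: le_Rintegral => //.
    exact: (integrableZl measurableT (-1) (memL2_sqr_integrable mw)).
  move=> x _; rewrite /w normc_real real_normK ?num_real// /psi.
  case: (leP (Rez (a * u x)) 0) => h; first by rewrite mul0r expr0n mulr0.
  rewrite mulN1r expr2 -mulrN; apply: ler_wpM2l; first exact: ltW.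
  by have := ag x; lra.
have : ae_eqc mu w (fun=> 0).
  apply: (rnormB_eq0 (two_ge1 R) mw (memLp_cst0 _ _)) => //.
  by under eq_fun do rewrite subr0; move: Nw; rewrite real_exprn_even_le0 ?num_real//= => /eqP ->.
apply: filterS => x /complexI; rewrite /psi => h.
by rewrite leNgt; apply/negP => h0; move: h; rewrite max_l ?ltW// => h; rewrite h ltxx in h0.
Qed.

End resolvent.

(** * Resolvents are contractions of L^p *)

Section truncated_power.
Context {R : realType}.
Implicit Types (p q K x y s : R) (k : nat).

Lemma powR_le_pow K r x : 1 <= K -> K^-1 <= x <= K -> x `^ r <= K `^ `|r|.
Proof.
move=> K1 /andP[xK Kx]; have K0 : 0 < K by exact: lt_le_trans K1.
have x0 : 0 < x by apply: lt_le_trans xK; rewrite invr_gt0.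
have [r0|r0] := leP 0 r.
  by rewrite ger0_norm//; apply: ge0_ler_powR; rewrite ?nnegrE ?(ltW x0) ?(ltW K0).
rewrite ltr0_norm//.
have -> : x `^ r = (x^-1) `^ (- r).
  by rewrite -powR_inv1 ?(ltW x0)// -powRrM mulN1r opprK.
apply: ge0_ler_powR; rewrite ?nnegrE ?invr_ge0 ?(ltW x0) ?(ltW K0)//.
  by rewrite oppr_ge0 ltW.
by rewrite -(invrK K) lef_pV2// posrE ?invr_gt0.
Qed.

Lemma powR_Lipschitz q K x y : 1 <= K -> K^-1 <= x -> x <= y -> y <= K ->
  `|y `^ q - x `^ q| <= `|q| * K `^ `|q - 1| * (y - x).
Proof.
move=> K1 Kx xy yK; have K0 : 0 < K by exact: lt_le_trans K1.
have x0 : 0 < x by apply: lt_le_trans Kx; rewrite invr_gt0.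
have dr (z : R) : 0 < z -> is_derive z 1 (fun t => t `^ q) (q * z `^ (q - 1)).
  by move=> z0; exact: is_derive1_powR.
have [||c /[!in_itv]/= /andP[xc cy] ->] :=
    @MVT_segment R (fun t => t `^ q) (fun t => q * t `^ (q - 1)) x y xy.
- by move=> z; rewrite in_itv/= => /andP[xz _]; apply: dr; exact: lt_trans xz.
- apply: derivable_within_continuous => z; rewrite in_itv/= => /andP[xz _].
  by have [] := dr z (lt_le_trans x0 xz).
rewrite normrM (ger0_norm (_ : 0 <= y - x)) ?subr_ge0// ler_wpM2r ?subr_ge0//.
rewrite normrM ler_wpM2l// ger0_norm ?powR_ge0//; apply: powR_le_pow => //.
by rewrite (le_trans Kx xc) (le_trans cy yK).
Qed.

Definition clamp k s : R := Num.max k.+1%:R^-1 (Num.min s k.+1%:R).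

Lemma kinv_le k : (k.+1%:R^-1 : R) <= k.+1%:R.
Proof. by rewrite (@le_trans _ _ 1)// ?invf_le1// ler1n. Qed.

Lemma clamp_itv k s : k.+1%:R^-1 <= clamp k s <= k.+1%:R.
Proof. by rewrite /clamp le_max lexx ge_max kinv_le ge_min lexx orbT. Qed.

Lemma clamp_homo k : {homo clamp k : x y / x <= y}.
Proof.
move=> x y xy; rewrite /clamp ge_max le_max lexx/= le_max; apply/orP; right.
by rewrite le_min ge_min xy ge_min lexx orbT.
Qed.

Lemma clamp_Lipschitz k x y : x <= y -> clamp k y - clamp k x <= y - x.
Proof.
move=> xy.
have hmin (c : R) : 0 <= Num.min y c - Num.min x c <= y - x.
  by case: (leP x c) => h1; case: (leP y c) => h2; apply/andP; split; lra.
have hmax (c x' y' : R) : x' <= y' -> Num.max c y' - Num.max c x' <= y' - x'.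
  by move=> h; case: (leP c x') => h1; case: (leP c y') => h2; lra.
have /andP[h1 h2] := hmin k.+1%:R.
by apply: le_trans (hmax _ _ _ _) h2; rewrite -subr_ge0.
Qed.

(** The power [s ^ (p - 1)] is cut off near zero and near infinity so as to
    become Lipschitz, and is shifted so as to vanish at zero. *)
Definition tpow p k s : R := clamp k s `^ (p - 1) - k.+1%:R^-1 `^ (p - 1).

Variable p : R.
Hypothesis p1 : 1 < p.
Let p0 : 0 < p. Proof. exact: lt_trans p1. Qed.
Let q0 : 0 < p - 1. Proof. by rewrite subr_gt0. Qed.

Lemma tpow_homo k : {homo tpow p k : x y / x <= y}.
Proof.
move=> x y xy; rewrite lerD2r; apply: ge0_ler_powR; rewrite ?nnegrE ?(ltW q0)//.
- by have /andP[h _] := clamp_itv k x; apply: le_trans h; rewrite invr_ge0.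
- by have /andP[h _] := clamp_itv k y; apply: le_trans h; rewrite invr_ge0.
- exact: clamp_homo.
Qed.

Lemma tpow_Lipschitz k : exists2 L, 0 <= L &
  forall x y, `|tpow p k x - tpow p k y| <= L * `|x - y|.
Proof.
pose L : R := `|p - 1| * k.+1%:R `^ `|p - 1 - 1|.
have L0 : 0 <= L by rewrite mulr_ge0 ?powR_ge0.
exists L => //.
suff h x y : x <= y -> `|tpow p k x - tpow p k y| <= L * `|x - y|.
  move=> x y; have [xy|/ltW yx] := leP x y; first exact: h.
  by rewrite distrC (distrC x); exact: h.
move=> xy; rewrite distrC (distrC x) (ger0_norm (_ : 0 <= y - x)) ?subr_ge0//.
rewrite /tpow opprB addrA subrK.
have /andP[a1 _] := clamp_itv k x; have /andP[_ b1] := clamp_itv k y.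
apply: le_trans (powR_Lipschitz _ _ a1 (clamp_homo k xy) b1) _; first by rewrite ler1n.
by rewrite ler_wpM2l// clamp_Lipschitz.
Qed.

Lemma tpow_le0 k s : s <= 0 -> tpow p k s = 0.
Proof.
move=> s0; rewrite /tpow (_ : clamp k s = k.+1%:R^-1) ?subrr//.
rewrite /clamp max_l// ge_min; apply/orP; left.
by apply: le_trans s0 _; rewrite invr_ge0.
Qed.

Lemma tpow0 k : tpow p k 0 = 0. Proof. exact: tpow_le0. Qed.

Lemma tpow_ge0 k s : 0 <= tpow p k s.
Proof.
by rewrite -(@tpow_le0 k (Num.min s 0)) ?ge_min ?lexx ?orbT// tpow_homo// ge_min lexx.
Qed.

Lemma tpow_le k s : 0 <= s -> tpow p k s <= s `^ (p - 1).
Proof.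
move=> s0; have [h|h] := leP s k.+1%:R^-1.
  rewrite /tpow (_ : clamp k s = k.+1%:R^-1) ?subrr ?powR_ge0//.
  by rewrite /clamp max_l// ge_min h.
rewrite lerBlDr; apply: (@le_trans _ _ (s `^ (p - 1))); last by rewrite lerDl powR_ge0.
have /andP[c1 _] := clamp_itv k s.
apply: ge0_ler_powR; rewrite ?nnegrE ?(ltW q0)//.
- by apply: le_trans c1; rewrite invr_ge0.
- by rewrite /clamp ge_max (ltW h) ge_min lexx.
Qed.

(** Young's inequality with exponents [p] and [p / (p - 1)], where the power
    of [tpow p k s] with exponent [p / (p - 1)] is at most [tpow p k s *
    s]. *)
Lemma tpow_Young k s t : 0 <= t ->
  tpow p k s * (t - s) <= p^-1 * (t `^ p - tpow p k s * s).
Proof.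
move=> t0; have [s0|s0] := leP s 0.
  by rewrite tpow_le0// !mul0r subr0 mulr_ge0 ?invr_ge0 ?powR_ge0// ltW.
pose q := p / (p - 1).
have qq : q^-1 = 1 - p^-1 by rewrite /q; field; rewrite !gt_eqF.
have q00 : 0 < q by rewrite divr_gt0.
have Y := conjugate_powR (tpow_ge0 k s) t0 q00 p0 (_ : q^-1 + p^-1 = 1).
have {}Y : tpow p k s * t <= tpow p k s `^ q / q + t `^ p / p.
  by apply: Y; rewrite qq subrK.
have h : tpow p k s `^ q <= tpow p k s * s.
  have -> : q = 1 + (p - 1)^-1 by rewrite /q; field; rewrite gt_eqF.
  have [->|n0] := eqVneq (tpow p k s) 0.
    by rewrite powR0 ?mul0r// gt_eqF// addr_gt0// invr_gt0.
  rewrite powRD ?n0 ?implybT// powRr1 ?tpow_ge0// ler_wpM2l ?tpow_ge0//.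
  have hs := tpow_le k (ltW s0).
  have : tpow p k s `^ (p - 1)^-1 <= (s `^ (p - 1)) `^ (p - 1)^-1.
    by apply: ge0_ler_powR; rewrite ?nnegrE ?powR_ge0 ?tpow_ge0 ?invr_ge0 ?(ltW q0).
  by rewrite -powRrM mulfV ?gt_eqF// powRr1// ltW.
have h2 : tpow p k s `^ q / q <= (1 - p^-1) * (tpow p k s * s).
  rewrite qq mulrC; apply: ler_wpM2l => //.
  by rewrite subr_ge0 invf_le1// ltW.
move: Y h2; move: (tpow p k s `^ q / q) (tpow p k s) (t `^ p) => A B C; lra.
Qed.

Lemma tpow_cvg s : 0 <= s -> tpow p k s * s @[k --> \oo] --> s `^ p.
Proof.
rewrite le_eqVlt => /predU1P[<-|s0].
  rewrite powR0 ?gt_eqF//; apply: cvg_near_cst; apply: nearW => k; by rewrite mulr0.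
have inv0 : (k.+1%:R^-1 : R) @[k --> \oo] --> (0 : R).
  apply/gtr0_cvgV0; first exact: nearW.
  apply/cvgryPge => A; near=> k; apply: (@le_trans _ _ k%:R); last by rewrite ler_nat.
  by near: k; exact: nbhs_infty_ger.
have inv1 : (k.+1%:R^-1 : R) `^ (p - 1) @[k --> \oo] --> (0 : R).
  have := cvg_powR q0 (fun n => _ : 0 <= n.+1%:R^-1 :> R) inv0.
  by rewrite powR0 ?gt_eqF//; apply => n; rewrite invr_ge0.
have lim : (s `^ (p - 1) - k.+1%:R^-1 `^ (p - 1)) * s @[k --> \oo] --> s `^ p.
  rewrite -[X in _ --> X](mulr_powRB1 (ltW s0) p0) mulrC -[X in X * s]subr0.
  apply: cvgMl; apply: cvgB => //; exact: cvg_cst.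
apply: cvg_trans lim; apply: near_eq_cvg; near=> k.
suff -> : tpow p k s = s `^ (p - 1) - k.+1%:R^-1 `^ (p - 1) by [].
rewrite /tpow (_ : clamp k s = s)// /clamp min_l; last first.
  apply: (@le_trans _ _ k%:R); last by rewrite ler_nat.
  by near: k; exact: nbhs_infty_ger.
rewrite max_r// -[leRHS]invrK lef_pV2 ?posrE ?invr_gt0//.
apply: (@le_trans _ _ k%:R); last by rewrite ler_nat.
by near: k; exact: nbhs_infty_ger.
Unshelve. all: by end_near. Qed.

End truncated_power.

Section rational_directions.
Context {R : realType}.

Lemma rat_near (x e : R) : 0 < e -> exists r : rat, `|ratr r - x| <= e.
Proof.
move=> e0; have h : x < x + e by rewrite ltrDl.
have [r] := rat_in_itvoo h; rewrite in_itv/= => /andP[r1 r2].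
by exists r; rewrite ler_norml; apply/andP; split; lra.
Qed.

(** Countably many directions determine the modulus, so that bounds that hold
    almost everywhere in each direction hold almost everywhere
    simultaneously. *)
Lemma normc_le_directions (z : R[i]) (W : R) :
  (forall r1 r2 : rat, Rez ((ratr r1 +i* ratr r2) * z) <=
     nc (ratr r1 +i* ratr r2) * W) -> nc z <= W.
Proof.
move=> h.
have W0 : 0 <= W.
  have := h 1 0; have := h (-1) 0.
  rewrite !RezM /= !rmorphN !rmorph1 !rmorph0 !mul0r !subr0 expr0n/= !addr0 sqrrN expr1n sqrtr1; lra.
have [->|z0] := eqVneq (nc z) 0; first by [].
have D0 : 0 < nc z by rewrite lt_def z0 normc_ge0.
rewrite -(ler_pM2l D0) -expr2.
apply/ler_addgt0Pr => r r0.
pose e := r / (2 * (W + nc z + 1)).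
have S0 : 0 < 2 * (W + nc z + 1) by rewrite mulr_gt0// ltr_wpDl// addr_ge0// ltW.
have e0 : 0 < e by rewrite divr_gt0.
have er : 2 * e * (W + nc z) <= r.
  have -> : r = e * (2 * (W + nc z + 1)) by rewrite /e divfK// gt_eqF.
  rewrite -subr_ge0 (_ : _ - _ = 2 * e); last by ring.
  by rewrite mulr_ge0// ltW.
have [r1 h1] := rat_near (Rez z) e0; have [r2 h2] := rat_near (- Imz z) e0.
pose c : R[i] := ratr r1 +i* ratr r2.
have cz : nc (c - conjc z) <= 2 * e.
  apply: le_trans (normc_le_ReIm _) _; rewrite !ReImE/= in h1 h2 *.
  by move: h1 h2; rewrite opprK => ? ?; lra.
have nc_c : nc c <= nc z + 2 * e.
  rewrite -(normc_conjc z) -[c in leLHS](subrK (conjc z)).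
  by apply: le_trans (normcD _ _) _; rewrite addrC lerD2l.
have Re_cz : nc z ^+ 2 - 2 * e * nc z <= Rez (c * z).
  have -> : Rez (c * z) = Rez ((c - conjc z) * z) + nc z ^+ 2.
    by rewrite sqr_nc !ReImE; ring.
  have : `|Rez ((c - conjc z) * z)| <= 2 * e * nc z.
    by apply: le_trans (normr_Re_le _) _; rewrite Normc.normcM ler_wpM2r ?normc_ge0.
  by rewrite ler_norml => /andP[? _]; lra.
have := h r1 r2; rewrite -/c => hc.
have := ler_wpM2r W0 nc_c; nra.
Qed.

End rational_directions.

Section contraction.
Context {d : measure_display} {T : measurableType d} {R : realType}.
Variable mu : {measure set T -> \bar R}.
Variable E : set R -> (T -> R[i]) -> (T -> R[i]).
Variable G : (T -> R[i]) -> (T -> R[i]) -> Prop.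
Hypothesis hG : spectral_resolution mu G E.
Hypothesis hdiss : dissipative_graph mu G.
Let hE := hG.1.
Local Notation L2 := (memLp 2 mu).
Local Notation N := (rnorm mu 2).
Local Notation ucalc := (ucalc mu E).
Implicit Types (f g h u v w : T -> R[i]) (a : R[i]).

Let RezrM (r : R) (z : R[i]) : Rez (r%:C * z) = r * Rez z.
Proof. by rewrite RezM/= mul0r subr0. Qed.

Lemma ucalcZ_vec phi a f u : ucalc phi f u ->
  ucalc phi (fun x => a * f x) (fun x => a * u x).
Proof.
move=> cu; have c0 := ucalc_lin_vec hE (-1) cu cu; have c1 := ucalc_lin_vec hE a cu c0.
by have := c1; congr ucalc; apply/funext => x; rewrite mulN1r addNr addr0.
Qed.

(** In each direction [a] the function [a f - |a| |f|] has a nonpositive real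
    part, and [resolvent_halfplane] preserves it. *)
Lemma resolvent_domination lam f u w : 0 < lam -> ucalc (rho lam) f u ->
  ucalc (rho lam) (fun x => (nc (f x))%:C) w -> {ae mu, forall x, nc (u x) <= Rez (w x)}.
Proof.
move=> lam0 cu cw.
have dir (a : R[i]) : {ae mu, forall x, Rez (a * u x) <= nc a * Rez (w x)}.
  have cg := ucalc_lin_vec hE a cu (ucalcZ_vec (- (nc a)%:C) cw).
  have := resolvent_halfplane hG hdiss (a := 1) lam0 cg.
  have hg x : Rez (1 * (a * f x + - (nc a)%:C * (nc (f x))%:C)) <= 0.
    rewrite mul1r RezD mulNr RezN -rmorphM/= subr_le0 -Normc.normcM.
    exact: Re_le_normc.
  move=> /(_ hg); apply: filterS => x.
  by rewrite mul1r RezD mulNr RezN RezrM subr_le0.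
have : {ae mu, forall x, forall k : nat,
    if @choice.unpickle (rat * rat)%type k is Some (r1, r2) then
      Rez ((ratr r1 +i* ratr r2) * u x) <= nc (ratr r1 +i* ratr r2) * Rez (w x)
    else true}.
  apply: ae_foralln => k; case: choice.unpickle => [[r1 r2]|]; last exact: aeW.
  exact: dir.
apply: filterS => x hx; apply: normc_le_directions => r1 r2.
by have := hx (choice.pickle (r1, r2)); rewrite choice.pickleK.
Qed.

(** Testing the resolvent equation with [psi = tpow p k] gives a nonnegative
    integral of [psi (w) (h - w)]; Young's inequality turns this into a bound
    for the integral of [psi (w) w] by that of [h ^ p], uniform in [k], and
    Fatou's lemma applies as [k] grows. *)
Lemma resolvent_real_contraction lam p (h : T -> R) w : 0 < lam -> 1 < p ->
  (forall x, 0 <= h x) -> memLp p mu (fun x => (h x)%:C) ->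
  ucalc (rho lam) (fun x => (h x)%:C) w ->
  (cnorm p mu (fun x => (Num.max (Rez (w x)) 0)%:C)%R <= cnorm p mu (fun x => (h x)%:C))%E.
Proof.
move=> lam0 p1 h0 hp cw; have [h2 mw] := ucalc_mem cw.
have p0 : 0 < p by exact: lt_trans p1.
pose U x := Rez (1 * w x).
have UE x : U x = Rez (w x) by rewrite /U mul1r.
have mU : measurable_fun setT U by have := (cmeasurableZ 1 mw.1).1.
rewrite (rnormE hp).
(* The p-th power of [v k] is the integrand [psi (w) w] of the estimate. *)
pose v k x : R[i] := ((tpow p k (U x) * U x) `^ p^-1)%:C.
have tU k x : 0 <= tpow p k (U x) * U x.
  have [u0|u0] := leP (U x) 0; first by rewrite tpow_le0// mul0r.
  by rewrite mulr_ge0 ?(tpow_ge0 p1)// ltW.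
have mt k : measurable_fun setT (fun x => tpow p k (U x)).
  have [L L0 hL] := tpow_Lipschitz p k.
  apply: (@measurableT_comp _ _ _ _ _ _ (tpow p k) _ U) => //.
  exact: continuous_measurable_fun (Lipschitz_continuous L0 hL).
have mtU k : measurable_fun setT (fun x => tpow p k (U x) * U x) by exact: measurable_funM.
have mv k : cmeasurable (v k).
  apply: cmeasurable_real.
  by apply: (@measurableT_comp _ _ _ _ _ _ (@powR R ^~ p^-1) _ (fun x => tpow p k (U x) * U x)).
have hpp : mu.-integrable setT (EFin \o (fun x => h x `^ p)).
  apply/integrableP; split.
    apply/measurable_EFinP.
    by apply: (@measurableT_comp _ _ _ _ _ _ (@powR R ^~ p) _ h) => //; exact: hp.1.1.
  have := rnorm_powR p0 hp; under eq_integral do rewrite normc_real ger0_norm//.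
  by move=> e; under eq_integral do rewrite /comp gee0_abs ?lee_fin ?powR_ge0//; rewrite e ltry.
have Ihp : (\int[mu]_x (h x `^ p))%R = rnorm mu p (fun x => (h x)%:C) `^ p.
  have := rnorm_powR p0 hp; under eq_integral do rewrite normc_real ger0_norm//.
  by rewrite /Rintegral => ->.
have itU k : mu.-integrable setT (EFin \o (fun x => tpow p k (U x) * U x)).
  have [L L0 hL] := tpow_Lipschitz p k.
  apply: (@integrable_le_sqr _ _ _ _ _ (fun x => L%:C * w x) w) => //.
    exact: memLpZ.
  move=> x; rewrite normrM UE; apply: ler_pM => //; last exact: normr_Re_le.
  rewrite Normc.normcM normc_real (ger0_norm L0).
  have h1 := hL (Rez (w x)) 0; rewrite tpow0 !subr0 in h1.
  by apply: le_trans h1 _; rewrite ler_wpM2l// normr_Re_le.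
have bound k : (\int[mu]_x (tpow p k (U x) * U x))%R <= rnorm mu p (fun x => (h x)%:C) `^ p.
  have [L L0 hL] := tpow_Lipschitz p k.
  have [i1 p_1] := resolvent_dissipative hG hdiss 1 lam0 cw L0 hL (tpow_homo p1 k) (tpow0 p k).
  have iB : mu.-integrable setT (EFin \o (fun x => h x `^ p - tpow p k (U x) * U x)).
    exact: (integrableB measurableT hpp (itU k)).
  have le1 : (\int[mu]_x (tpow p k (Rez (1 * w x)) * (Rez (1 * (h x)%:C) - Rez (1 * w x))) <=
    \int[mu]_x (p^-1 * (h x `^ p - tpow p k (U x) * U x)))%R.
    apply: (le_Rintegral measurableT i1 (integrableZl measurableT p^-1 iB)).
    by move=> x _; rewrite -/(U x) [(1 * (h x)%:C)%R]mul1r; exact: tpow_Young p1 k (U x) _ (h0 x).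
  move: (le_trans p_1 le1); rewrite RintegralZl// pmulr_rge0 ?invr_gt0//.
  by rewrite RintegralB// subr_ge0 Ihp.
apply: (@cnorm_fatou _ _ _ mu p v) => //.
- exact: rnorm_ge0.
- apply: cmeasurable_real; apply: measurable_maxr => //; exact: mw.1.1.
- apply: aeW => x; split => /=; last exact: cvg_cst.
  have -> : Num.max (Rez (w x)) 0 = ((Num.max (U x) 0) `^ p) `^ p^-1.
    by rewrite UE -powRrM mulfV ?gt_eqF// powRr1// le_max lexx orbT.
  apply: cvg_powR; rewrite ?invr_gt0//.
  have [u0|u0] := leP (U x) 0.
    rewrite powR0 ?gt_eqF//; apply: cvg_near_cst; apply: nearW => k.
    by rewrite tpow_le0// mul0r.
  exact: tpow_cvg (ltW u0).
- apply: nearW => k; apply: cnorm_le_powR => //; first exact: rnorm_ge0.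
  have -> : (\int[mu]_x (nc (v k x) `^ p)%:E = \int[mu]_x (tpow p k (U x) * U x)%:E)%E.
    apply: eq_integral => x _; rewrite /v normc_real ger0_norm ?powR_ge0//.
    by rewrite -powRrM mulVf ?gt_eqF// powRr1.
  have fi := integrable_fin_num measurableT (itU k).
  by rewrite -(fineK fi) lee_fin; exact: bound.
Qed.

(** Domination by the resolvent of [|f|] reduces the claim to nonnegative
    functions. *)
Lemma resolvent_contraction lam p f u : 0 < lam -> 1 < p -> memLp p mu f ->
  ucalc (rho lam) f u -> (cnorm p mu u <= cnorm p mu f)%E.
Proof.
move=> lam0 p1 fp cu; have [mf mu_] := ucalc_mem cu.
have p0 : 0 < p by exact: lt_trans p1.
have mh := cmeasurable_normc mf.1.
have h2 : L2 (fun x => (nc (f x))%:C).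
  by apply: (ae_le_memLp _ mh _ mf) => //; apply: aeW => x; rewrite normc_real ger0_norm ?normc_ge0.
have hp : memLp p mu (fun x => (nc (f x))%:C).
  by apply: (ae_le_memLp p0 mh _ fp); apply: aeW => x; rewrite normc_real ger0_norm ?normc_ge0.
have [w cw] := ucalc_exists hE (measurable_rho lam0) (fun l => normc_rho l lam0) h2.
have [_ mw] := ucalc_mem cw.
apply: (@le_trans _ _ (cnorm p mu (fun x => (Num.max (Rez (w x)) 0)%:C)%R)).
  apply: ae_le_cnorm => //; first exact: mu_.1.
    by apply: cmeasurable_real; apply: measurable_maxr => //; exact: mw.1.1.
  apply: filterS (resolvent_domination lam0 cu cw) => x h.
  by rewrite normc_real ger0_norm ?le_max ?lexx ?orbT// h.
apply: le_trans (resolvent_real_contraction lam0 p1 (fun x => normc_ge0 _) hp cw) _.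
by apply: le_cnorm => //; [exact: mf.1|move=> x; rewrite normc_real ger0_norm ?normc_ge0].
Qed.

End contraction.

(** * The algebra of L^p multipliers *)

Section multiplier.
Context {d : measure_display} {T : measurableType d} {R : realType}.
Variable mu : {measure set T -> \bar R}.
Variable E : set R -> (T -> R[i]) -> (T -> R[i]).
Hypothesis hE : projection_valued_measure mu E.
Local Notation mR := (measurableTypeR R).
Local Notation ucalc := (ucalc mu E).
Variable p : R.
Hypothesis p1 : 1 <= p.
Let p0 : 0 < p. Proof. exact: lt_le_trans p1. Qed.
Implicit Types (f g h k : T -> R[i]) (a : R[i]) (phi psi : mR -> R[i]) (r s : R).

(** The bound [r] also controls the supremum of [phi]: with both conditions in
    one definition, pointwise limits of multipliers are automatically
    bounded. *)
Definition multiplier r phi := [/\ cmeasurable phi,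
  forall l, nc (phi l) <= r
  & forall f h, memLp 2 mu f -> memLp p mu f -> ucalc phi f h ->
      (cnorm p mu h <= r%:E * cnorm p mu f)%E].

Lemma multiplier_ge0 r phi : multiplier r phi -> 0 <= r.
Proof. by move=> [_ h _]; apply: le_trans (h point); exact: normc_ge0. Qed.

Lemma multiplier_lin a phi psi r s : multiplier r phi -> multiplier s psi ->
  multiplier (nc a * r + s) (fun l => a * phi l + psi l).
Proof.
move=> kphi kpsi; have r0 := multiplier_ge0 kphi; have s0 := multiplier_ge0 kpsi.
move: kphi kpsi => [mphi hB hphi] [mpsi hC hpsi]; split.
- exact: cmeasurable_lin.
- move=> l; apply: le_trans (normcD _ _) _.
  by rewrite Normc.normcM lerD ?ler_wpM2l ?normc_ge0.
move=> f h f2 fp ch.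
have [u cu] := ucalc_exists hE mphi hB f2; have [v cv] := ucalc_exists hE mpsi hC f2.
have cuv := ucalc_lin hE a cu cv.
have mlin := cmeasurable_lin a mphi mpsi.
have eq := ucalc_uniq hE mlin ch cuv (aeW mu (fun x => erefl (f x))).
have [_ mh] := ucalc_mem ch; have [_ mu_] := ucalc_mem cu; have [_ mv] := ucalc_mem cv.
rewrite (ae_eq_cnorm p0 mh.1 (cmeasurable_lin a mu_.1 mv.1) eq).
apply: le_trans (cnormD _ p1 (cmeasurableZ a mu_.1) mv.1) _.
have hu := hphi _ _ f2 fp cu; have hv := hpsi _ _ f2 fp cv.
rewrite cnormZ//; last exact: mu_.1.
rewrite EFinD EFinM ge0_muleDl ?lee_fin ?mulr_ge0 ?normc_ge0//.
by rewrite leeD// -muleA lee_wpmul2l// lee_fin normc_ge0.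
Qed.

Lemma multiplier_mul phi psi r s : multiplier r phi -> multiplier s psi ->
  multiplier (s * r) (fun l => psi l * phi l).
Proof.
move=> kphi kpsi; have r0 := multiplier_ge0 kphi; have s0 := multiplier_ge0 kpsi.
move: kphi kpsi => [mphi hB hphi] [mpsi hC hpsi].
have mM := cmeasurableM mpsi mphi.
split; first exact: mM.
- by move=> l; rewrite Normc.normcM ler_pM ?normc_ge0.
move=> f h f2 fp ch.
have [u cu] := ucalc_exists hE mphi hB f2; have [_ u2] := ucalc_mem cu.
have hu := hphi _ _ f2 fp cu.
have up : memLp p mu u.
  by split; [exact: u2.1|apply: le_lt_trans hu _; rewrite lte_mul_pinfty// fp.2].
have [v cv] := ucalc_exists hE mpsi hC u2; have [_ v2] := ucalc_mem cv.
have cuv := ucalc_mul hE r0 s0 hB hC cu cv.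
have eq := ucalc_uniq hE mM ch cuv (aeW mu (fun x => erefl (f x))).
have [_ mh] := ucalc_mem ch.
rewrite (ae_eq_cnorm p0 mh.1 v2.1 eq).
apply: le_trans (hpsi _ _ u2 up cv) _.
by rewrite EFinM -muleA lee_wpmul2l// lee_fin.
Qed.

(** Bounded pointwise convergence on the spectrum gives convergence in L^2 by
    [ucalc_cvg], and the L^p bound survives by [cnorm_le_cvg_norm]. *)
Lemma multiplier_cvg (phi_ : nat -> mR -> R[i]) phi r : (forall n, multiplier r (phi_ n)) ->
  (forall l, ccvg (phi_ ^~ l) (phi l)) -> multiplier r phi.
Proof.
move=> hphi phic; have r0 := multiplier_ge0 (hphi 0%N).
have hB n l : nc (phi_ n l) <= r by have [] := hphi n.
have mphi : cmeasurable phi.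
  split; [apply: (@measurable_fun_cvg _ _ _ _ (fun n l => Rez (phi_ n l)))
         |apply: (@measurable_fun_cvg _ _ _ _ (fun n l => Imz (phi_ n l)))].
  - by move=> n; have [[]] := hphi n.
  - by move=> l _; have [] := phic l.
  - by move=> n; have [[]] := hphi n.
  - by move=> l _; have [] := phic l.
have hBl l : nc (phi l) <= r.
  by apply: (cvgr_to_le (ccvg_normc (phic l))); exact: nearW.
split => //.
move=> f h f2 fp ch; have [_ mh] := ucalc_mem ch.
have /choice[h_ ch_] n : exists h_, ucalc (phi_ n) f h_.
  by have [mn _ _] := hphi n; exact: (ucalc_exists hE mn (hB n) f2).
have hn n := ucalc_mem (ch_ n).
have c2 := ucalc_cvg hE (fun n => let: And3 m _ _ := hphi n in m) mphi hB phic ch_ ch.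
rewrite (rnormE fp) -EFinM.
apply: (cnorm_le_cvg_norm p0 (two_ge1 R) _ _ mh.1 c2).
- by rewrite mulr_ge0 ?rnorm_ge0.
- by move=> n; exact: (hn n).2.1.
- by move=> n; rewrite EFinM -rnormE//; have [_ _] := hphi n; apply.
Qed.

Lemma multiplier_le phi r s : r <= s -> multiplier r phi -> multiplier s phi.
Proof.
move=> rs [mphi hB hphi]; split => //; first by move=> l; exact: le_trans rs.
move=> f h f2 fp ch; apply: le_trans (hphi _ _ f2 fp ch) _.
by rewrite lee_wpmul2r ?cnorm_ge0// lee_fin.
Qed.

Lemma multiplier0 : multiplier 0 (fun=> 0).
Proof.
split => //; first exact: cmeasurable_cst.
  by move=> l; rewrite Normc.normc0.
move=> f h f2 fp ch; rewrite mul0e.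
have m0 : cmeasurable (fun _ : mR => 0 : R[i]) by exact: cmeasurable_cst.
have [_ mh] := ucalc_mem ch.
have c0 := ucalc_lin hE (-1) ch ch.
have e0 : (fun l : mR => -1 * 0 + 0) = (fun=> 0 : R[i]) by apply/funext => l; rewrite mulr0 addr0.
rewrite e0 in c0.
have eq := ucalc_uniq hE m0 ch c0 (aeW mu (fun x => erefl (f x))).
have eq0 : ae_eqc mu h (fun=> 0).
  by apply: filterS eq => x; rewrite mulN1r addNr.
by rewrite (ae_eq_cnorm p0 mh.1 (cmeasurable_cst 0) eq0) cnorm0.
Qed.

Lemma multiplier_sum (I : Type) (F : I -> mR -> R[i]) (w : I -> R) (s : seq I) :
  (forall i, multiplier (w i) (F i)) ->
  multiplier (\sum_(i <- s) w i) (fun l => \sum_(i <- s) F i l).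
Proof.
move=> hF; elim: s => [|i s IH].
  rewrite big_nil (_ : (fun l => _) = fun=> 0); first exact: multiplier0.
  by apply/funext => l; rewrite big_nil.
rewrite big_cons (_ : (fun l => _) = fun l => 1 * F i l + \sum_(j <- s) F j l).
  by have := multiplier_lin 1 (hF i) IH; rewrite Normc.normc1 mul1r.
by apply/funext => l; rewrite big_cons mul1r.
Qed.

Lemma multiplierZ a phi r : multiplier r phi -> multiplier (nc a * r) (fun l => a * phi l).
Proof.
move=> hphi; have := multiplier_lin a hphi multiplier0; rewrite addr0.
by congr multiplier; apply/funext => l; rewrite addr0.
Qed.

End multiplier.

(** * The operators m (m^2 + A)^(-1/2) *)

Section sqrt_iteration.
Context {R : realType}.
Variables q z : R.

(** The iteration [w := (q z + w^2) / 2] converges to [1 - sqrt (1 - q z)]. It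
    is a polynomial in [z] with nonnegative coefficients, so for a contraction
    in place of [z] its norm is at most its value at [z = 1]. *)
Fixpoint sqrt_iter k : R :=
  if k is k'.+1 then 2^-1 * (q * z + sqrt_iter k' * sqrt_iter k') else 0.

(** The iteration [y := sqrt (1 - q) + w y], with [w] from [sqrt_iter],
    converges to [sqrt (1 - q) / sqrt (1 - q z)], and has nonnegative
    coefficients too. *)
Fixpoint rsqrt_iter k : R :=
  if k is k'.+1 then Num.sqrt (1 - q) + sqrt_iter k' * rsqrt_iter k' else 0.

Hypotheses (q0 : 0 < q) (q1 : q < 1) (z01 : 0 <= z <= 1).
Let c : R := Num.sqrt (1 - q).
Let s : R := Num.sqrt (1 - q * z).

Let qz : q * z <= q.
Proof. by rewrite ger_pMr//; case/andP: z01. Qed.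

Let qz0 : 0 <= q * z.
Proof. by case/andP: z01 => z0 _; rewrite mulr_ge0// ltW. Qed.

Let s2 : s ^+ 2 = 1 - q * z.
Proof. by rewrite sqr_sqrtr// subr_ge0 (le_trans qz)// ltW. Qed.

Let c_gt0 : 0 < c. Proof. by rewrite sqrtr_gt0 subr_gt0. Qed.

Let cs : c <= s. Proof. by rewrite ler_wsqrtr// lerD2l lerN2. Qed.

Let s1 : s <= 1.
Proof. by rewrite -[leRHS]sqrtr1 ler_wsqrtr// gerBl. Qed.

Let s_gt0 : 0 < s. Proof. exact: lt_le_trans cs. Qed.

Lemma sqrt_iter_bounds k : 0 <= sqrt_iter k <= 1 - s.
Proof.
elim: k => [|k /andP[IH0 IH1]] /=; first by rewrite lexx subr_ge0.
apply/andP; split.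
  by rewrite mulr_ge0 ?invr_ge0//; apply: addr_ge0 => //; exact: mulr_ge0.
have : sqrt_iter k * sqrt_iter k <= (1 - s) ^+ 2 by rewrite expr2 ler_pM.
have := s2; lra.
Qed.

(** The distance to the limit [1 - s] is multiplied by [(1 - s + w) / 2],
    which is at most [1 - c]. *)
Lemma sqrt_iter_dist k : 1 - s - sqrt_iter k <= (1 - c) ^+ k.
Proof.
elim: k => [|k IH] /=; first by rewrite subr0 expr0 gerBl ltW.
have /andP[w0 w1] := sqrt_iter_bounds k.
have -> : 1 - s - 2^-1 * (q * z + sqrt_iter k * sqrt_iter k) =
    (1 - s - sqrt_iter k) * (2^-1 * (1 - s + sqrt_iter k)).
  have -> : q * z = 1 - s ^+ 2 by rewrite s2; ring.
  by field.
rewrite exprSr; apply: ler_pM => //; first by rewrite subr_ge0.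
  by rewrite mulr_ge0 ?invr_ge0//; have := s1; lra.
have := cs; lra.
Qed.

Lemma rsqrt_iter_dist k : 0 <= c / s - rsqrt_iter k <= 2 / c * (1 - c / 2) ^+ k.
Proof.
have cs1 : 0 <= c / s <= 1.
  apply/andP; split; first exact: divr_ge0 (ltW c_gt0) (ltW s_gt0).
  by rewrite ler_pdivrMr// mul1r.
have /andP[cs0 csl] := cs1.
have c1 : c <= 1 := le_trans cs s1.
elim: k => [|k /andP[IH0 IH1]] /=.
  rewrite subr0 cs0 expr0 mulr1 (le_trans csl)// ler_pdivlMr// mul1r; lra.
have /andP[w0 w1] := sqrt_iter_bounds k; have hd := sqrt_iter_dist k.
have d0 : 0 <= 1 - s - sqrt_iter k by rewrite subr_ge0.
rewrite -/c; set w := sqrt_iter k in w0 w1 hd d0 *; set y := rsqrt_iter k in IH0 IH1 *.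
have -> : c / s - (c + w * y) = w * (c / s - y) + (1 - s - w) * (c / s).
  by field; rewrite gt_eqF.
apply/andP; split; first by apply: addr_ge0; exact: mulr_ge0.
have e1 : (1 - c) ^+ k <= (1 - c / 2) ^+ k.
  by have := c_gt0; move: c1 => ? ?; apply: lerXn2r; rewrite ?nnegrE; lra.
have e2 : (1 - s - w) * (c / s) <= (1 - c / 2) ^+ k.
  by apply: le_trans (le_trans hd e1); rewrite -[leRHS]mulr1 ler_wpM2l.
have e3 : w * (c / s - y) <= (1 - c) * (2 / c * (1 - c / 2) ^+ k).
  by apply: ler_pM => //; have := cs; lra.
rewrite exprSr; set u := (1 - c / 2) ^+ k in e2 e3 *.
(* The constant 2 / c is the one for which the recursion closes with ratio [1
   - c / 2]. *)
have -> : 2 / c * (u * (1 - c / 2)) = (1 - c) * (2 / c * u) + u.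
  by field; rewrite gt_eqF.
exact: lerD.
Qed.

Lemma rsqrt_iter_cvg : rsqrt_iter k @[k --> \oo] --> c / s.
Proof.
have c1 : c <= 1 := le_trans cs s1.
apply: (@squeeze_cvgr _ _ _ _ (fun k => c / s - 2 / c * (1 - c / 2) ^+ k) (fun=> c / s)).
- apply: nearW => k; have /andP[h1 h2] := rsqrt_iter_dist k; apply/andP; split; lra.
- rewrite -[X in _ --> X]subr0; apply: cvgB; first exact: cvg_cst.
  rewrite -[X in _ --> X](mulr0 (2 / c)); apply: cvgMr; apply: cvg_expr.
  by rewrite ger0_norm; have := c_gt0; lra.
- exact: cvg_cst.
Qed.

End sqrt_iteration.

Section square_root.
Context {d : measure_display} {T : measurableType d} {R : realType}.
Variable mu : {measure set T -> \bar R}.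
Variable E : set R -> (T -> R[i]) -> (T -> R[i]).
Variable G : (T -> R[i]) -> (T -> R[i]) -> Prop.
Hypothesis hG : spectral_resolution mu G E.
Hypothesis hdiss : dissipative_graph mu G.
Let hE := hG.1.
Local Notation mR := (measurableTypeR R).
Variable p : R.
Hypothesis p1 : 1 < p.
Let p1' := ltW p1.
Local Notation multiplier := (multiplier mu E p).

Lemma multiplier_ind0 : multiplier 1 (@ind0 R).
Proof.
split => //; first exact: measurable_ind0.
  by move=> l; exact: normc_indic.
move=> f h f2 fp ch; rewrite mul1e.
have eq := ucalc_uniq hE (@measurable_ind0 R) ch (ucalc_ind0 hG hdiss f2) (aeW mu (fun x => erefl (f x))).
have [_ mh] := ucalc_mem ch.
by rewrite (ae_eq_cnorm (lt_trans ltr01 p1) mh.1 f2.1 eq).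
Qed.

Lemma multiplier_rho lam : 0 < lam -> multiplier 1 (@rho R lam).
Proof.
move=> lam0; split => //; first exact: measurable_rho.
  by move=> l; exact: normc_rho.
by move=> f h f2 fp ch; rewrite mul1e; exact: (resolvent_contraction hG hdiss lam0 p1 fp ch).
Qed.

Definition rhor (lam l : R) := if 0 <= l then lam / (lam + l) else 0.

(** With [c = sqrt (1 - q)] the bounds are consistent: [(q + (1 - c)^2) / 2 =
    1 - c]. *)
Lemma multiplier_sqrt_iter lam q k : 0 < lam -> 0 < q -> q < 1 ->
  multiplier (1 - Num.sqrt (1 - q)) (fun l : mR => (sqrt_iter q (rhor lam l) k)%:C).
Proof.
move=> lam0 q0 q1; set c := Num.sqrt (1 - q).
have c2 : c ^+ 2 = 1 - q by rewrite sqr_sqrtr// subr_ge0 ltW.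
have c1 : c <= 1 by rewrite -[leRHS]sqrtr1 ler_wsqrtr// gerBl ltW.
elim: k => [|k IH] /=.
  by apply: multiplier_le (multiplier0 hE p1'); rewrite subr_ge0.
have h1 := multiplier_mul hE p1' IH IH.
have h2 := multiplier_lin hE p1' (2^-1 * q)%:C (multiplier_rho lam0) (multiplierZ hE p1' (2^-1)%:C h1).
move: h2; rewrite !normc_real !ger0_norm ?mulr_ge0 ?invr_ge0 ?(ltW q0)//.
rewrite (_ : 2^-1 * q * 1 + _ = 1 - c); last first.
  by have -> : q = 1 - c ^+ 2 by [rewrite c2; ring]; field.
congr multiplier; apply/funext => l; rewrite -!rmorphM/=.
rewrite (_ : rho lam l = (rhor lam l)%:C); last by rewrite /rho /rhor; case: ifP.
by rewrite -!rmorphM -rmorphD/=; congr (_%:C); ring.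
Qed.

(** The bounds add up to [c + (1 - c) * 1 = 1]. *)
Lemma multiplier_rsqrt_iter lam q k : 0 < lam -> 0 < q -> q < 1 ->
  multiplier 1 (fun l : mR => ind0 l * (rsqrt_iter q (rhor lam l) k)%:C).
Proof.
move=> lam0 q0 q1; elim: k => [|k IH] /=.
  rewrite (_ : (fun l => _) = fun=> 0); first exact: multiplier_le (multiplier0 hE p1').
  by apply/funext => l; rewrite mulr0.
set c := Num.sqrt (1 - q).
have h1 := multiplier_mul hE p1' IH (multiplier_sqrt_iter k lam0 q0 q1).
have := multiplier_lin hE p1' c%:C multiplier_ind0 h1.
rewrite normc_real ger0_norm ?sqrtr_ge0// !mulr1 subrKC.
congr multiplier; apply/funext => l; rewrite rmorphD rmorphM/=; ring.
Qed.

(** The symbol of the operator [m (m^2 + A)^(-1/2)]. *)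
Definition poisson_symbol (m : R) (l : mR) : R[i] :=
  ind0 l * (m / Num.sqrt (m ^+ 2 + l))%:C.

(** For [z] the resolvent [lam / (lam + l)] and [q = lam / (m^2 + lam)], the
    quotient of [1 - q] by [1 - q z] is [m^2 / (m^2 + lam l / (lam + l))], and
    the iterates of [rsqrt_iter] have multiplier norm at most 1. *)
Lemma multiplier_resolvent_sqrt m lam : 0 < m -> 0 < lam ->
  multiplier 1 (fun l : mR => ind0 l * (Num.sqrt (m ^+ 2 / (m ^+ 2 + lam * l / (lam + l))))%:C).
Proof.
move=> m0 lam0; have m2 : 0 < m ^+ 2 by rewrite exprn_gt0.
pose q := lam / (m ^+ 2 + lam).
have ml : 0 < m ^+ 2 + lam by rewrite addr_gt0.
have q0 : 0 < q by rewrite divr_gt0.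
have q1 : q < 1 by rewrite ltr_pdivrMr// mul1r ltrDr.
have z01 (l : R) : 0 <= rhor lam l <= 1.
  by rewrite /rhor; case: ifPn => l0; [exact: rho01|rewrite lexx ler01].
apply: (multiplier_cvg hE p1' (fun k => multiplier_rsqrt_iter k lam0 q0 q1)) => l.
have [l0|l0] := leP 0 (l : R); last first.
  rewrite ind0E (lt_geF l0) mul0r.
  by under eq_fun do rewrite mul0r; exact: ccvg_cst.
rewrite ind0E l0.
suff : rsqrt_iter q (rhor lam l) k @[k --> \oo] --> Num.sqrt (m ^+ 2 / (m ^+ 2 + lam * l / (lam + l))).
  move=> h; rewrite mul1r; under eq_fun do rewrite mul1r.
  by split => /=; [exact: h|exact: cvg_cst].
have := rsqrt_iter_cvg q0 q1 (z01 l).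
have ll : 0 < lam + l by rewrite ltr_wpDr.
have pos : 0 < m ^+ 2 * (lam + l) + lam * l.
  by rewrite ltr_wpDr ?mulr_gt0// mulr_ge0// ltW.
have -> // : Num.sqrt (1 - q) / Num.sqrt (1 - q * rhor lam l) =
   Num.sqrt (m ^+ 2 / (m ^+ 2 + lam * l / (lam + l))).
rewrite -sqrtrV; last first.
  rewrite subr_ge0 mulr_ile1 ?(ltW q0) ?(ltW q1)//; by case/andP: (z01 l).
rewrite -sqrtrM ?subr_ge0 ?(ltW q1)//; congr Num.sqrt; rewrite /q /rhor l0.
have e1 : 1 - lam / (m ^+ 2 + lam) * (lam / (lam + l)) =
   (m ^+ 2 * (lam + l) + lam * l) / ((m ^+ 2 + lam) * (lam + l)).
  by field; rewrite !gt_eqF.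
have e2 : m ^+ 2 + lam * l / (lam + l) = (m ^+ 2 * (lam + l) + lam * l) / (lam + l).
  by field; rewrite gt_eqF.
by rewrite e1 e2; field; rewrite !gt_eqF.
Qed.

(** As [lam] grows, the Yosida approximation [lam l / (lam + l)] tends to
    [l]. *)
Lemma multiplier_poisson m : 0 <= m -> multiplier 1 (poisson_symbol m).
Proof.
rewrite le_eqVlt => /predU1P[<-|m0].
  rewrite (_ : poisson_symbol 0 = fun=> 0); first exact: multiplier_le (multiplier0 hE p1').
  by apply/funext => l; rewrite /poisson_symbol mul0r mulr0.
have m2 : 0 < m ^+ 2 by rewrite exprn_gt0.
have k0 k : 0 < (k.+1%:R : R) by [].
apply: (multiplier_cvg hE p1' (fun k => multiplier_resolvent_sqrt m0 (k0 k))) => l.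
rewrite /poisson_symbol.
have [l0|l0] := leP 0 (l : R); last first.
  rewrite ind0E (lt_geF l0) mul0r.
  by under eq_fun do rewrite mul0r; exact: ccvg_cst.
rewrite ind0E l0.
suff : Num.sqrt (m ^+ 2 / (m ^+ 2 + k.+1%:R * l / (k.+1%:R + l))) @[k --> \oo] -->
    m / Num.sqrt (m ^+ 2 + l).
  move=> h; rewrite mul1r; under eq_fun do rewrite mul1r.
  by split => /=; [exact: h|exact: cvg_cst].
have ml : 0 < m ^+ 2 + l by rewrite ltr_wpDr.
have -> : m / Num.sqrt (m ^+ 2 + l) = Num.sqrt (m ^+ 2 / (m ^+ 2 + l)).
  by rewrite sqrtrM ?ltW// sqrtrV ?ltW// sqrtr_sqr gtr0_norm.
apply: continuous_cvg; first exact: sqrt_continuous.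
apply: cvgMr; apply: cvgV; first by rewrite gt_eqF.
apply: cvgD; first exact: cvg_cst.
have hE2 (k : nat) : k.+1%:R * l / (k.+1%:R + l) = l - l ^+ 2 * (k.+1%:R + l)^-1.
  by field; rewrite gt_eqF// ltr_wpDr.
under eq_cvg do rewrite hE2.
suff : (l - l ^+ 2 * (k.+1%:R + l)^-1) @[k --> \oo] --> (l - 0) by rewrite subr0.
apply: cvgB; first exact: cvg_cst.
apply: (@squeeze_cvgr _ _ _ _ (fun=> 0) (fun k => l ^+ 2 * k.+1%:R^-1)).
- apply: nearW => k; have kl : 0 < k.+1%:R + l by rewrite ltr_wpDr.
  rewrite mulr_ge0 ?sqr_ge0 ?invr_ge0 ?(ltW kl)//= ler_wpM2l ?sqr_ge0//.
  by rewrite lef_pV2 ?posrE// lerDl.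
- exact: cvg_cst.
- by rewrite -[X in _ --> X](mulr0 (l ^+ 2)); apply: cvgMr; exact: cvg_harmonic.
Qed.

End square_root.

(** * Integrals with respect to complex measures *)

Section charge_integral.
Context {d : measure_display} {T : measurableType d} {R : realType}.
Implicit Types (nu : {charge set T -> \bar R}) (D : set T).

Lemma sum_level_sets (f : R -> R) (g : T -> R) (s : seq R) x : uniq s -> g x \in s ->
  f (g x) = \sum_(y <- s) f y * \1_(g @^-1` [set y]) x.
Proof.
move=> us gs; rewrite (bigD1_seq (g x))//= indicE mem_set//= mulr1 big1 ?addr0// => y yg.
by rewrite indicE memNset ?mulr0// => /= e; rewrite e eqxx in yg.
Qed.

Lemma Rintegral_simple (m : {finite_measure set T -> \bar R}) D (g : T -> R) (f : R -> R)
    (s : seq R) : measurable D -> measurable_fun setT g -> uniq s -> (forall x, g x \in s) ->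
  (\int[m]_(x in D) f (g x))%R = \sum_(y <- s) f y * fine (m (D `&` g @^-1` [set y])).
Proof.
move=> mD mg us gs; under eq_Rintegral do rewrite (sum_level_sets f us (gs _)).
have mA y : measurable (g @^-1` [set y]).
  by rewrite -[X in measurable X]setTI; apply: mg => //; exact: measurable_set1.
have iA y : m.-integrable D (EFin \o (fun x => \1_(g @^-1` [set y]) x : R)).
  by apply: (integrableS measurableT) => //; exact: integrable_indic.
have iZ y : m.-integrable D (EFin \o (fun x => f y * \1_(g @^-1` [set y]) x)).
  exact: (integrableZl mD (f y) (iA y)).
elim: s {us gs} => [|y s IH].
  under eq_Rintegral do rewrite big_nil; rewrite big_nil.
  by rewrite /Rintegral integral0.
rewrite big_cons -IH; under eq_Rintegral do rewrite big_cons.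
rewrite RintegralD//; last first.
  have := @integrable_sum _ _ _ m D mD _ s xpredT (fun y x => (f y * \1_(g @^-1` [set y]) x)%:E) (fun y _ => iZ y).
  by congr (m.-integrable D _); apply/funext => x /=; rewrite sumEFin.
by rewrite RintegralZl//; congr (_ * _ + _); rewrite /Rintegral integral_indic// setIC.
Qed.

Lemma Rintegral_bounded_cvg (m : {finite_measure set T -> \bar R}) D (h : nat -> T -> R) (k : T -> R) (B : R) :
  measurable D -> (forall n, measurable_fun D (h n)) ->
  (forall n x, D x -> `|h n x| <= B) -> (forall x, D x -> h n x @[n --> \oo] --> k x) ->
  (\int[m]_(x in D) h n x)%R @[n --> \oo] --> (\int[m]_(x in D) k x)%R.
Proof.
move=> mD mh hB hk.
have mh' n : measurable_fun D (EFin \o h n) by exact/measurable_EFinP.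
have hk' x : D x -> (EFin \o h n) x @[n --> \oo] --> (EFin \o k) x.
  by move=> Dx; apply: cvg_EFin; [exact: nearW|exact: hk].
have iB := finite_measure_integrable_cst m B mD.
have hB' n x : D x -> (`|(EFin \o h n) x| <= (EFin \o cst B) x)%E.
  by move=> Dx; rewrite /= lee_fin hB.
have mk : measurable_fun D (EFin \o k).
  by apply/measurable_EFinP; exact: (measurable_fun_cvg mh hk).
have [ik _] := dominated_convergence mD mh' mk
  (aeW m hk') iB (aeW m (fun x n Dx => hB' n x Dx)).
by rewrite -(fineK (integrable_fin_num mD ik)) => /fine_cvg.
Qed.

(** This names the Hahn decomposition that is chosen inside
    [charge_integral]. *)
Lemma charge_integralE nu D : exists P Q (hN : hahn_decomposition nu P Q), forall f,
  charge_integral nu D f =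
  (\int[jordan_pos hN]_(x in D) f x - \int[jordan_neg hN]_(x in D) f x)%R.
Proof. by exists _, _, (svalP (cid (svalP (cid (Hahn_decomposition nu))))). Qed.

Lemma charge_integral_simple nu D (g : T -> R) (f : R -> R) (s : seq R) :
  measurable D -> measurable_fun setT g -> uniq s -> (forall x, g x \in s) ->
  charge_integral nu D (f \o g) = \sum_(y <- s) f y * fine (nu (D `&` g @^-1` [set y])).
Proof.
move=> mD mg us gs; have [P [Q [hN E]]] := charge_integralE nu D; rewrite E.
rewrite (Rintegral_simple (jordan_pos hN) f mD mg us gs).
rewrite (Rintegral_simple (jordan_neg hN) f mD mg us gs) -sumrB.
apply: eq_bigr => y _; rewrite -mulrBr; congr (_ * _).
have mA : measurable (D `&` g @^-1` [set y]).
  apply: measurableI => //; rewrite -[X in measurable X]setTI.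
  by apply: mg => //; exact: measurable_set1.
rewrite (jordan_decomp hN mA) /cadd/= cscaleN1 fineB//; exact: fin_num_measure.
Qed.

Lemma charge_integral_cvg nu D (h : nat -> T -> R) (k : T -> R) (B : R) :
  measurable D -> (forall n, measurable_fun D (h n)) ->
  (forall n x, D x -> `|h n x| <= B) -> (forall x, D x -> h n x @[n --> \oo] --> k x) ->
  charge_integral nu D (h n) @[n --> \oo] --> charge_integral nu D k.
Proof.
move=> mD mh hB hk; have [P [Q [hN E]]] := charge_integralE nu D; rewrite E.
by under eq_cvg do rewrite E; apply: cvgB; apply: (Rintegral_bounded_cvg (B := B)).
Qed.

Variable alpha : complex_measure T R.

(** A finite partition, completed by empty sets, is one of the countable
    partitions of the supremum. *)
Lemma cm_variation_sum D (A : R -> set T) (s : seq R) : uniq s ->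
  (forall y, measurable (A y)) -> trivIset setT A ->
  (forall x, D x <-> exists2 y, y \in s & A y x) ->
  ((\sum_(y <- s) nc (cm_val alpha (A y)))%:E <= cm_variation alpha D)%E.
Proof.
move=> us mA tA DA.
pose F k := if (k < size s)%N then A (nth 0 s k) else set0.
have F0 : nc (cm_val alpha set0) = 0 by rewrite /cm_val !charge0 Normc.normc0.
apply: (@le_trans _ _ (\sum_(0 <= k <oo) (nc (cm_val alpha (F k)))%:E)%E).
  apply: le_trans (nneseries_lim_ge (size s) _); last first.
    by move=> k _; rewrite lee_fin normc_ge0.
  rewrite (big_nth 0) -sumEFin !big_nat lee_sum// => k /andP[_ ks].
  by rewrite /F ks.
apply: ereal_sup_ubound; exists F; split => //.
- by move=> k; rewrite /F; case: ifP.
- apply/trivIsetP => i j _ _ ij; rewrite /F; case: ifPn => hi; last by rewrite set0I.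
  case: ifPn => hj; last by rewrite setI0.
  by move/trivIsetP : tA; apply => //; rewrite nth_uniq.
- apply/seteqP; split => x.
    move=> [k _]; rewrite /F; case: ifPn => // ks Ax; apply/DA.
    by exists (nth 0 s k); first exact: mem_nth.
  move=> /DA[y ys Ax]; exists (index y s) => //.
  by rewrite /F index_mem ys nth_index.
Qed.

Lemma cm_variation_ge0 D : measurable D -> (0 <= cm_variation alpha D)%E.
Proof.
move=> mD; pose F k : set T := if k is 0%N then D else set0.
apply: (@le_trans _ _ (\sum_(0 <= k <oo) (nc (cm_val alpha (F k)))%:E)%E).
  by apply: nneseries_ge0 => k _ _; rewrite lee_fin normc_ge0.
apply: ereal_sup_ubound; exists F; split => //.
- by move=> [|k]; [exact: mD|exact: measurable0].
- by apply/trivIsetP => -[|i] [|j] _ _ ij //=; rewrite ?setI0 ?set0I.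
- by apply/seteqP; split => [x [[|k] _ //]|x Dx]; exists 0%N.
Qed.

(** The variation is dominated by the sum of the total variations of the real
    and imaginary parts, which the Hahn decompositions show to be finite. *)
Lemma cm_variation_lty D : measurable D -> (cm_variation alpha D < +oo)%E.
Proof.
move=> mD.
pose hr := svalP (cid (svalP (cid (Hahn_decomposition (cm_re alpha))))).
pose hi := svalP (cid (svalP (cid (Hahn_decomposition (cm_im alpha))))).
pose tr := charge_variation hr; pose ti := charge_variation hi.
have fin nu (P Q : set T) (h : hahn_decomposition nu P Q) A : measurable A ->
    (`|fine (nu A)|%:E <= charge_variation h A)%E.
  move=> mA; have fA : nu A \is a fin_num by exact: fin_num_measure.
  by apply: le_trans (abse_charge_variation h mA); rewrite -{2}(fineK fA).
have tfin : (tr D + ti D < +oo)%E.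
  by rewrite lte_add_pinfty// ltey_eq fin_num_measure.
apply: le_lt_trans tfin; apply: ge_ereal_sup => _ [F [mF tF <- ->]].
have -> : tr (\bigcup_k F k) = (\sum_(0 <= k <oo) tr (F k))%E.
  by apply/esym/cvg_lim => //; exact: measure_sigma_additive.
have -> : ti (\bigcup_k F k) = (\sum_(0 <= k <oo) ti (F k))%E.
  by apply/esym/cvg_lim => //; exact: measure_sigma_additive.
rewrite -nneseriesD//.
apply: lee_nneseries => [k _|k _]; first by rewrite lee_fin normc_ge0.
apply: le_trans (leeD (fin _ _ _ hr _ (mF k)) (fin _ _ _ hi _ (mF k))).
by rewrite -EFinD lee_fin; exact: normc_le_ReIm.
Qed.

End charge_integral.

(** * Superposition over the half-line *)

Section half_line_approx.
Context {R : realType}.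
Local Notation mR := (measurableTypeR R).
Import HBNNSimple.

(** Finite-valued measurable approximations of the identity of the half-line
    that are exact at 0, where m / sqrt (m^2 + l) may be discontinuous in m. *)
Lemma half_line_approx : exists (g : nat -> mR -> R) (s : nat -> seq R),
  [/\ forall k, measurable_fun setT (g k),
      forall k, uniq (s k) /\ forall x, g k x \in s k,
      forall k y, y \in s k -> 0 <= y,
      forall k, g k 0 = 0
    & forall x : R, 0 <= x -> g k x @[k --> \oo] --> x].
Proof.
have mD : measurable (@half_line R : set mR) by exact: measurable_itv.
have mf : measurable_fun (@half_line R : set mR) (fun x : mR => x%:E) by exact/measurable_EFinP.
have f0 (x : mR) : @half_line R x -> (0 <= x%:E)%E.
  by rewrite /half_line/= in_itv/= andbT lee_fin.
have DE (x : R) : 0 <= x -> @half_line R x by move=> x0; rewrite /half_line/= in_itv/= x0.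
pose g := nnsfun_approx mD mf.
exists (fun k => g k), (fun k => enum_fset (fset_set (range (g k)))); split.
- by move=> k; exact: measurable_funPT.
- move=> k; split; first exact: fset_uniq.
  move=> x; have : g k x \in fset_set (range (g k)) by rewrite (in_fset_set (fimfunP (g k))) mem_set.
  exact.
- move=> k y ys; have : y \in range (g k) by rewrite -(in_fset_set (fimfunP (g k))); exact: ys.
  by move=> /set_mem[x _ <-]; exact: fun_ge0.
- move=> k; apply/eqP; rewrite eq_le fun_ge0 andbT.
  have := le_approx k f0 (DE 0 (lexx 0)); rewrite -(nnsfun_approxE mD mf k) lee_fin; exact.
- move=> x x0; have := cvg_nnsfun_approx mD mf f0 (DE x x0).
  exact: fine_cvg.
Qed.

End half_line_approx.

Section symbol.
Context {d : measure_display} {T : measurableType d} {R : realType}.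
Variable mu : {measure set T -> \bar R}.
Variable E : set R -> (T -> R[i]) -> (T -> R[i]).
Variable G : (T -> R[i]) -> (T -> R[i]) -> Prop.
Hypothesis hG : spectral_resolution mu G E.
Hypothesis hdiss : dissipative_graph mu G.
Let hE := hG.1.
Local Notation mR := (measurableTypeR R).
Variable p : R.
Hypothesis p1 : 1 < p.
Let p1' := ltW p1.
Local Notation multiplier := (multiplier mu E p).
Variable alpha : complex_measure mR R.
Local Notation D := (@half_line R : set mR).

Let mD : measurable D. Proof. exact: measurable_itv. Qed.

Definition half_line_kernel (l m : R) := 1 - m / Num.sqrt (m ^+ 2 + l).

Lemma half_line_kernel01 (l m : R) : 0 <= l -> 0 <= m -> `|half_line_kernel l m| <= 1.
Proof.
move=> l0 m0; rewrite /half_line_kernel.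
have h1 : m / Num.sqrt (m ^+ 2 + l) <= 1.
  have [->|mn0] := eqVneq m 0; first by rewrite mul0r ler01.
  have m2 : 0 < m ^+ 2 + l by rewrite ltr_wpDr// exprn_gt0// lt_def mn0.
  rewrite ler_pdivrMr ?sqrtr_gt0// mul1r -{1}(ger0_norm m0) -sqrtr_sqr ler_wsqrtr//.
  by rewrite lerDl.
have h0 : 0 <= m / Num.sqrt (m ^+ 2 + l) by rewrite divr_ge0// sqrtr_ge0.
by rewrite ger0_norm; lra.
Qed.

(** At [m = 0] the kernel may be discontinuous, hence the condition that the
    approximating sequence be stationary there. *)
Lemma half_line_kernel_cvg (l : R) (u : nat -> R) (m : R) : 0 <= l -> 0 <= m ->
  (m = 0 -> forall k, u k = 0) -> u k @[k --> \oo] --> m ->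
  half_line_kernel l (u k) @[k --> \oo] --> half_line_kernel l m.
Proof.
move=> l0 m0 hu um; have [m00|mn0] := eqVneq m 0.
  by under eq_cvg do rewrite hu// -[X in half_line_kernel l X]m00; exact: cvg_cst.
have m2 : 0 < m ^+ 2 + l by rewrite ltr_wpDr// exprn_gt0// lt_def mn0.
apply: cvgB; first exact: cvg_cst.
apply: cvgM => //; apply: cvgV; first by rewrite gt_eqF// sqrtr_gt0.
apply: continuous_cvg; first exact: sqrt_continuous.
apply: cvgD; last exact: cvg_cst.
by under eq_cvg do rewrite expr2; rewrite expr2; exact: cvgM.
Qed.

Lemma multiplier_half_line_kernel (m : R) : 0 <= m ->
  multiplier 2 (fun l : mR => ind0 l * (half_line_kernel l m)%:C).
Proof.
move=> m0; have := multiplier_lin hE p1' (-1) (multiplier_poisson hG hdiss p1 m0) (multiplier_ind0 hG hdiss p1).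
rewrite normcN' Normc.normc1 mulr1; congr multiplier.
apply/funext => l; rewrite /poisson_symbol /half_line_kernel rmorphB rmorph1; ring.
Qed.

(** Replacing [m] by a simple function turns the integral into a finite sum of
    kernels, of multiplier bound 2 each, with coefficients the values of
    [alpha] on the level sets; the moduli of these coefficients add up to at
    most the total variation. The sums converge boundedly and pointwise by
    dominated convergence. *)
Lemma multiplier_half_line_integral (Phi : R -> R[i]) :
  (forall x : R, 0 <= x -> Phi x = cm_integral alpha D (half_line_kernel x)) ->
  multiplier (2 * fine (cm_variation alpha D)) (fun l : mR => if 0 <= l then Phi l else 0).
Proof.
move=> hPhi; have [g [s [mg us s0 g0 gx]]] := @half_line_approx R.
pose A k (y : R) : set mR := D `&` g k @^-1` [set y].
have mA k y : measurable (A k y).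
  apply: measurableI => //; rewrite -[X in measurable X]setTI.
  by apply: mg => //; exact: measurable_set1.
have tA k : trivIset setT (A k).
  by move=> i j _ _ [x [[_ <-] [_ <-]]].
have DA k x : D x <-> exists2 y, y \in s k & A k y x.
  by split=> [Dx|[y _ []]//]; exists (g k x) => //; exact: (us k).2.
have V0 := cm_variation_ge0 alpha mD; have Voo := cm_variation_lty alpha mD.
have hV k : \sum_(y <- s k) nc (cm_val alpha (A k y)) <= fine (cm_variation alpha D).
  rewrite -lee_fin fineK ?ge0_fin_numE//.
  exact: cm_variation_sum (us k).1 (mA k) (tA k) (DA k).
(* The absolute value leaves the nodes [y], values of [g k], unchanged. *)
pose F k (y : R) (l : mR) : R[i] := cm_val alpha (A k y) * (ind0 l * (half_line_kernel l `|y|)%:C).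
have mF k y : multiplier (nc (cm_val alpha (A k y)) * 2) (F k y).
  by apply: multiplierZ => //; apply: multiplier_half_line_kernel.
apply: (multiplier_cvg hE p1' (phi_ := fun k l => \sum_(y <- s k) F k y l)).
  move=> k; apply: (multiplier_le _ (multiplier_sum hE p1' (s k) (mF k))).
  by rewrite -mulr_suml mulrC ler_wpM2l.
move=> l; have [l0|l0] := leP 0 (l : R); last first.
  have -> : (fun k => \sum_(y <- s k) F k y l) = fun=> 0.
    by apply/funext => k; rewrite big1// => y _; rewrite /F ind0E (lt_geF l0) mul0r mulr0.
  exact: ccvg_cst.
have FE k : \sum_(y <- s k) F k y l = cm_integral alpha D (half_line_kernel l \o g k).
  rewrite /cm_integral (charge_integral_simple _ _ mD (mg k) (us k).1 (us k).2).
  rewrite (charge_integral_simple _ _ mD (mg k) (us k).1 (us k).2).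
  have : all (fun y => 0 <= y) (s k) by apply/allP => y; exact: s0.
  elim: (s k) => [|y t IH] /=; first by rewrite !big_nil.
  move=> /andP[y0 ht]; rewrite !big_cons IH// /F ind0E l0 mul1r ger0_norm//.
  apply: complex_ext; rewrite !ReImE/=; ring.
have hcv nu : charge_integral nu D (half_line_kernel l \o g k) @[k --> \oo] -->
    charge_integral nu D (half_line_kernel l).
  apply: (@charge_integral_cvg _ _ _ nu D (fun k => half_line_kernel l \o g k) _ 1) => //.
  - move=> k; apply: measurable_funTS.
    rewrite (_ : _ \o _ = fun x => \sum_(y <- s k) half_line_kernel l y * \1_(g k @^-1` [set y]) x).
      apply: measurable_sum => y; apply: measurable_funM => //; apply: measurable_indic.
      by rewrite -[X in measurable X]setTI; apply: mg => //; exact: measurable_set1.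
    by apply/funext => x; exact: (sum_level_sets (half_line_kernel l) (us k).1 ((us k).2 x)).
  - by move=> k x _; apply: half_line_kernel01 => //; exact: s0 ((us k).2 x).
  - move=> x; rewrite /half_line/= in_itv/= andbT => x0.
    by apply: half_line_kernel_cvg => //; [move=> -> k|exact: gx].
rewrite hPhi//; split.
  by under eq_cvg do rewrite FE; exact: hcv.
by under eq_cvg do rewrite FE; exact: hcv.
Qed.

End symbol.

(** * Extension to L^p *)

Section extension.
Context {d : measure_display} {T : measurableType d} {R : realType}.
Variable mu : {measure set T -> \bar R}.
Variable E : set R -> (T -> R[i]) -> (T -> R[i]).
Hypothesis hE : projection_valued_measure mu E.
Local Notation mR := (measurableTypeR R).
Local Notation ucalc := (ucalc mu E).
Variable p : R.
Hypothesis p1 : 1 < p.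
Variables (phi : mR -> R[i]) (r : R).
Hypothesis hphi : multiplier mu E p r phi.
Let p1' : 1 <= p. Proof. exact: ltW. Qed.
Let p0 : 0 < p. Proof. exact: lt_trans p1. Qed.
Let mphi : cmeasurable phi. Proof. by have [] := hphi. Qed.
Let r0 : 0 <= r. Proof. exact: multiplier_ge0 hphi. Qed.
Local Notation L2 := (memLp 2 mu).
Local Notation Lp := (memLp p mu).
Local Notation N := (rnorm mu p).
Implicit Types (f g h u v : T -> R[i]) (a : R[i]).

Lemma multiplier_rnorm f h : Lp f -> ucalc phi f h -> Lp h /\ N h <= r * N f.
Proof.
move=> fp ch; have [f2 h2] := ucalc_mem ch; have [_ _ bd] := hphi.
have b := bd _ _ f2 fp ch; have hp : Lp h.
  by split; [exact: h2.1|apply: le_lt_trans b _; rewrite lte_mul_pinfty// fp.2].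
by split => //; rewrite -lee_fin EFinM -!rnormE.
Qed.

(** The closure, in the product of L^p with itself, of the graph of [phi] on
    the intersection of L^2 and L^p. *)
Definition Lp_closure f h := [/\ Lp f, Lp h & forall e : R, 0 < e -> exists g u,
  [/\ Lp g, ucalc phi g u, N (fun x => f x - g x) <= e & N (fun x => h x - u x) <= e]].

Lemma Lp_closure_lin a f g h u : Lp_closure f h -> Lp_closure g u ->
  Lp_closure (fun x => a * f x + g x) (fun x => a * h x + u x).
Proof.
move=> [fp hp cf] [gp up cg]; split; [exact: memLp_lin|exact: memLp_lin|].
move=> e e0; pose e1 := e / (nc a + 1).
have a1 : 0 < nc a + 1 by rewrite ltr_wpDl ?normc_ge0.
have e10 : 0 < e1 by rewrite divr_gt0.
have [f1 [h1 [f1p c1 nf nh]]] := cf _ e10; have [g1 [u1 [g1p c2 ng nu]]] := cg _ e10.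
have [h1p _] := multiplier_rnorm f1p c1; have [u1p _] := multiplier_rnorm g1p c2.
have aux v w v1 w1 : Lp v -> Lp w -> Lp v1 -> Lp w1 -> N (fun x => v x - v1 x) <= e1 ->
    N (fun x => w x - w1 x) <= e1 ->
    N (fun x => (a * v x + w x) - (a * v1 x + w1 x)) <= e.
  move=> vp wp v1p w1p nv nw.
  have -> : (fun x => (a * v x + w x) - (a * v1 x + w1 x)) =
      fun x => a * (v x - v1 x) + (w x - w1 x) by apply/funext => x; ring.
  have dv := memLpB p1' vp v1p; have dw := memLpB p1' wp w1p.
  apply: le_trans (rnormD p1' (memLpZ a p1' dv) dw) _.
  rewrite rnormZ// (_ : e = nc a * e1 + e1); last by rewrite /e1; field; rewrite gt_eqF.
  by rewrite lerD// ler_wpM2l ?normc_ge0.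
exists (fun x => a * f1 x + g1 x), (fun x => a * h1 x + u1 x); split.
- exact: memLp_lin.
- exact: (ucalc_lin_vec hE a c1 c2).
- exact: aux.
- exact: aux.
Qed.

Lemma Lp_closure_bound f h : Lp_closure f h -> N h <= r * N f.
Proof.
move=> [fp hp cf]; apply/ler_addgt0Pr => e e0.
have e10 : 0 < e / (r + 1) by rewrite divr_gt0// ltr_wpDl.
have [g [u [gp cu nf nh]]] := cf _ e10; have [up bu] := multiplier_rnorm gp cu.
have h1 := le_rnorm_dist p1' hp up; have h2 := le_rnorm_dist p1' gp fp.
rewrite rnorm_distC in h2.
have h3 : r * N g <= r * (e / (r + 1) + N f) by rewrite ler_wpM2l// (le_trans h2)// lerD2r.
have -> : e = e / (r + 1) + r * (e / (r + 1)) by field; rewrite gt_eqF// ltr_wpDl.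
lra.
Qed.

Lemma Lp_closure_uniq f h u : Lp_closure f h -> Lp_closure f u -> ae_eqc mu h u.
Proof.
move=> ch cu; have [_ hp _] := ch; have [_ up _] := cu.
apply: (rnormB_eq0 p1' hp up).
have := Lp_closure_bound (Lp_closure_lin (-1) cu ch).
rewrite (_ : (fun x => -1 * f x + f x) = fun=> 0); last by apply/funext => x; rewrite mulN1r addNr.
rewrite {2}/rnorm cnorm0// mulr0; apply: le_trans; rewrite le_eqVlt; apply/orP; left; apply/eqP.
by apply: eq_rnorm => x; rewrite mulN1r addrC.
Qed.

Lemma Lp_closure_ucalc f h : Lp f -> ucalc phi f h -> Lp_closure f h.
Proof.
move=> fp ch; have [hp _] := multiplier_rnorm fp ch; split => // e e0.
have z v : N (fun x => v x - v x) <= e.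
  rewrite (_ : (fun x => _) = fun=> 0); first by rewrite /rnorm cnorm0// ltW.
  by apply/funext => x; rewrite subrr.
by exists f, h; split.
Qed.

(** The intersection of L^2 and L^p is dense, and the images of a Cauchy
    sequence are Cauchy because of the multiplier bound. *)
Lemma Lp_closure_exists f : Lp f -> exists h, Lp_closure f h.
Proof.
move=> fp; have [_ hB _] := hphi.
have inv0 n : 0 < (n.+1%:R : R)^-1 by rewrite invr_gt0.
have /choice[g hg] n : exists g, [/\ L2 g, Lp g &
    (cnorm p mu (fun x => f x - g x)%R <= (n.+1%:R^-1)%:E)%E].
  exact: Lp_dense.
have /choice[u hu] n : exists u, ucalc phi (g n) u.
  by have [g2 _ _] := hg n; exact: (ucalc_exists hE mphi hB g2).
have gp n : Lp (g n) by have [] := hg n.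
have up n : Lp (u n) by have [] := multiplier_rnorm (gp n) (hu n).
have fg n : N (fun x => f x - g n x) <= n.+1%:R^-1.
  by have [_ _ h] := hg n; rewrite -lee_fin -rnormE//; exact: memLpB.
have small (e : R) : 0 < e -> exists K, forall n, (K <= n)%N -> (n.+1%:R : R)^-1 <= e.
  move=> e0; have /cvgrPdist_le /(_ _ e0)[K _ hK] := @cvg_harmonic R.
  by exists K => n /hK; rewrite /= sub0r normrN ger0_norm ?(ltW (inv0 _)).
have [|h hp hcv] := @Lp_complete _ _ _ mu p u p1' up.
  move=> e e0; have e20 : 0 < e / (2 * (r + 1)) by rewrite divr_gt0// mulr_gt0// ltr_wpDl.
  have [K hK] := small _ e20; exists K => j k Kj Kk.
  rewrite rnormE; last exact: memLpB.
  have cjk := ucalc_lin_vec hE (-1) (hu k) (hu j).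
  have [_ b] := multiplier_rnorm (memLp_lin (-1) p1' (gp k) (gp j)) cjk.
  have eN v w : N (fun x => -1 * v x + w x) = N (fun x => w x - v x).
    by apply: eq_rnorm => x; rewrite mulN1r addrC.
  rewrite !eN in b; rewrite lee_fin; apply: le_trans b _.
  have t := rnorm_triangle p1' (gp j) fp (gp k).
  have f1 := le_trans (fg j) (hK _ Kj); have f2 := le_trans (fg k) (hK _ Kk).
  have t2 : N (fun x => g j x - g k x) <= e / (r + 1).
    rewrite (_ : e / (r + 1) = e / (2 * (r + 1)) + e / (2 * (r + 1))).
      by apply: le_trans t _; apply: lerD; [rewrite rnorm_distC|].
    by field; rewrite gt_eqF// ltr_wpDl.
  apply: le_trans (ler_wpM2l r0 t2) _.
  by rewrite mulrCA ger_pMr// ler_pdivrMr ?ltr_wpDl// mul1r lerDl.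
exists h; split => // e e0; have [K1 h1] := small _ e0; have [K2 h2] := hcv _ e0.
pose k := maxn K1 K2; exists (g k), (u k); split => //.
- by apply: le_trans (fg k) _; apply: h1; exact: leq_maxl.
- rewrite rnorm_distC -lee_fin -rnormE; last exact: memLpB.
  by apply: h2; exact: leq_maxr.
Qed.

(** On the intersection of L^2 and L^p the value is taken from the functional
    calculus, elsewhere from the closure of its graph; both lie in that
    closure, which is single-valued, linear and bounded. *)
Lemma multiplier_extension : exists Tp : (T -> R[i]) -> (T -> R[i]),
  [/\ forall (a : R[i]) f g, Lp f -> Lp g ->
        ae_eqc mu (Tp (fun x => a * f x + g x)) (fun x => a * Tp f x + Tp g x),
      forall f, L2 f -> Lp f -> spectral_integral mu E phi f (Tp f)
    & forall f, Lp f -> Lp (Tp f) /\ (cnorm p mu (Tp f) <= r%:E * cnorm p mu f)%E].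
Proof.
have [_ hB _] := hphi.
have /choice[Tp hTp] f : exists h, Lp f -> Lp_closure f h /\ (L2 f -> ucalc phi f h).
  have [f2|nf2] := pselect (L2 f).
    have [h ch] := ucalc_exists hE mphi hB f2; exists h => fp; split => //.
    exact: Lp_closure_ucalc.
  have [fp|nfp] := pselect (Lp f); last by exists f.
  by have [h ch] := Lp_closure_exists fp; exists h.
exists Tp; split.
- move=> a f g fp gp; have [cf _] := hTp _ fp; have [cg _] := hTp _ gp.
  have [cfg _] := hTp _ (memLp_lin a p1' fp gp).
  exact: (Lp_closure_uniq cfg (Lp_closure_lin a cf cg)).
- move=> f f2 fp; have [_ /(_ f2) c] := hTp _ fp.
  exact: (ucalc_spectral_integral hE mphi c).
- move=> f fp; have [c _] := hTp _ fp; have [_ hp _] := c; split => //.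
  by rewrite !rnormE// -EFinM lee_fin; exact: Lp_closure_bound.
Qed.

End extension.

Lemma pstar_ge2 (R : realType) (p : R) : 1 < p -> 2 <= pstar p.
Proof.
move=> p1; rewrite /pstar le_max; have [//|p2] := leP 2 p.
by rewrite /= ler_pdivlMr ?subr_gt0//; lra.
Qed.

Theorem theorem1p1 (R : realType) (n : nat) (M : ptopologicalType)
    (atlas : set (chart R n M)) (mu : {measure set (borel M) -> \bar R})
    (Delta : (M -> R) -> M -> R)
    (d : measure_display) (Om : measurableType d)
    (X : R -> Om -> opc M) (P : opc M -> probability Om R)
    (Phi : R -> R[i]) (alpha : complex_measure (measurableTypeR R) R)
    (E : set R -> (M -> R[i]) -> (M -> R[i])) (p : R) :
  smooth_manifold atlas ->
  diffusion_operator atlas Delta ->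
  locally_subelliptic atlas Delta ->
  smooth_measure atlas mu ->
  symmetric_wrt atlas mu Delta ->
  essentially_self_adjoint atlas mu Delta ->
  diffusion_process atlas Delta X P ->
  non_explosive X P ->
  spectral_resolution mu (minus_Delta atlas mu Delta) E ->
  bounded_borel Phi ->
  (forall x : R, 0 <= x ->
    Phi x = cm_integral alpha (@half_line R)
              (fun m => 1 - m / Num.sqrt (m ^+ 2 + x))) ->
  1 < p ->
  exists Tp : (M -> R[i]) -> (M -> R[i]),
  [/\ forall (a : R[i]) f g, memLp p mu f -> memLp p mu g ->
        ae_eqc mu (Tp (fun x => a * f x + g x))
                  (fun x => a * Tp f x + Tp g x),
      forall f, memLp 2 mu f -> memLp p mu f ->
        functional_calculus mu E Phi f (Tp f)
    & forall f, memLp p mu f ->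
        memLp p mu (Tp f) /\
        (cnorm p mu (Tp f) <=
           (2 * (pstar p - 1))%:E * cm_variation alpha (@half_line R) *
           cnorm p mu f)%E].
Proof.
move=> hM hD _ hmu hsym _ _ _ hspec _ hPhi p1.
have hdiss : dissipative_graph mu (minus_Delta atlas mu Delta).
  by move=> u v a psi L; exact: (minus_Delta_dissipative hM hD hmu hsym).
have hmult := multiplier_half_line_integral hspec hdiss p1 hPhi.
have [Tp [lin spec bound]] := multiplier_extension hspec.1 p1 hmult.
exists Tp; split => // f fp; have [hp b] := bound _ fp; split => //.
apply: le_trans b _; rewrite lee_wpmul2r ?cnorm_ge0//.
have mD : measurable (@half_line R : set (measurableTypeR R)) by exact: measurable_itv.
have V0 := cm_variation_ge0 alpha mD; have Voo := cm_variation_lty alpha mD.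
rewrite EFinM fineK ?ge0_fin_numE// lee_wpmul2r// lee_fin.
by have := pstar_ge2 p1; lra.
Qed.
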